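(* Let $d\ge2$ be an integer, let $\alpha\in(0,\infty)$ and $\eta\in(0,1]$. Suppose $(\lambda(n))_{n \in\mathbb{N}}$ is an increasing $(0,\infty)$-valued sequence that tends to $\infty$ as $n \to\infty$, and $(\phi_\lambda)_{\lambda>0}$ is a collection of connection functions in $\Phi_{d,\eta}$. Suppose that as $\lambda\to\infty$ along the sequence $(\lambda(n))$, we have $$\lambda\int_{\Gamma} \exp \Bigl( - \lambda\int_{\Gamma} \phi_\lambda(y-x) \,dy \Bigr) \,dx \to\alpha.$$ Then for $k \in\mathbb{N}_0=\{0,1,\ldots\}$ we have, as $\lambda\to\infty$ along the same sequence, that $$P\bigl[N_0( G_{\phi_\lambda}(\mathcal{P}_\lambda)) =k \bigr] \to e^{-\alpha} \alpha^k/k!.$$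
   Context: Let $\Gamma=[0,1]^d$ and let $|\cdot|$ be the Euclidean norm on $\mathbb{R}^d$. $\mathcal{P}_\lambda$ is a homogeneous Poisson point process of intensity $\lambda$ on $\Gamma$, viewed as a random set. A connection function on $\mathbb{R}^d$ is a measurable $\phi:\mathbb{R}^d\to[0,1]$ with $\phi(x)=\phi(-x)$ for all $x$. For a locally finite set $\mathcal{X}\subset\mathbb{R}^d$ and a connection function $\phi$, $G_\phi(\mathcal{X})$ is the random graph with vertex set $\mathcal{X}$ in which each possible edge $\{x,y\}$ ($x\ne y$ in $\mathcal{X}$) is present with probability $\phi(x-y)$, independently of all other possible edges; $G_\phi(\mathcal{P}_\lambda)$ is obtained by applying this conditionally on $\mathcal{P}_\lambda$. $N_0(G)$ is the number of isolated vertices of the graph $G$. For a connection function $\phi$ put $\mu(\phi)=\sup_{x}\phi(x)$ and, for $\eta>0$, $\rho_\eta(\phi)=\inf\{|x|: x\in\mathbb{R}^d,\ \phi(x)<\eta\mu(\phi)\}$. $\Psi_d$ is the class of connection functions on $\mathbb{R}^d$ with $\phi(x)\ge\phi(y)$ whenever $|x|\le|y|$. $\Phi_{d,\eta}$ is the class of connection functions $\phi$ on $\mathbb{R}^d$ such that (i) $\rho_\eta(\phi)\in(0,\infty)$; (ii) $\phi(x)\le 3\eta^{-1}\mu(\phi)\exp(-\eta(|x|/\rho_\eta(\phi))^\eta)$ for all $x\in\mathbb{R}^d$; (iii) if $d\ge3$ then $\phi\in\Psi_d$. *)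

(* Defs.v *)
From HB Require Import structures.
From mathcomp Require Import all_boot all_order all_algebra.
From mathcomp Require Import all_classical all_reals all_analysis.
From mathcomp Require Import measurable_realfun.

Set Implicit Arguments.
Unset Strict Implicit.
Unset Printing Implicit Defensive.

Import Order.TTheory GRing.Theory Num.Theory.
Import numFieldNormedType.Exports.

Local Open Scope classical_set_scope.
Local Open Scope ring_scope.

(* R^n is 'rV[R]_n with the sigma-algebra generated by the n coordinate maps,
   i.e. the Borel sigma-algebra. *)
Definition rV_coord (R : realType) n (i : 'I_n) (v : 'rV[R]_n) : R := v ord0 i.

Lemma rV_measurable0 (R : realType) n : g_sigma_preimage (@rV_coord R n) set0.
Proof. exact: sigma_algebra0. Qed.

Lemma rV_measurableC (R : realType) n (A : set 'rV[R]_n) :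
  g_sigma_preimage (@rV_coord R n) A -> g_sigma_preimage (@rV_coord R n) (~` A).
Proof. exact: sigma_algebraC. Qed.

Lemma rV_measurable_bigcup (R : realType) n (F : (set 'rV[R]_n)^nat) :
  (forall i, g_sigma_preimage (@rV_coord R n) (F i)) ->
  g_sigma_preimage (@rV_coord R n) (\bigcup_i F i).
Proof. exact: sigma_algebra_bigcup. Qed.

Definition rV_display : measure_display -> measure_display.
Proof. exact. Qed.

HB.instance Definition _ (R : realType) n :=
  @isMeasurable.Build (rV_display default_measure_display) 'rV[R]_n
    (g_sigma_preimage (@rV_coord R n))
    (@rV_measurable0 R n) (@rV_measurableC R n) (@rV_measurable_bigcup R n).

Lemma measurable_rV_coord (R : realType) n (i : 'I_n) :
  measurable_fun [set: 'rV[R]_n] (@rV_coord R n i).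
Proof.
move=> _ Y mY; rewrite setTI; apply: sub_sigma_algebra => /=.
rewrite -bigcup_seq/=; exists i => /=; first by rewrite mem_index_enum.
by exists Y => //; rewrite setTI.
Qed.

Lemma measurable_fun_rVP d (T : measurableType d) (R : realType) n
    (f : T -> 'rV[R]_n) :
  measurable_fun [set: T] f <->
  forall i, measurable_fun [set: T] (fun x => f x ord0 i).
Proof.
split=> [mf i|mf].
  exact: (measurableT_comp (measurable_rV_coord i) mf).
move=> _ Y mY; rewrite setTI.
pose M : set (set 'rV[R]_n) := [set A | measurable (f @^-1` A)].
suff : g_sigma_preimage (@rV_coord R n) `<=` M by apply.
apply: smallest_sub.
  split => /=.
  - by rewrite /M/= preimage_set0.
  - by move=> A mA; rewrite /M/= setTD preimage_setC; exact: measurableC.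
  - move=> F mF; rewrite /M/= preimage_bigcup.
    by apply: bigcup_measurable => k _; exact: mF.
rewrite -bigcup_seq => A [i _ [B mB <-]]; rewrite /M/= setTI -comp_preimage.
by rewrite -[X in measurable X]setTI; exact: mf.
Qed.

Definition rV_cons (R : realType) n (p : R * 'rV[R]_n) : 'rV[R]_n.+1 :=
  \row_i (if unlift ord0 i is Some j then p.2 ord0 j else p.1).

Lemma rV_cons0 (R : realType) n (p : R * 'rV[R]_n) : rV_cons p ord0 ord0 = p.1.
Proof. by rewrite mxE unlift_none. Qed.

Lemma rV_consS (R : realType) n (p : R * 'rV[R]_n) (j : 'I_n) :
  rV_cons p ord0 (lift ord0 j) = p.2 ord0 j.
Proof. by rewrite mxE liftK. Qed.

Lemma measurable_rV_cons (R : realType) n :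
  measurable_fun [set: R * 'rV[R]_n] (@rV_cons R n).
Proof.
apply/measurable_fun_rVP => i; case: (unliftP ord0 i) => [j ->|->].
- rewrite (_ : (fun _ => _) = @rV_coord R n j \o snd).
    exact: (measurableT_comp (measurable_rV_coord j) measurable_snd).
  by apply/funext => p; exact: rV_consS.
- rewrite (_ : (fun _ => _) = fst); first exact: measurable_fst.
  by apply/funext => p; exact: rV_cons0.
Qed.

(* Lebesgue measure on R^n, by iterating products with the one-dimensional
   Lebesgue measure; lebesgue_rV_box below evaluates it on boxes. *)
Fixpoint lebesgue_rV (R : realType) (n : nat) : set 'rV[R]_n -> \bar R :=
  match n with
  | 0 => \d_(0 : 'rV[R]_0)
  | m.+1 => pushforward (@lebesgue_measure R \x @lebesgue_rV R m)%E (@rV_cons R m)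
  end.
Arguments lebesgue_rV : clear implicits.

Lemma sigma_finite_measureP d (T : measurableType d) (R : realType)
    (mu : set T -> \bar R) :
  mu set0 = 0%E -> (forall A, (0 <= mu A)%E) -> semi_sigma_additive mu ->
  sigma_finite setT mu ->
  exists m : {sigma_finite_measure set T -> \bar R},
    mu = m :> (set T -> \bar R).
Proof.
move=> mu0 mu_ge0 mu_add mu_fin.
pose muM := isMeasure.Build _ _ _ mu mu0 mu_ge0 mu_add.
pose m0 : {measure set T -> \bar R} := HB.pack mu muM.
pose muS := Measure_isSigmaFinite.Build _ _ _ (m0 : set T -> \bar R) mu_fin.
pose m1 : {sigma_finite_measure set T -> \bar R} := HB.pack mu muM muS.
by exists m1.
Qed.

Lemma lebesgue_rV_subproof (R : realType) n :
  exists mu : {sigma_finite_measure set 'rV[R]_n -> \bar R},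
    lebesgue_rV R n = mu :> (set 'rV[R]_n -> \bar R).
Proof.
elim: n => [|n [mu muE]].
  by exists (\d_(0 : 'rV[R]_0)).
pose h : 'rV[R]_n.+1 -> R * 'rV[R]_n :=
  fun v => (v ord0 ord0, \row_j v ord0 (lift ord0 j)).
have hK p : h (rV_cons p) = p.
  case: p => x v; rewrite /h rV_cons0; congr pair.
  by apply/rowP => j; rewrite mxE rV_consS.
have mh : measurable_fun [set: 'rV[R]_n.+1] h.
  apply/measurable_fun_pairP; split.
    exact: measurable_rV_coord.
  apply/measurable_fun_rVP => i.
  rewrite (_ : (fun _ => _) = @rV_coord R n.+1 (lift ord0 i)).
    exact: measurable_rV_coord.
  by apply/funext => v /=; rewrite mxE.
pose l1 : {sigma_finite_measure set (measurableTypeR R) -> \bar R} :=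
  @lebesgue_measure R.
pose pm : {measure set (measurableTypeR R * 'rV[R]_n)%type -> \bar R} :=
  (l1 \x mu)%E.
pose nu := pushforward pm (@rV_cons R n).
have nu0 : nu set0 = 0%E by rewrite /nu /pushforward preimage_set0 measure0.
have nu_ge0 A : (0 <= nu A)%E by exact: (measure_ge0 pm).
have nu_add : semi_sigma_additive nu.
  move=> F mF tF mUF; rewrite /nu /pushforward preimage_bigcup.
  apply: measure_semi_sigma_additive.
  - by move=> k; rewrite -[X in measurable X]setTI; exact: measurable_rV_cons.
  - apply/trivIsetP => /= i j _ _ ij; rewrite -preimage_setI.
    by move/trivIsetP : tF => /(_ _ _ _ _ ij) ->//; rewrite preimage_set0.
  - rewrite -preimage_bigcup -[X in measurable X]setTI.
    exact: measurable_rV_cons.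
have nu_fin : sigma_finite setT nu.
  have /sigma_finiteP[F [TF ndF Foo]] := sigma_finiteT l1.
  have /sigma_finiteP[G [TG ndG Goo]] := sigma_finiteT mu.
  exists (fun k => h @^-1` (F k `*` G k)).
    apply/seteqP; split=> [v _|]; last by [].
    have [i _ Fi] : (\bigcup_i F i) (h v).1 by rewrite -TF.
    have [j _ Gj] : (\bigcup_i G i) (h v).2 by rewrite -TG.
    exists (maxn i j) => //; split.
      by move: (h v).1 Fi; exact/subsetPset/ndF/leq_maxl.
    by move: (h v).2 Gj; exact/subsetPset/ndG/leq_maxr.
  move=> k; have [mF Fk] := Foo k; have [mG Gk] := Goo k.
  have mFG : measurable (F k `*` G k) by exact: measurableX.
  split; first by rewrite -[X in measurable X]setTI; exact: mh.
  rewrite /nu /pushforward -comp_preimage (_ : h \o _ = id); last first.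
    by apply/funext => p /=; exact: hK.
  rewrite preimage_id /pm/= product_measure1E//.
  by rewrite lte_mul_pinfty// ge0_fin_numE.
have [m mE] := sigma_finite_measureP nu0 nu_ge0 nu_add nu_fin.
by exists m; rewrite -mE /= muE.
Qed.

Lemma lebesgue_rV_measure0 (R : realType) n : lebesgue_rV R n set0 = 0%E.
Proof. by have [mu ->] := lebesgue_rV_subproof R n; exact: measure0. Qed.

Lemma lebesgue_rV_ge0 (R : realType) n A : (0 <= lebesgue_rV R n A)%E.
Proof. by have [mu ->] := lebesgue_rV_subproof R n; exact: measure_ge0. Qed.

Lemma lebesgue_rV_sigma_additive (R : realType) n :
  semi_sigma_additive (lebesgue_rV R n).
Proof.
by have [mu ->] := lebesgue_rV_subproof R n; exact: measure_semi_sigma_additive.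
Qed.

Lemma lebesgue_rV_sigma_finite (R : realType) n :
  sigma_finite setT (lebesgue_rV R n).
Proof. by have [mu ->] := lebesgue_rV_subproof R n; exact: sigma_finiteT. Qed.

HB.instance Definition _ (R : realType) n := isMeasure.Build _ _ _
  (lebesgue_rV R n) (@lebesgue_rV_measure0 R n) (@lebesgue_rV_ge0 R n)
  (@lebesgue_rV_sigma_additive R n).

HB.instance Definition _ (R : realType) n := Measure_isSigmaFinite.Build _ _ _
  (lebesgue_rV R n) (@lebesgue_rV_sigma_finite R n).

Definition rV_box (R : realType) n (a b : 'I_n -> R) : set 'rV[R]_n :=
  [set v | forall i, a i <= v ord0 i <= b i].

Lemma measurable_rV_box (R : realType) n (a b : 'I_n -> R) :
  measurable (rV_box a b).
Proof.
rewrite (_ : rV_box a b =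
    \big[setI/setT]_(i < n) (@rV_coord R n i @^-1` `[a i, b i])).
  apply: bigsetI_measurable => i _.
  by rewrite -[X in measurable X]setTI; exact: measurable_rV_coord.
rewrite -bigcap_seq; apply/seteqP; split => v vab i.
- by move=> _ /=; rewrite in_itv/=; exact: vab.
- by have /= := vab i (mem_index_enum i); rewrite in_itv.
Qed.

Lemma lebesgue_rV_box (R : realType) n (a b : 'I_n -> R) :
  (forall i, a i <= b i) ->
  lebesgue_rV R n (rV_box a b) = (\prod_(i < n) (b i - a i))%:E.
Proof.
elim: n a b => [|n IHn] a b ab.
  by rewrite big_ord0 /= diracE mem_set// => -[].
rewrite big_ord_recl EFinM -(IHn (a \o lift ord0) (b \o lift ord0)); last first.
  by move=> i; exact: ab.
rewrite /= /pushforward.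
have -> : @rV_cons R n @^-1` rV_box a b =
    `[a ord0, b ord0]%classic `*` rV_box (a \o lift ord0) (b \o lift ord0).
  apply/seteqP; split => [p pab|p [/= p1 p2] i].
    split; first by have /= := pab ord0; rewrite rV_cons0 in_itv.
    by move=> j; have := pab (lift ord0 j); rewrite rV_consS.
  by case: (unliftP ord0 i) => [j ->|->];
    [rewrite rV_consS; exact: p2|rewrite rV_cons0; move: p1; rewrite in_itv].
rewrite product_measure1E//=; last exact: measurable_rV_box.
congr (_ * _)%E; rewrite lebesgue_measure_itv/= lte_fin.
by case: ltP => // ba; rewrite (@le_anti _ _ (b ord0) (a ord0)) ?subrr// ba ab.
Qed.

Definition unit_cube (R : realType) d : set 'rV[R]_d :=
  rV_box (fun=> 0) (fun=> 1).
Arguments unit_cube : clear implicits.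

(* The library norm on 'rV[R]_d is the sup norm. *)
Definition enorm (R : realType) d (x : 'rV[R]_d) : R :=
  Num.sqrt (\sum_(i < d) x ord0 i ^+ 2).

Record connection_function (R : realType) d (phi : 'rV[R]_d -> R) : Prop := {
  connection_measurable : measurable_fun [set: 'rV[R]_d] phi ;
  connection_itv : forall x, 0 <= phi x <= 1 ;
  connection_even : forall x, phi (- x) = phi x }.

Definition conn_sup (R : realType) d (phi : 'rV[R]_d -> R) : R :=
  sup (range phi).

(* Extended-real valued, since the infimum is +oo when phi is nowhere below
   eta * conn_sup phi. *)
Definition conn_radius (R : realType) d (eta : R) (phi : 'rV[R]_d -> R)
    : \bar R :=
  ereal_inf [set (enorm x)%:E | x in [set x | phi x < eta * conn_sup phi]].

Definition Psi_class (R : realType) d (phi : 'rV[R]_d -> R) : Prop :=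
  connection_function phi /\
  forall x y, enorm x <= enorm y -> phi y <= phi x.

Record Phi_class (R : realType) d (eta : R) (phi : 'rV[R]_d -> R) : Prop := {
  Phi_connection : connection_function phi ;
  Phi_radius : (0 < conn_radius eta phi < +oo)%E ;
  Phi_decay : forall x,
    phi x <= 3 * eta^-1 * conn_sup phi *
      expR (- eta * (enorm x / fine (conn_radius eta phi)) `^ eta) ;
  Phi_mono : (3 <= d)%N -> Psi_class phi }.

Record graph (V : Type) := Graph {
  vertices : set V ;
  adj : V -> V -> Prop ;
  adj_vertices : forall x y, adj x y -> vertices x /\ vertices y ;
  adj_irrefl : forall x, ~ adj x x ;
  adj_sym : forall x y, adj x y -> adj y x }.

Definition isolated (V : Type) (G : graph V) : set V :=
  [set x | vertices G x /\ forall y, ~ adj G x y].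

Definition N0 (R : realType) (V : choiceType) (G : graph V) : \bar R :=
  counting (isolated G).
Arguments N0 : clear implicits.
Arguments N0 R {V} G.

(* The library's poisson_pmf is 1 at every k when the rate is 0, which would be
   wrong here for null sets; note 0 ^+ 0 = 1. *)
Definition poisson_mass (R : realType) (r : R) (k : nat) : R :=
  expR (- r) * r ^+ k / k`!%:R.

Definition num_points (R : realType) (V : choiceType) (X A : set V) : \bar R :=
  counting (X `&` A).
Arguments num_points R {V} X A.

(* X is a homogeneous Poisson process of intensity lambda on the unit cube, seen
   as a random finite set. *)
Record poisson_process (R : realType) d disp (T : measurableType disp)
    (P : probability T R) (lambda : R) (X : T -> set 'rV[R]_d) : Prop := {
  poisson_support : forall w, X w `<=` unit_cube R d ;
  poisson_finite : forall w, finite_set (X w) ;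
  poisson_measurable : forall A, measurable A ->
    measurable_fun [set: T] (fun w => num_points R (X w) A) ;
  poisson_count : forall A k, measurable A ->
    P [set w | num_points R (X w) A = k%:R%:E] =
    (poisson_mass (lambda * fine (lebesgue_rV R d (A `&` unit_cube R d))) k)%:E ;
  poisson_indep : forall m (A : 'I_m -> set 'rV[R]_d) (k : 'I_m -> nat),
    (forall i, measurable (A i)) -> trivIset [set: 'I_m] A ->
    P (\bigcap_i [set w | num_points R (X w) (A i) = (k i)%:R%:E]) =
    (\prod_(i < m) P [set w | num_points R (X w) (A i) = (k i)%:R%:E])%E }.

(* Probability that the random graph G_phi on the n distinct points x i has
   exactly the edges prescribed by e (only the values e i j with i < j are
   used). *)
Definition edge_prob (R : realType) d (phi : 'rV[R]_d -> R) n
    (x : 'I_n -> 'rV[R]_d) (e : rel 'I_n) : R :=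
  \prod_(i < n) \prod_(j < n | (i < j)%N)
    (if e i j then phi (x i - x j) else 1 - phi (x i - x j)).

(* G w is a realisation of G_phi(P_lambda): its vertex set is a Poisson process
   and, listing the vertices measurably as Y 0, ..., Y (N - 1), the edges are
   conditionally independent given N and Y 0, ..., Y (N - 1), the edge between
   Y i and Y j being present with probability phi (Y i - Y j). *)
Record poisson_random_graph (R : realType) d disp (T : measurableType disp)
    (P : probability T R) (lambda : R) (phi : 'rV[R]_d -> R)
    (G : T -> graph 'rV[R]_d) : Prop := {
  prg_vertices : poisson_process P lambda (fun w => vertices (G w)) ;
  prg_edges : exists (N : T -> nat) (Y : nat -> T -> 'rV[R]_d),
    [/\ measurable_fun [set: T] N,
        forall i, measurable_fun [set: T] (Y i),
        forall w, set_bij `I_(N w) (vertices (G w)) (fun i => Y i w),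
        forall i j, measurable [set w | adj (G w) (Y i w) (Y j w) /\
                                        (i < j < N w)%N] &
        forall n (B : set (n.-tuple 'rV[R]_d)) (e : rel 'I_n), measurable B ->
          let A := [set w | N w = n /\ B [tuple Y i w | i < n]] in
          P (A `&` [set w | forall i j : 'I_n, (i < j)%N ->
                      adj (G w) (Y i w) (Y j w) <-> e i j]) =
          (\int[P]_(w in A) (edge_prob phi (fun i : 'I_n => Y i w) e)%:E)%E] }.

(* Main.v *)
(* The idea is a coupling recursion rather than the Chen-Stein method.  Let p_k be
   the probability of k isolated vertices, and m their mean number.  By Mecke's
   formula (k+1) p_(k+1) = lambda * int Q_k(x) dx, where Q_k(x) is the probability
   that an added vertex x is isolated and exactly k others are.  Given that x is
   isolated, the remaining vertices form a thinned Poisson process; comparing it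
   with the unthinned one costs at most
     err = lambda^2 iint q(x) q(y) (phi(y-x) + e^(lambda int phi(z-x) phi(z-y) dz) - 1),
   where q(x) = e^(-lambda int phi(z-x) dz), so that m p_k <= (k+1) p_(k+1) + err.  Since sum_k k p_k <= m and
   sum_k p_k = 1, m -> alpha and err -> 0 force (k+1) p_(k+1) - alpha p_k -> 0,
   which determines the Poisson limit.

   For err -> 0, the main point is a lower bound, for x <> y in the cube, on the
   mass of phi around y that phi around x does not see,
     D(x,y) = int phi(z-y) (1 - phi(z-x)) dz,
   because q(y) e^(lambda int phi(z-x) phi(z-y) dz) = e^(-lambda D(x,y)).  Moving a small box
   along an arithmetic progression of step u inside the cube until phi has decayed
   makes the integrals of phi (1 - phi(. + u)) telescope.  For d >= 3 radial
   monotonicity lets u be parallel to an axis; for d = 2 one takes u = y - x,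
   which only fails near the corners of the square, whose contribution is
   negligible. *)
Require Import Defs.
From HB Require Import structures.
From mathcomp Require Import all_boot all_order all_algebra fingroup perm finmap.
From mathcomp Require Import ring lra.

Set Implicit Arguments.
Unset Strict Implicit.
Unset Printing Implicit Defensive.

Import Order.TTheory GRing.Theory Num.Theory.

(** * Finite random graphs *)

(** Only a lower bound on each defect (k+1) p_(k+1) - m p_k is needed: the sum of the defects over k
    <= M is at most m^2/(M+1), so the lower bounds also bound each defect from above. This is why
    the comparison with the thinned process may lose in one direction. Deleting a vertex y changes
    the count either because y was isolated, which gives phi(y-x), or because another vertex becomes
    isolated, which gives the exponential minus 1. The integrand of err is at most both q(x)
    e^(-lambda D(x,y)) and q(y) e^(-lambda D(y,x)), so the progression may start from whichever
    point has room in the cube. Convergence of m forces lambda mu min(1,rho)^d to be of order log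
    lambda = s^4, with mu the supremum and rho the radius of phi. If mu <= s^-8 the exponent is
    small for all pairs; otherwise it is small for pairs more than about s^4 rho apart, and the
    other pairs fill a volume polynomial in s, against which e^(-c s) wins. The graph lists its
    vertices in an arbitrary measurable numbering, so only functionals symmetric in the points have
    a known law. *)

Lemma perm_nat_card n (J : finType) (f g : 'I_n -> J) :
  #|[set s : {perm 'I_n} | [forall i, g (s i) == f i]]| =
  if [forall j, #|[set i | f i == j]| == #|[set i | g i == j]|]
  then \prod_j (#|[set i | f i == j]|)`! else 0.
Proof.
elim: n f g => [|n IH] f g.
  have e0 (h : 'I_0 -> J) j : #|[set i | h i == j]| = 0.
    by apply: eq_card0 => -[].
  rewrite (_ : [forall j, _] = true); last by apply/forallP => j; rewrite !e0.
  rewrite big1 => [|j _]; last by rewrite e0.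
  apply/eqP/cards1P; exists (1%g : {perm 'I_0}).
  by apply/setP => s; rewrite !inE; apply/forallP/eqP => [_|_ []//];
    apply/permP => -[].
have cardE (h : 'I_n.+1 -> J) (a : 'I_n.+1) j :
    #|[set i | h i == j]| = (h a == j) + #|[set i | h (lift a i) == j]|.
  rewrite -!sum1_card (big_mkcond (fun i => i \in _)) /= (bigD1_ord a) //=.
  congr addn; first by rewrite inE; case: (h a == j).
  by rewrite -big_mkcond /=; apply: eq_bigl => i; rewrite !inE.
(* Induction on [n]: the image [a] of [ord0] must lie in the [g]-fibre of [f ord0], and [lift_perm]
   identifies the rest of [s] with a permutation of [n] indices. The number of choices of [a]
   supplies the leading factor of one factorial. *)
transitivity (\sum_(a : 'I_n.+1 | g a == f ord0)
   #|[set s : {perm 'I_n} | [forall i, g (lift a (s i)) == f (lift ord0 i)]]|).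
  rewrite -sum1_card (partition_big (fun s : {perm 'I_n.+1} => s ord0)
    (fun a => g a == f ord0)) /=; last first.
    by move=> s; rewrite inE => /forallP/(_ ord0).
  apply: eq_bigr => a ga.
  rewrite (reindex (lift_perm ord0 a)) /=; last first.
    pose del (s : {perm 'I_n.+1}) (k : 'I_n) : 'I_n := odflt k (unlift (s ord0) (s (lift ord0 k))).
    have delK (s : {perm 'I_n.+1}) k : lift (s ord0) (del s k) = s (lift ord0 k).
      have : s ord0 != s (lift ord0 k) by rewrite (inj_eq perm_inj) neq_lift.
      by rewrite /del => /unlift_some[l E1 E2]; rewrite E2 E1.
    have del_inj s : injective (del s).
      move=> k l /(congr1 (lift (s ord0))); rewrite !delK => /perm_inj.
      exact: lift_inj.
    exists (fun s => perm (@del_inj s)) => s; rewrite inE.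
      move=> _; apply/permP => k; rewrite permE; apply: (@lift_inj _ a).
      by have := delK (lift_perm ord0 a s) k; rewrite lift_perm_id lift_perm_lift.
    move=> /andP[_ /eqP sa]; apply/permP => k.
    case: (unliftP ord0 k) => [l|] ->; last by rewrite lift_perm_id.
    by rewrite lift_perm_lift permE -sa delK.
  rewrite -sum1_card; apply: eq_bigl => s; rewrite !inE lift_perm_id eqxx andbT.
  apply/forallP/forallP => H i.
    by have := H (lift ord0 i); rewrite lift_perm_lift.
  case: (unliftP ord0 i) => [k ->|->]; last by rewrite lift_perm_id.
  by rewrite lift_perm_lift; exact: H.
under [LHS]eq_bigr => a _ do
  rewrite (IH (fun i => f (lift ord0 i)) (fun i => g (lift a i))).
case: ifPn => [/forallP fg|]; last first.
  move/forallPn => [j jfg]; apply: big1 => a ga; rewrite ifF //.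
  apply/negP => /forallP/(_ j)/eqP E; case/negP: jfg.
  by rewrite (cardE f ord0) (cardE g a) E (eqP ga).
rewrite (eq_bigr (fun=> \prod_j (#|[set i | f (lift ord0 i) == j]|)`!)); last first.
  move=> a ga; rewrite ifT //; apply/forallP => j.
  by have := fg j; rewrite (cardE f ord0) (cardE g a) (eqP ga) eqn_add2l.
rewrite sum_nat_const.
have -> : #|[pred a | g a == f ord0]| = #|[set i | f i == f ord0]|.
  by rewrite (eqP (fg (f ord0))); apply: eq_card => a; rewrite !inE.
rewrite [RHS](bigD1 (f ord0)) //= (bigD1 (f ord0)) //= mulnA.
congr (_ * _)%N; last first.
  apply: eq_bigr => j jf; rewrite [in RHS](cardE f ord0).
  by rewrite eq_sym (negbTE jf).
by rewrite (cardE f ord0) eqxx factS.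
Qed.

Local Open Scope ring_scope.

Definition touching n (A J : {set 'I_n}) : {set 'I_n * 'I_n} :=
  [set p | [&& p.1 \in A, p.2 \in A, p.1 != p.2 & (p.1 \in J) || (p.2 \in J)]].

Definition no_edge (R : comNzRingType) n (w : 'I_n -> 'I_n -> R) (A J : {set 'I_n}) : R :=
  \prod_(p in touching A J | (p.1 < p.2)%N) (1 - w p.1 p.2).

(* Inclusion-exclusion over the set [J] of vertices required to be isolated: the
   coefficient of ['X^k] is the probability that exactly [k] vertices of [A] are
   isolated in the random graph on [A]. *)
Definition iso_pgf (R : comNzRingType) n (w : 'I_n -> 'I_n -> R) (A : {set 'I_n}) :
    {poly R} :=
  \sum_(J : {set 'I_n} | J \subset A) no_edge w A J *: ('X - 1) ^+ #|J|.

(** Law of the random edge set. All ordered pairs are drawn independently, the non-increasing ones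
    with probability 0, so that sums over [e] factor by distributivity over the full product. *)
Definition edge_weight (R : comNzRingType) n (w : 'I_n -> 'I_n -> R)
    (e : {set 'I_n * 'I_n}) : R :=
  \prod_p (if p \in e then (if (p.1 < p.2)%N then w p.1 p.2 else 0)
           else 1 - (if (p.1 < p.2)%N then w p.1 p.2 else 0)).

Definition iso_set n (A : {set 'I_n}) (e : {set 'I_n * 'I_n}) : {set 'I_n} :=
  [set i in A | [forall j in A, (j != i) ==>
     ~~ ((i, j) \in e) && ~~ ((j, i) \in e)]].

Lemma in_touching n (A J : {set 'I_n}) p : (p \in touching A J) =
  [&& p.1 \in A, p.2 \in A, p.1 != p.2 & (p.1 \in J) || (p.2 \in J)].
Proof. by rewrite inE. Qed.

Lemma in_iso_set n (A : {set 'I_n}) (e : {set 'I_n * 'I_n}) i : (i \in iso_set A e) =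
  (i \in A) && [forall j in A, (j != i) ==> ~~ ((i, j) \in e) && ~~ ((j, i) \in e)].
Proof. by rewrite inE. Qed.

Definition isoE := (in_touching, in_iso_set).

Section no_edge.
Context (R : realDomainType).

(** Squaring restores the pairs in decreasing order. A relabelling need not preserve the order of
    the indices, so identities for [no_edge] are checked on squares and extracted by
    nonnegativity. *)
Lemma no_edge_sqr n (w : 'I_n -> 'I_n -> R) (A J : {set 'I_n}) :
  (forall i j, w i j = w j i) ->
  no_edge w A J ^+ 2 = \prod_(p in touching A J) (1 - w p.1 p.2).
Proof.
move=> ws; rewrite [RHS](bigID (fun p : 'I_n * 'I_n => (p.1 < p.2)%N)) /= expr2.
congr (_ * _); rewrite /no_edge.
rewrite (reindex_inj (h := fun p : 'I_n * 'I_n => (p.2, p.1))) /=; last first.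
  by move=> [a b] [c d] [-> ->].
apply: eq_big => [[a b]|[a b] _] /=; last by rewrite ws.
rewrite !(isoE, inE) /= eq_sym; case: (a \in A); case: (b \in A) => //=.
rewrite orbC; case: (ltngtP b a) => //= ba; rewrite ?andbF ?andbT //.
by rewrite (val_inj ba) eqxx.
Qed.

Lemma no_edge_ge0 n (w : 'I_n -> 'I_n -> R) (A J : {set 'I_n}) :
  (forall i j, w i j <= 1) -> 0 <= no_edge w A J.
Proof. by move=> w1; apply: prodr_ge0 => p _; rewrite subr_ge0. Qed.

Lemma no_edge_imset m n (h : 'I_m -> 'I_n) (w : 'I_n -> 'I_n -> R) (A J : {set 'I_m}) :
  injective h -> (forall i j, w i j = w j i) -> (forall i j, w i j <= 1) ->
  no_edge w (h @: A) (h @: J) = no_edge (fun i j => w (h i) (h j)) A J.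
Proof.
move=> hi ws w1.
apply/eqP; rewrite -(@eqrXn2 _ 2) ?no_edge_ge0 //; apply/eqP.
rewrite !no_edge_sqr //.
have -> : touching (h @: A) (h @: J) = (fun p => (h p.1, h p.2)) @: touching A J.
  apply/setP => -[a b]; rewrite !(isoE, inE) /=; apply/and4P/imsetP => /=.
    case=> /imsetP[i iA ->] /imsetP[j jA ->] ij.
    rewrite !mem_imset // => ijJ; exists (i, j) => //.
    by rewrite !(isoE, inE) /= iA jA ijJ andbT; apply: contraNneq ij => ->.
  move=> [[i j]]; rewrite !(isoE, inE) /= => /and4P[iA jA ij ijJ] [-> ->].
  by rewrite !mem_imset // iA jA (inj_eq hi) ij ijJ.
by rewrite big_imset //= => -[a b] [c d] _ _ /= [/hi -> /hi ->].
Qed.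

Lemma iso_pgf_imset m n (h : 'I_m -> 'I_n) (w : 'I_n -> 'I_n -> R) (A : {set 'I_m}) :
  injective h -> (forall i j, w i j = w j i) -> (forall i j, w i j <= 1) ->
  iso_pgf w (h @: A) = iso_pgf (fun i j => w (h i) (h j)) A.
Proof.
move=> hi ws w1; rewrite /iso_pgf.
rewrite (reindex_onto (fun J : {set 'I_m} => h @: J)
   (fun J : {set 'I_n} => h @^-1: J)) /=; last first.
  move=> J JA; apply/setP => x; apply/imsetP/idP => [[y]|xJ].
    by rewrite inE => yJ ->.
  have /imsetP[y yA xE] := subsetP JA _ xJ.
  by exists y => //; rewrite inE -xE.
apply: eq_big => [J|J JA]; last first.
  by rewrite no_edge_imset // card_imset.
have -> : h @^-1: (h @: J) = J by apply/setP => x; rewrite inE mem_imset.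
by rewrite eqxx andbT; apply/subsetP/subsetP => JA x;
   [move=> xJ; have := JA (h x); rewrite !mem_imset //; apply
   |case/imsetP => y yJ ->; rewrite mem_imset //; exact: JA].
Qed.

Lemma no_edge1E n (w : 'I_n -> 'I_n -> R) (A : {set 'I_n}) i :
  (forall i j, w i j = w j i) -> (forall i j, w i j <= 1) -> i \in A ->
  no_edge w A [set i] = \prod_(j in A | j != i) (1 - w i j).
Proof.
move=> ws w1 iA.
apply/eqP; rewrite -(@eqrXn2 _ 2) ?no_edge_ge0 //; last first.
  by apply: prodr_ge0 => p _; rewrite subr_ge0.
apply/eqP; rewrite no_edge_sqr // (bigID (fun p : 'I_n * 'I_n => p.1 == i)) /= expr2.
congr (_ * _).
- rewrite (reindex_onto (fun j => (i, j)) snd) /=; last first.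
    by move=> [a b] /=; rewrite !(isoE, inE) /= => /andP[_ /eqP->].
  by apply: eq_bigl => j; rewrite !(isoE, inE) /= !eqxx iA /= !andbT eq_sym.
- rewrite (reindex_onto (fun j => (j, i)) fst) /=; last first.
    move=> [a b] /=; rewrite !(isoE, inE) /= => /andP[/and4P[_ _ ab /orP[/eqP ai|/eqP->//]]].
    by rewrite ai eqxx.
  apply: eq_big => [j|j _]; last by rewrite ws.
  by rewrite !(isoE, inE) /= !eqxx iA /= orbT !andbT -andbA andbb.
Qed.

Lemma no_edgeD1 n (w : 'I_n -> 'I_n -> R) (A J : {set 'I_n}) i :
  J \subset A -> i \in J ->
  no_edge w A J = no_edge w A [set i] * no_edge w (A :\ i) (J :\ i).
Proof.
move=> JA iJ; have iA := subsetP JA _ iJ.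
rewrite /no_edge (bigID (fun p : 'I_n * 'I_n => (p.1 == i) || (p.2 == i))) /=.
congr (_ * _); apply: eq_bigl => -[a b]; rewrite !(isoE, inE) /=;
  case: (eqVneq a i) => [->|ai]; case: (eqVneq b i) => [->|bi];
  rewrite ?iJ ?iA ?eqxx ?andbF ?orbT ?andbT //=.
Qed.

(** Differentiation turns [#|J|] into a sum over [i] in [J], and [no_edgeD1] factors out the edges
    at [i]. On coefficients this is the finite form of Mecke's formula: a marked isolated vertex is
    removed from the graph. *)
Lemma deriv_iso_pgf n (w : 'I_n -> 'I_n -> R) (A : {set 'I_n}) :
  (iso_pgf w A)^`() =
  \sum_(i in A) no_edge w A [set i] *: iso_pgf w (A :\ i).
Proof.
rewrite /iso_pgf raddf_sum /=.
have d1 : ('X - 1 : {poly R})^`() = 1 by rewrite derivB derivX -polyC1 derivC subr0.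
under eq_bigr do rewrite derivZ deriv_exp d1 mul1r.
under [RHS]eq_bigr do rewrite scaler_sumr.
transitivity (\sum_(J : {set 'I_n} | J \subset A) \sum_(i in J)
    no_edge w A [set i] *: (no_edge w (A :\ i) (J :\ i) *: ('X - 1) ^+ #|J|.-1)).
  apply: eq_bigr => J JA.
  rewrite -[LHS]scalerMnr [in LHS](_ : #|J| = #|J|%N) //.
  under eq_bigr => i iJ do rewrite scalerA -(no_edgeD1 _ JA iJ).
  by rewrite sumr_const scalerMnr.
rewrite (exchange_big_dep (fun i => i \in A)) /=; last first.
  by move=> J i JA; exact: (subsetP JA).
apply: eq_bigr => i iA.
rewrite (reindex_onto (fun J => i |: J) (fun J => J :\ i)) /=; last first.
  by move=> J /andP[_ iJ]; rewrite setD1K.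
apply: eq_big => [J|J /andP[/andP[JA _] /eqP JE]]; last first.
  have iJ : i \notin J by rewrite -JE !(isoE, inE) eqxx.
  by rewrite JE cardsU1 iJ.
rewrite !(isoE, inE) eqxx orTb andbT subUset sub1set iA /= subsetD1.
congr (_ && _); apply/eqP/idP => [<-|iJ]; first by rewrite !(isoE, inE) eqxx.
by rewrite setU1K.
Qed.

Lemma sum_subsets_pow n (A : {set 'I_n}) (z : {poly R}) :
  \sum_(J : {set 'I_n} | J \subset A) z ^+ #|J| = (z + 1) ^+ #|A|.
Proof.
rewrite -prodr_const [RHS]big_mkcond /=.
transitivity (\prod_(i : 'I_n) ((if i \in A then z else 0) + 1)); last first.
  by apply: eq_bigr => i _; case: ifP => // _; rewrite add0r.
rewrite bigA_distr big_mkcond /=; apply: eq_bigr => J _; case: ifP => JA.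
  rewrite -prodr_const big_mkcond /=; apply: eq_bigr => i _; case: ifP => // iJ.
  by rewrite (subsetP JA _ iJ).
have /subsetPn[i iJ iA] := negbT JA.
by rewrite (bigD1 i) //= iJ (negbTE iA) mul0r.
Qed.

Lemma subset_iso_set n (A J : {set 'I_n}) (e : {set 'I_n * 'I_n}) :
  J \subset A -> (J \subset iso_set A e) = [disjoint e & touching A J].
Proof.
move=> JA; apply/subsetP/pred0P => [JI [a b] /=|D i iJ].
  apply/negP => /andP[abe]; rewrite !(isoE, inE) /= => /and4P[aA bA ab /orP[aJ|bJ]].
    have := JI _ aJ; rewrite in_iso_set => /andP[_ /forall_inP/(_ _ bA)].
    by rewrite eq_sym ab /= abe.
  have := JI _ bJ; rewrite in_iso_set => /andP[_ /forall_inP/(_ _ aA)].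
  by rewrite ab /= abe andbF.
have iA := subsetP JA _ iJ.
rewrite in_iso_set iA /=; apply/forall_inP => j jA; apply/implyP => ji.
apply/andP; split.
  by have := D (i, j); rewrite /= !(isoE, inE) /= iA jA iJ eq_sym ji !andbT => /negbT.
by have := D (j, i); rewrite /= !(isoE, inE) /= iA jA iJ ji orbT !andbT => /negbT.
Qed.

(** Independence of the pairs is distributivity here: a pair in [X] contributes only the term in
    which it is absent, and any other pair sums to 1. *)
Lemma sum_edge_weight_disjoint n (w : 'I_n -> 'I_n -> R) (X : {set 'I_n * 'I_n}) :
  \sum_e edge_weight w e * [disjoint e & X]%:R =
  \prod_(p in X | (p.1 < p.2)%N) (1 - w p.1 p.2).
Proof.
pose q (p : 'I_n * 'I_n) := if (p.1 < p.2)%N then w p.1 p.2 else 0.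
transitivity (\prod_p ((if p \in X then 0 else q p) + (1 - q p))); last first.
  rewrite [RHS]big_mkcond /=; apply: eq_bigr => p _; rewrite /q.
  by case: (p \in X) => /=; case: ifP => _; rewrite ?subr0 ?add0r // addrC subrK.
rewrite bigA_distr; apply: eq_bigr => e _.
case: (boolP [disjoint e & X]) => [D|]; rewrite ?mulr1 ?mulr0.
  apply: eq_bigr => p _; case: ifP => // pe.
  by rewrite (disjointFr D pe).
case/pred0Pn => p /= /andP[pe pX].
by rewrite (bigD1 p) //= pe pX mul0r.
Qed.

Lemma sum_edge_weight n (w : 'I_n -> 'I_n -> R) : \sum_e edge_weight w e = 1.
Proof.
have := sum_edge_weight_disjoint w set0.
have D (e : {set 'I_n * 'I_n}) : [disjoint e & set0].
  by apply/pred0P => p; rewrite /= inE andbF.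
rewrite (eq_bigr (edge_weight w)) => [->|e _]; last by rewrite D mulr1.
by rewrite big_pred0 // => p; rewrite inE.
Qed.

Lemma sum_edge_weight_iso n (w : 'I_n -> 'I_n -> R) (A : {set 'I_n}) i : i \in A ->
  \sum_e edge_weight w e * (i \in iso_set A e)%:R = no_edge w A [set i].
Proof.
move=> iA; rewrite /no_edge -sum_edge_weight_disjoint; apply: eq_bigr => e _.
by rewrite -subset_iso_set ?sub1set.
Qed.

(** For a fixed edge set, the [J] that meet no edge are the subsets of its isolated set, and the
    binomial theorem sums the powers of ['X - 1] over them to a power of ['X]. *)
Lemma iso_pgfE n (w : 'I_n -> 'I_n -> R) (A : {set 'I_n}) :
  iso_pgf w A = \sum_e edge_weight w e *: 'X^#|iso_set A e|.
Proof.
rewrite /iso_pgf.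
under eq_bigr do rewrite /no_edge -sum_edge_weight_disjoint scaler_suml.
rewrite exchange_big /=; apply: eq_bigr => e _.
transitivity (edge_weight w e *: \sum_(J : {set 'I_n} | J \subset A)
    [disjoint e & touching A J]%:R *: ('X - 1) ^+ #|J| : {poly R}).
  by rewrite scaler_sumr; apply: eq_bigr => J _; rewrite scalerA.
congr (_ *: _).
under eq_bigr => J JA do rewrite -(subset_iso_set e JA).
rewrite -[in RHS](subrK 1 'X) -sum_subsets_pow.
rewrite [RHS]big_mkcond [LHS]big_mkcond /=; apply: eq_bigr => J _.
case: (boolP (J \subset iso_set A e)) => [JI|_]; last first.
  by rewrite scale0r; case: ifP.
rewrite scale1r ifT //; apply: (subset_trans JI); apply/subsetP => i.
by rewrite in_iso_set => /andP[].
Qed.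

Lemma coef_iso_pgf n (w : 'I_n -> 'I_n -> R) (A : {set 'I_n}) k :
  (iso_pgf w A)`_k = \sum_e edge_weight w e * (#|iso_set A e| == k)%:R.
Proof.
rewrite iso_pgfE coef_sum; apply: eq_bigr => e _.
by rewrite coefZ coefXn eq_sym.
Qed.

Lemma edge_weight_ge0 n (w : 'I_n -> 'I_n -> R) e :
  (forall i j, 0 <= w i j <= 1) -> 0 <= edge_weight w e.
Proof.
move=> w01; apply: prodr_ge0 => p _.
have /andP[w0 w1] := w01 p.1 p.2.
by case: ifP => _; case: ifP => _; rewrite ?subr_ge0 ?subr0 ?ler01.
Qed.

Lemma coef_iso_pgf_ge0 n (w : 'I_n -> 'I_n -> R) (A : {set 'I_n}) k :
  (forall i j, 0 <= w i j <= 1) -> 0 <= (iso_pgf w A)`_k.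
Proof.
move=> w01; rewrite coef_iso_pgf; apply: sumr_ge0 => e _.
by rewrite mulr_ge0 // edge_weight_ge0.
Qed.

Lemma sum_coef_iso_pgf n (w : 'I_n -> 'I_n -> R) (A : {set 'I_n}) m :
  (forall i j, 0 <= w i j <= 1) -> \sum_(k < m) (iso_pgf w A)`_k <= 1.
Proof.
move=> w01; under eq_bigr do rewrite coef_iso_pgf.
rewrite exchange_big /= -[leRHS](sum_edge_weight w).
apply: ler_sum => e _; rewrite -mulr_sumr ler_piMr ?edge_weight_ge0 //.
case: (ltnP #|iso_set A e| m) => [lm|ml].
  rewrite (bigD1 (Ordinal lm)) //= eqxx big1 ?addr0 // => i.
  by rewrite -val_eqE /= eq_sym => /negbTE->.
rewrite big1 // => i _; rewrite gtn_eqF // (leq_trans _ ml) //.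
Qed.

(* Vertices in [S] are deleted; the number of isolated vertices changes only if
   a deleted vertex was isolated or a remaining one becomes isolated. *)
Lemma coef_iso_pgf_delete n (w : 'I_n -> 'I_n -> R) (S : {set 'I_n}) k :
  (forall i j, 0 <= w i j <= 1) ->
  (iso_pgf w setT)`_k <= (iso_pgf w (~: S))`_k +
    \sum_i (if i \in S then no_edge w setT [set i]
            else no_edge w (~: S) [set i] - no_edge w setT [set i]).
Proof.
move=> w01; rewrite !coef_iso_pgf.
have -> : \sum_i (if i \in S then no_edge w setT [set i]
            else no_edge w (~: S) [set i] - no_edge w setT [set i]) =
  \sum_e edge_weight w e * \sum_i (if i \in S then (i \in iso_set setT e)%:R
            else (i \in iso_set (~: S) e)%:R - (i \in iso_set setT e)%:R).
  under [RHS]eq_bigr do rewrite mulr_sumr.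
  rewrite exchange_big /=; apply: eq_bigr => i _; case: ifP => iS.
    by rewrite sum_edge_weight_iso.
  under eq_bigr do rewrite mulrBr.
  by rewrite sumrB !sum_edge_weight_iso ?inE ?iS.
rewrite -big_split /=; apply: ler_sum => e _; rewrite -mulrDr.
rewrite ler_wpM2l ?edge_weight_ge0 //.
have sub i : i \notin S -> i \in iso_set setT e -> i \in iso_set (~: S) e.
  move=> iS; rewrite !(isoE, inE) iS /= => /forallP H.
  by apply/forall_inP => j _; have := H j; rewrite inE.
pose F i : R := if i \in S then (i \in iso_set setT e)%:R
            else (i \in iso_set (~: S) e)%:R - (i \in iso_set setT e)%:R.
rewrite -[X in _ <= _ + X]/(\sum_i F i).
have F0 i : 0 <= F i.
  rewrite /F; case: ifP => iS; first exact: ler0n.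
  rewrite subr_ge0 ler_nat; have := sub i; rewrite iS /=.
  by case: (i \in iso_set setT e) => //= ->.
have [E|NE] := eqVneq (iso_set setT e) (iso_set (~: S) e).
  by rewrite E lerDl; apply: sumr_ge0.
have [i Fi] : exists i, 1 <= F i.
  have [i] : exists i, (i \in iso_set setT e) != (i \in iso_set (~: S) e).
    apply/existsP; apply: contraNT NE; rewrite negb_exists => /forallP H.
    by apply/eqP/setP => i; have := H i; rewrite negbK => /eqP.
  move=> H; exists i; rewrite /F; case: ifP => iS.
    move: H; case: (i \in iso_set setT e) => //=.
    by rewrite !(isoE, inE) iS.
  have := sub i; rewrite iS /=.
  move: H; case: (i \in iso_set setT e); case: (i \in iso_set (~: S) e) => //=.
    by move=> _ /(_ isT isT).
  by rewrite subr0.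
rewrite (bigD1 i) //= addrA -[leLHS]addr0 lerD ?sumr_ge0 //.
by rewrite -[leLHS]add0r lerD // (le_trans _ Fi) // lern1 leq_b1.
Qed.

Lemma sum_subset_weight_prod n (a : 'I_n -> R) (f g : 'I_n -> R) :
  \sum_(S : {set 'I_n}) (\prod_i (if i \in S then a i else 1 - a i)) *
     \prod_i (if i \in S then f i else g i) =
  \prod_i (a i * f i + (1 - a i) * g i).
Proof.
rewrite bigA_distr; apply: eq_bigr => S _; rewrite -big_split /=.
by apply: eq_bigr => i _; case: ifP.
Qed.

(** Average of [coef_iso_pgf_delete] over a random [S] containing each [i] independently with
    probability [a i]. Later [a i] is the probability of an edge to the added vertex, so that [~: S]
    keeps the points not joined to it. The factor [1 - (1 - a j) * w i j] is the probability that
    [j] is deleted or not joined to [i]. *)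
Lemma coef_iso_pgf_thinning n (w : 'I_n -> 'I_n -> R) (a : 'I_n -> R) k :
  (forall i j, 0 <= w i j <= 1) -> (forall i j, w i j = w j i) ->
  (forall i, 0 <= a i <= 1) ->
  (iso_pgf w setT)`_k <=
  \sum_(S : {set 'I_n}) (\prod_i (if i \in S then a i else 1 - a i)) *
     (iso_pgf w (~: S))`_k +
  \sum_i (a i * \prod_(j | j != i) (1 - w i j) + (1 - a i) *
     (\prod_(j | j != i) (1 - (1 - a j) * w i j) - \prod_(j | j != i) (1 - w i j))).
Proof.
move=> w01 ws a01.
have w1 i j : w i j <= 1 by have /andP[] := w01 i j.
pose wt (S : {set 'I_n}) := \prod_i (if i \in S then a i else 1 - a i).
have wt0 S : 0 <= wt S.
  apply: prodr_ge0 => i _; have /andP[a0 a1] := a01 i.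
  by case: ifP => _ //; rewrite subr_ge0.
have wt1 : \sum_S wt S = 1.
  have := sum_subset_weight_prod a (fun=> 1) (fun=> 1).
  under [in RHS]eq_bigr do rewrite !mulr1 addrC subrK.
  rewrite [X in _ = X]big1_eq => <-; apply: eq_bigr => S _.
  by rewrite [X in _ * X]big1 ?mulr1 // => i _; case: ifP.
rewrite -[leLHS]mul1r -[X in X * _ <= _]wt1 mulr_suml.
apply: le_trans (_ : \sum_S (wt S * (iso_pgf w (~: S))`_k + wt S *
    \sum_i (if i \in S then no_edge w setT [set i]
            else no_edge w (~: S) [set i] - no_edge w setT [set i])) <= _).
  apply: ler_sum => S _; rewrite -mulrDr ler_wpM2l ?wt0 //.
  exact: coef_iso_pgf_delete.
rewrite big_split /= lerD2l.
under eq_bigr do rewrite mulr_sumr.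
rewrite exchange_big /=; apply: ler_sum => i _.
have NT : no_edge w setT [set i] = \prod_(j | j != i) (1 - w i j).
  by rewrite no_edge1E ?inE //; apply: eq_bigl => j; rewrite inE.
have NS (S : {set 'I_n}) : i \notin S ->
    no_edge w (~: S) [set i] = \prod_(j | j != i) (if j \in S then 1 else 1 - w i j).
  move=> iS; rewrite no_edge1E ?inE //.
  rewrite [LHS]big_mkcond [RHS]big_mkcond /=; apply: eq_bigr => j _.
  by rewrite !(isoE, inE); case: (j \in S); case: (j != i).
rewrite -NT.
rewrite le_eqVlt; apply/orP; left; apply/eqP/esym.
have E1 : a i = \sum_S wt S * (i \in S)%:R.
  transitivity (\sum_S wt S * \prod_j (if j \in S then 1 else (j != i)%:R)).
    rewrite sum_subset_weight_prod (bigD1 i) //= eqxx mulr1 mulr0 addr0.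
    by rewrite big1 ?mulr1 // => j ->; rewrite !mulr1 addrC subrK.
  apply: eq_bigr => S _; congr (_ * _).
  case: (boolP (i \in S)) => iS.
    by rewrite big1 // => j _; case: ifP => // jS; case: eqVneq => // ji;
       rewrite ji iS in jS.
  by rewrite (bigD1 i) //= (negbTE iS) eqxx mul0r.
have E2 : (1 - a i) * \prod_(j | j != i) (1 - (1 - a j) * w i j) =
    \sum_S wt S * (i \notin S)%:R * no_edge w (~: S) [set i].
  transitivity (\sum_S wt S * \prod_j (if j \in S then (j != i)%:R
      else if j == i then 1 else 1 - w i j)).
    rewrite sum_subset_weight_prod [RHS](bigD1 i) //= eqxx mulr1 mulr0 add0r.
    congr (_ * _); apply: eq_bigr => j ji; rewrite ji (negbTE ji) mulr1; ring.
  apply: eq_bigr => S _; rewrite -mulrA; congr (_ * _).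
  case: (boolP (i \in S)) => iS.
    by rewrite mul0r (bigD1 i) //= iS eqxx mul0r.
  rewrite mul1r NS // (bigD1 i) //= (negbTE iS) eqxx mul1r.
  by apply: eq_bigr => j ji; rewrite ji (negbTE ji).
have E3 : 1 - a i = \sum_S wt S * (i \notin S)%:R.
  rewrite -[X in X - _]wt1 E1 -sumrB; apply: eq_bigr => S _.
  by case: (i \in S); rewrite ?mulr1 ?mulr0 ?subrr ?subr0.
rewrite mulrBr E2 [X in X * _ + _]E1 [X in _ - X * _]E3 !mulr_suml -sumrB -big_split /=.
apply: eq_bigr => S _; rewrite -/(wt S).
by case: (boolP (i \in S)) => iS /=; rewrite ?mulr1 ?mulr0 ?mul0r ?subrr ?addr0 ?add0r // mulrBr.
Qed.

End no_edge.

(* Only imported here because the notations for [{set _}] used above clash with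
   those of [classical_sets]. *)
From mathcomp Require Import all_classical all_reals all_analysis.
From mathcomp Require Import measurable_realfun.

Import Order.TTheory GRing.Theory Num.Theory.
Import numFieldNormedType.Exports.
Local Open Scope classical_set_scope.
Local Open Scope ring_scope.

(** * Iterated integrals and the law of the Poisson process *)

Lemma finite_measureP d (T : measurableType d) (R : realType)
    (mu : {measure set T -> \bar R}) : (mu setT < +oo)%E ->
  exists m : {finite_measure set T -> \bar R}, forall A, m A = mu A.
Proof.
move=> mufin.
have fin1 : fin_num_fun mu by apply: lty_fin_num_fun.
pose mu' : set T -> \bar R := mu.
pose muM := isMeasure.Build _ _ _ mu' (measure0 mu) (measure_ge0 mu)
  (@measure_semi_sigma_additive _ _ _ mu).
pose m0 : {measure set T -> \bar R} := HB.pack mu' muM.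
pose fm := Measure_isFinite.Build _ _ _ (m0 : set T -> \bar R) fin1.
pose m : {finite_measure set T -> \bar R} := HB.pack mu' muM fm.
by exists m.
Qed.

Section iterated_integral.
Context d (E : measurableType d) (R : realType) (nu : probability E R).

(** Expectation of [F] under [n] independent points of law [nu]. Plain sequences and iterated
    integrals, rather than a product measure on tuples, let the length vary in inductions and when a
    point is removed; measurability is then asked for each length separately. *)
Fixpoint iter_int (n : nat) (F : seq E -> R) : \bar R :=
  if n is m.+1 then (\int[nu]_x iter_int m (fun s => F (x :: s)))%E
  else (F [::])%:E.

Lemma eq_iter_int n (F G : seq E -> R) :
  (forall s, size s = n -> F s = G s) -> iter_int n F = iter_int n G.
Proof.
elim: n F G => [|n IH] F G FG /=; first by rewrite FG.
apply: eq_integral => x _; apply: IH => s sn.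
by rewrite FG //= sn.
Qed.

Lemma iter_int_ge0 n (F : seq E -> R) : (forall s, 0 <= F s) -> (0 <= iter_int n F)%E.
Proof.
elim: n F => [|n IH] F F0 /=; first by rewrite lee_fin.
by apply: integral_ge0 => x _; exact: IH.
Qed.

Definition param_measurable dT (T : measurableType dT) n (F : T -> seq E -> R) :=
  measurable_fun [set: T * n.-tuple E] (fun p => F p.1 p.2).

Lemma param_measurable_cons dT (T : measurableType dT) n (F : T -> seq E -> R) :
  param_measurable n.+1 F ->
  param_measurable n (fun (p : T * E) s => F p.1 (p.2 :: s)).
Proof.
move=> mF; rewrite /param_measurable.
apply: (measurableT_comp (f := fun q : T * n.+1.-tuple E => F q.1 q.2)
  (g := fun p : (T * E) * n.-tuple E => (p.1.1, [the n.+1.-tuple E of p.1.2 :: p.2]))) => //.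
apply: measurable_fun_pair => /=.
  exact: (measurableT_comp measurable_fst measurable_fst).
apply: measurable_cons => //.
exact: (measurableT_comp measurable_snd measurable_fst).
Qed.

Lemma param_measurable_comp dT dU (T : measurableType dT) (U : measurableType dU)
    n (F : T -> seq E -> R) (f : U -> T) :
  measurable_fun [set: U] f -> param_measurable n F ->
  param_measurable n (fun u => F (f u)).
Proof.
move=> mf mF; rewrite /param_measurable.
apply: (measurableT_comp (f := fun q : T * n.-tuple E => F q.1 q.2)
  (g := fun p : U * n.-tuple E => (f p.1, p.2))) => //.
apply: measurable_fun_pair => //.
exact: (measurableT_comp mf measurable_fst).
Qed.

Lemma param_measurable_cons1 n (F : seq E -> R) :
  measurable_fun [set: n.+1.-tuple E] F ->
  param_measurable n (fun x s => F (x :: s)).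
Proof.
move=> mF; rewrite /param_measurable.
apply: (measurableT_comp (f := fun q : n.+1.-tuple E => F q)
  (g := fun p : E * n.-tuple E => [the n.+1.-tuple E of p.1 :: p.2])) => //.
exact: measurable_cons.
Qed.

Lemma param_measurable_fix dT (T : measurableType dT) n (F : T -> seq E -> R) t :
  param_measurable n F -> measurable_fun [set: n.-tuple E] (F t).
Proof.
move=> mF.
apply: (measurableT_comp (f := fun q : T * n.-tuple E => F q.1 q.2)
  (g := fun s : n.-tuple E => (t, s))) => //.
exact: (measurable_fun_pair (measurable_cst t) (@measurable_id _ _ _)).
Qed.

Lemma measurable_iter_int dT (T : measurableType dT) n (F : T -> seq E -> R) :
  (forall t s, 0 <= F t s) -> param_measurable n F ->
  measurable_fun [set: T] (fun t => iter_int n (F t)).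
Proof.
elim: n dT T F => [|n IH] dT T F F0 mF /=.
  apply/measurable_EFinP.
  apply: (measurableT_comp (f := fun q : T * 0.-tuple E => F q.1 q.2)
    (g := fun t : T => (t, [tuple]))) => //.
have := @measurable_fun_fubini_tonelli_F _ _ _ _ R nu
  (fun p : T * E => iter_int n (fun s => F p.1 (p.2 :: s))).
apply.
  by apply: IH => //; exact: param_measurable_cons.
by move=> p; apply: iter_int_ge0 => s; exact: F0.
Qed.

Lemma measurable_iter_int_cons n (F : seq E -> R) :
  (forall s, 0 <= F s) -> measurable_fun [set: n.+1.-tuple E] F ->
  measurable_fun [set: E] (fun x => iter_int n (fun s => F (x :: s))).
Proof.
move=> F0 mF; apply: measurable_iter_int => //; exact: param_measurable_cons1.
Qed.

Lemma measurable_tuple_cons n (F : seq E -> R) x :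
  measurable_fun [set: n.+1.-tuple E] F ->
  measurable_fun [set: n.-tuple E] (fun s : n.-tuple E => F (x :: s)).
Proof. by move=> mF; exact: (param_measurable_fix x (param_measurable_cons1 mF)). Qed.

Lemma iter_intZ n (c : R) (F : seq E -> R) : 0 <= c -> (forall s, 0 <= F s) ->
  measurable_fun [set: n.-tuple E] F ->
  iter_int n (fun s => c * F s) = (c%:E * iter_int n F)%E.
Proof.
move=> c0; elim: n F => [|n IH] F F0 mF /=; first by rewrite EFinM.
rewrite -ge0_integralZl_EFin //.
- apply: eq_integral => x _; apply: IH => //; exact: measurable_tuple_cons.
- by move=> x _; exact: iter_int_ge0.
- exact: measurable_iter_int_cons.
Qed.

Lemma iter_int_sum n (I : Type) (r : seq I) (F : I -> seq E -> R) :
  (forall i s, 0 <= F i s) -> (forall i, measurable_fun [set: n.-tuple E] (F i)) ->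
  iter_int n (fun s => \sum_(i <- r) F i s) = (\sum_(i <- r) iter_int n (F i))%E.
Proof.
elim: n F => [|n IH] F F0 mF /=; first by rewrite sumEFin.
rewrite -ge0_integral_sum //.
- by apply: eq_integral => x _; apply: IH => // i; exact: measurable_tuple_cons.
- by move=> i; exact: measurable_iter_int_cons.
- by move=> i x _; exact: iter_int_ge0.
Qed.

Lemma iter_intD n (F G : seq E -> R) :
  (forall s, 0 <= F s) -> (forall s, 0 <= G s) ->
  measurable_fun [set: n.-tuple E] F -> measurable_fun [set: n.-tuple E] G ->
  iter_int n (fun s => F s + G s) = (iter_int n F + iter_int n G)%E.
Proof.
move=> F0 G0 mF mG.
have := @iter_int_sum n bool [:: true; false] (fun b => if b then F else G).
under eq_fun do rewrite !big_cons big_nil addr0.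
rewrite !big_cons big_nil adde0; apply; by case.
Qed.

Lemma le_iter_int n (F G : seq E -> R) :
  (forall s, 0 <= F s) -> (forall s, size s = n -> F s <= G s) ->
  (forall s, 0 <= G s) ->
  measurable_fun [set: n.-tuple E] F -> measurable_fun [set: n.-tuple E] G ->
  (iter_int n F <= iter_int n G)%E.
Proof.
elim: n F G => [|n IH] F G F0 FG G0 mF mG /=; first by rewrite lee_fin FG.
apply: ge0_le_integral => //.
- by move=> x _; exact: iter_int_ge0.
- exact: measurable_iter_int_cons.
- exact: measurable_iter_int_cons.
- move=> x _; apply: IH => //.
  + by move=> s sn; apply: FG; rewrite /= sn.
  + exact: measurable_tuple_cons.
  + exact: measurable_tuple_cons.
Qed.

Lemma iter_int_cst n (c : R) : iter_int n (fun=> c) = c%:E.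
Proof.
elim: n => //= n ->; rewrite (integral_cst nu measurableT c%:E).
rewrite -[RHS]mule1; congr (_ * _)%E; exact: probability_setT.
Qed.

Lemma measurable_nth x0 n (i : nat) :
  measurable_fun [set: n.-tuple E] (fun s : n.-tuple E => nth x0 s i).
Proof.
have [ni|ni] := leqP n i.
  under eq_fun do rewrite nth_default ?size_tuple //.
  exact: measurable_cst.
under eq_fun do rewrite -(tnth_nth x0 _ (Ordinal ni)).
exact: measurable_tnth.
Qed.

(** Exchangeability: Tonelli swaps the extracted coordinate with the head, and induction on [i]
    brings it to the front. *)
Lemma iter_int_nth x0 n i (F : E -> seq E -> R) : (i <= n)%N ->
  (forall x s, 0 <= F x s) -> param_measurable n F ->
  iter_int n.+1 (fun s => F (nth x0 s i) (take i s ++ drop i.+1 s)) =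
  (\int[nu]_x iter_int n (F x))%E.
Proof.
elim: i n F => [|i IH] n F.
  move=> _ F0 mF /=; apply: eq_integral => x _; apply: eq_iter_int => s _.
  by rewrite /= drop0.
case: n => [//|n]; rewrite ltnS => iN F0 mF.
transitivity (\int[nu]_y \int[nu]_x iter_int n (fun s => F x (y :: s)))%E.
  apply: eq_integral => y _.
  rewrite -(IH n (fun x s => F x (y :: s))) //.
  apply: (param_measurable_comp (f := fun x : E => (x, y))
    (F := fun p s => F p.1 (p.2 :: s))) => //.
  exact: param_measurable_cons.
rewrite (@fubini_tonelli _ _ _ _ _ nu nu
  (fun p => iter_int n (fun s => F p.2 (p.1 :: s)))) //=.
- apply: measurable_iter_int => //.
  apply: (param_measurable_comp (f := fun p : E * E => (p.2, p.1))
    (F := fun p s => F p.1 (p.2 :: s))) => //.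
  + exact: measurable_fun_pair.
  + exact: param_measurable_cons.
- by move=> p; exact: iter_int_ge0.
Qed.

Lemma measurable_prod_seq n (h : E -> R) : measurable_fun [set: E] h ->
  measurable_fun [set: n.-tuple E] (fun s : n.-tuple E => \prod_(x <- s) h x).
Proof.
move=> mh.
under eq_fun do rewrite big_tuple.
apply: measurable_prod => i _.
exact: (measurableT_comp mh (measurable_tnth i)).
Qed.

Lemma iter_int_prod n (h : E -> R) (A : R) : (forall x, 0 <= h x) ->
  measurable_fun [set: E] h -> (\int[nu]_x (h x)%:E = A%:E)%E ->
  iter_int n (fun s => \prod_(x <- s) h x) = (A ^+ n)%:E.
Proof.
move=> h0 mh hA.
have A0 : 0 <= A.
  by rewrite -lee_fin -hA; apply: integral_ge0 => x _; rewrite lee_fin.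
have P0 s : 0 <= \prod_(x <- s) h x by apply: prodr_ge0.
elim: n => [|n IH] /=; first by rewrite big_nil.
transitivity (\int[nu]_x ((A ^+ n)%:E * (h x)%:E))%E.
  apply: eq_integral => x _; rewrite muleC -IH.
  rewrite (eq_iter_int (G := fun s => h x * \prod_(j <- s) h j)); last first.
    by move=> s _; rewrite big_cons.
  rewrite iter_intZ; [by []|exact: h0|exact: P0|exact: measurable_prod_seq].
rewrite ge0_integralZl_EFin ?exprn_ge0 // ?hA.
- by rewrite -EFinM exprSr.
- by move=> x _; rewrite lee_fin.
- exact/measurable_EFinP.
Qed.

(** Coordinates marked by [b] occur only through [a] and integrate to [A] each; the others remain as
    an iterated integral of smaller length. The constant [c] collects the factors met so far, as the
    induction requires. *)
Lemma iter_int_mask (b : bitseq) (a : E -> R) (A c : R) (F : seq E -> R) :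
  (forall x, 0 <= a x) -> measurable_fun [set: E] a ->
  (\int[nu]_x (a x)%:E = A%:E)%E -> 0 <= c -> (forall s, 0 <= F s) ->
  measurable_fun [set: (count negb b).-tuple E] F ->
  iter_int (size b) (fun s => c * (\prod_(p <- zip b s) if p.1 then a p.2 else 1) *
     F (mask (map negb b) s)) =
  ((c * A ^+ count id b)%:E * iter_int (count negb b) F)%E.
Proof.
move=> a0 ma aA.
have A0 : 0 <= A.
  by rewrite -lee_fin -aA; apply: integral_ge0 => x _; rewrite lee_fin.
elim: b c F => [|[] b IH] c F c0 F0 mF /=.
- by rewrite big_nil !mulr1 EFinM.
- have {}mF : measurable_fun [set: (count negb b).-tuple E] F by exact: mF.
  rewrite add0n add1n.
  transitivity (\int[nu]_x ((c * A ^+ count id b)%:E *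
      iter_int (count negb b) F * (a x)%:E))%E.
    apply: eq_integral => x _; rewrite muleAC -EFinM mulrAC -IH ?mulr_ge0 //.
    by apply: eq_iter_int => s _; rewrite big_cons /= mulrA.
  rewrite ge0_integralZl //; first by rewrite aA muleAC -EFinM exprSr mulrA.
  + exact/measurable_EFinP.
  + by move=> x _; rewrite lee_fin.
  + by rewrite mule_ge0 ?iter_int_ge0 // lee_fin mulr_ge0 ?exprn_ge0.
- have {}mF : measurable_fun [set: (count negb b).+1.-tuple E] F by exact: mF.
  rewrite !add0n -ge0_integralZl_EFin ?mulr_ge0 ?exprn_ge0 //.
  + apply: eq_integral => x _; rewrite -IH //.
      by apply: eq_iter_int => s _; rewrite big_cons /= mul1r.
    exact: measurable_tuple_cons.
  + by move=> x _; exact: iter_int_ge0.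
  + exact: measurable_iter_int_cons.
Qed.

(** Built by pushing the product with [nu] forward under cons. [poisson_law] needs [iter_int] as a
    genuine finite measure on tuples in order to invoke uniqueness of measures. *)
Lemma iter_int_measure n :
  exists m : {finite_measure set (n.-tuple E) -> \bar R},
  forall F : seq E -> R, (forall s, 0 <= F s) -> measurable_fun [set: n.-tuple E] F ->
  (\int[m]_t (F t)%:E)%E = iter_int n F.
Proof.
elim: n => [|n [m mE]].
  exists (\d_([tuple] : 0.-tuple E)) => F F0 mF.
  rewrite integral_dirac //; last exact/measurable_EFinP.
  by rewrite diracT mul1e.
have mc : measurable_fun [set: E * n.-tuple E]
    (fun p : E * n.-tuple E => [the n.+1.-tuple E of p.1 :: p.2]).
  exact: measurable_cons.
pose c (p : E * n.-tuple E) := [the n.+1.-tuple E of p.1 :: p.2].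
pose m0 mf : {measure set (n.+1.-tuple E) -> \bar R} :=
  measure_function_pushforward__canonical__measure_function_Measure (nu \x m)%E (f := c) mf.
pose m1 := m0 mc.
have m1E (F : seq E -> R) : (forall s, 0 <= F s) -> measurable_fun [set: n.+1.-tuple E] F ->
  (\int[m1]_t (F t)%:E)%E = iter_int n.+1 F.
  move=> F0 mF.
  rewrite [LHS](ge0_integral_pushforward mc) //=; last 2 first.
  - exact/measurable_EFinP.
  - by move=> y _; rewrite lee_fin.
  rewrite preimage_setT fubini_tonelli1 //=; last 2 first.
  - apply/measurable_EFinP; exact: param_measurable_cons1.
  - by move=> x; rewrite lee_fin.
  apply: eq_integral => x _; rewrite -(mE (fun s => F (x :: s))) //.
  exact: measurable_tuple_cons.
have [|m2 m2E] := finite_measureP (mu := m1).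
  have := m1E (fun=> 1) (fun=> ler01) (measurable_cst _).
  rewrite integral_cst // mul1e => ->.
  by rewrite iter_int_cst ltry.
exists m2 => F F0 mF; rewrite -m1E //.
by apply: eq_measure_integral => A _ _; exact: m2E.
Qed.

End iterated_integral.

Lemma ge0_integral_mrestr d (T : measurableType d) (R : realType)
    (mu : {measure set T -> \bar R}) (D : set T) (mD : measurable D) (f : T -> \bar R) :
  measurable_fun [set: T] f -> (forall x, 0 <= f x)%E ->
  (\int[mrestr mu mD]_x f x = \int[mu]_(x in D) f x)%E.
Proof.
move=> mf f0.
rewrite (@ge0_negligible_integral _ _ _ (mrestr mu mD) setT (~` D)) //=.
- rewrite setDE setCK setTI; apply: eq_measure_integral => A mA AD.
  by rewrite /= /mrestr setIidl.
- exact: measurableC.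
- by rewrite /mrestr setICl measure0.
Qed.

(** Supplies the other side of the measure comparison in [poisson_law], where [f] runs over the
    renumberings of the points and [D] is the event that there are [n] of them. *)
Lemma sum_image_measure d (T : measurableType d) (R : realType) dX
    (X : measurableType dX) (mu : {measure set T -> \bar R}) (D : set T)
    (I : Type) (r : seq I) (f : I -> T -> X) : measurable D ->
  (forall i, measurable_fun [set: T] (f i)) ->
  exists m : {measure set X -> \bar R}, forall F : X -> \bar R,
    (forall x, 0 <= F x)%E -> measurable_fun [set: X] F ->
    (\int[m]_x F x = \sum_(i <- r) \int[mu]_(w in D) F (f i w))%E.
Proof.
move=> mD mf; elim: r => [|i r [m mE]].
  by exists mzero => F F0 mF; rewrite big_nil integral_measure_zero.
pose m0 mf : {measure set X -> \bar R} :=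
  measure_function_pushforward__canonical__measure_function_Measure (mrestr mu mD) (f := f i) mf.
exists (measure_add (m0 (mf i)) m) => F F0 mF.
rewrite ge0_integral_measure_add // mE // big_cons; congr (_ + _)%E.
rewrite [LHS](ge0_integral_pushforward (mf i)) //= preimage_setT.
by rewrite ge0_integral_mrestr //; exact: measurableT_comp.
Qed.

(** Boxes are stable under intersection, unlike the preimages under single coordinates; this is the
    generating family that [measure_unique] asks for. *)
Lemma measurable_tuple_boxes d (E : measurableType d) n :
  @measurable _ (n.-tuple E) = <<s [set B | exists A : 'I_n -> set E,
    (forall i, measurable (A i)) /\ B = [set t | forall i, A i (tnth t i)]] >>.
Proof.
have mbox (A : 'I_n -> set E) : (forall i, measurable (A i)) ->
    measurable [set t : n.-tuple E | forall i, A i (tnth t i)].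
  move=> mA; rewrite (_ : [set _ | _] =
      \big[setI/setT]_(i < n) ((fun t : n.-tuple E => tnth t i) @^-1` A i)).
    apply: bigsetI_measurable => i _.
    by rewrite -[X in measurable X]setTI; exact: measurable_tnth.
  rewrite -bigcap_seq; apply/seteqP; split => t tA i //=.
  by have := tA i (mem_index_enum i).
apply/seteqP; split; last first.
  apply: smallest_sub; first exact: sigma_algebra_measurable.
  by move=> B [A [mA ->]]; exact: mbox.
apply: smallest_sub; first exact: smallest_sigma_algebra.
rewrite -bigcup_seq => B [i _ [A mA <-]].
apply: sub_sigma_algebra; exists (fun j => if j == i then A else setT); split.
  by move=> j; case: ifP.
apply/seteqP; split => t /=; first by move=> [_ tA] j; case: eqP => // ->.
by move=> /(_ i); rewrite eqxx.
Qed.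

Section iter_int_prod_nth.
Context d (E : measurableType d) (R : realType) (nu : probability E R).

Lemma measurable_prod_nth x0 n (h : 'I_n -> E -> R) :
  (forall i, measurable_fun [set: E] (h i)) ->
  measurable_fun [set: n.-tuple E] (fun s : n.-tuple E => \prod_i h i (nth x0 s i)).
Proof.
move=> mh; apply: measurable_prod => i _.
exact: (measurableT_comp (mh i) (measurable_nth x0 i)).
Qed.

Lemma iter_int_prod_nth x0 n (h : 'I_n -> E -> R) (A : 'I_n -> R) :
  (forall i x, 0 <= h i x) -> (forall i, measurable_fun [set: E] (h i)) ->
  (forall i, \int[nu]_x (h i x)%:E = (A i)%:E)%E ->
  iter_int nu n (fun s => \prod_i h i (nth x0 s i)) = (\prod_i A i)%:E.
Proof.
move=> + + hA.
have A0 i : (forall x, 0 <= h i x) -> 0 <= A i.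
  by move=> h0; rewrite -lee_fin -hA; apply: integral_ge0 => x _; rewrite lee_fin.
elim: n h A hA A0 => [|n IH] h A hA A0 h0 mh /=; first by rewrite !big_ord0.
transitivity (\int[nu]_x ((\prod_i A (lift ord0 i))%:E * (h ord0 x)%:E))%E.
  apply: eq_integral => x _; rewrite muleC -(IH (fun i => h (lift ord0 i))) //;
    last by move=> i; apply: A0.
  rewrite -iter_intZ //.
  - by apply: eq_iter_int => s _; rewrite big_ord_recl.
  - by move=> s; apply: prodr_ge0.
  - exact: (@measurable_prod_nth x0 n (fun i => h (lift ord0 i))).
rewrite ge0_integralZl_EFin //.
- by rewrite hA -EFinM big_ord_recl mulrC.
- by move=> x _; rewrite lee_fin.
- exact/measurable_EFinP.
- by apply: prodr_ge0 => i _; apply: A0.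
Qed.

End iter_int_prod_nth.

Section poisson_law.
Context dT (T : measurableType dT) (R : realType) (P : probability T R)
  d (E : measurableType d) (nu : probability E R)
  (N : T -> nat) (Y : nat -> T -> E) (lambda : R) (x0 : E).
Hypothesis mN : measurable_fun [set: T] N.
Hypothesis mY : forall i, measurable_fun [set: T] (Y i).
Hypothesis lambda_ge0 : 0 <= lambda.

Let mean (A : set E) : R := lambda * fine (nu A).

Hypothesis count_law : forall m (A : 'I_m -> set E) (k : 'I_m -> nat),
  (forall i, measurable (A i)) -> trivIset [set: 'I_m] A ->
  P [set w | forall j, (\sum_(i < N w) (Y i w \in A j))%N = k j] =
  (\prod_j (expR (- mean (A j)) * mean (A j) ^+ k j / (k j)`!%:R))%:E.

Lemma measurable_level n : measurable [set w | N w = n].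
Proof.
rewrite (_ : [set _ | _] = N @^-1` [set n]) //.
by rewrite -[X in measurable X]setTI; exact: mN.
Qed.

(** When [N w = n], the number of renumberings that put the [i]-th point in the cell [f i] is, by
    [perm_nat_card], the product of the factorials of the [k j] if the cell counts are [k], and 0
    otherwise. These factorials cancel those of the Poisson probabilities of the counts. *)
Lemma cell_law (J : finType) (c : E -> J) n (f : 'I_n -> J) :
  (forall j, measurable (c @^-1` [set j])) ->
  (\sum_(s : {perm 'I_n}) \int[P]_(w in [set w | N w = n])
     (\prod_i (\1_(c @^-1` [set f i]) (Y (s i) w)))%:E =
  (expR (- lambda) * lambda ^+ n * \prod_i fine (nu (c @^-1` [set f i])))%:E)%E.
Proof.
move=> mC; set C := fun j => c @^-1` [set j].
have mC' j : measurable (C j) := mC j.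
have CE j x : (x \in C j) = (c x == j) by apply/idP/eqP; rewrite inE.
pose k j := #|[set i | f i == j]%SET|.
pose Ev := [set w | forall j, (\sum_(i < N w) (Y i w \in C j))%N = k j].
have sumk : (\sum_j k j = n)%N.
  rewrite -[RHS](card_ord n) -sum1_card (partition_big f xpredT) //=.
  by apply: eq_bigr => j _; rewrite /k -sum1_card; apply: eq_bigl => i; rewrite inE.
have sumN w : (\sum_j \sum_(i < N w) (Y i w \in C j) = N w)%N.
  rewrite exchange_big /= -[RHS](card_ord (N w)) -sum1_card; apply: eq_bigr => i _.
  rewrite (bigD1 (c (Y i w))) //= CE eqxx big1 // => j jc.
  by rewrite CE eq_sym (negbTE jc).
have cntE w j : N w = n ->
    (\sum_(i < N w) (Y i w \in C j) = \sum_(i < n) (Y i w \in C j))%N by move=> ->.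
(* The cells partition the space, so prescribing all cell counts prescribes the total. *)
have EvN : Ev `<=` [set w | N w = n].
  by move=> w Hw /=; rewrite -(sumN w) -sumk; apply: eq_bigr => j _; exact: Hw.
pose m := #|J|.
have PEv : P Ev = (\prod_j (expR (- mean (C j)) * mean (C j) ^+ k j / (k j)`!%:R))%:E.
  rewrite (reindex (fun i : 'I_m => enum_val i)) /=; last first.
    by apply: onW_bij; exact: enum_val_bij.
  rewrite -(@count_law m (fun i => C (enum_val i)) (fun i => k (enum_val i))).
  - congr (P _); apply/seteqP; split => w /= Hw j; first exact: Hw.
    by have := Hw (enum_rank j); rewrite enum_rankK.
  - by move=> i; exact: mC.
  - apply/trivIsetP => i j _ _ ij; apply/seteqP; split => // x [/= E1 E2].
    by move: ij; rewrite -(inj_eq enum_val_inj) -E1 -E2 eqxx.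
have mEv : measurable Ev.
  pose Evn := \big[setI/setT]_(j : J) [set w | N w = n /\
     (\sum_(i < n) (Y i w \in C j))%N = k j].
  have -> : Ev = [set w | N w = n] `&` Evn.
    apply/seteqP; split => w.
      move=> Ew; have Nw := EvN _ Ew; split => //.
      rewrite /Evn -bigcap_seq => j _; split => //.
      by rewrite -(Ew j) cntE.
    move=> [Nw]; rewrite /Evn -bigcap_seq => H j.
    by have [_ <-] := H j (mem_index_enum j); rewrite cntE.
  apply: measurableI; first exact: measurable_level.
  apply: bigsetI_measurable => j _.
  have mcount : measurable_fun [set: T] (fun w => \sum_(i < n) \1_(C j) (Y i w) : R).
    apply: measurable_sum => i.
    have mI : measurable_fun [set: E] (\1_(C j) : E -> R) by exact: measurable_indic.
    exact: (measurableT_comp mI (mY i)).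
  have -> : [set w | N w = n /\ (\sum_(i < n) (Y i w \in C j))%N = k j] =
      [set w | N w = n] `&`
      (fun w => \sum_(i < n) \1_(C j) (Y i w) : R) @^-1` [set (k j)%:R]; last first.
    apply: measurableI; first exact: measurable_level.
    by rewrite -[X in measurable X]setTI; exact: mcount.
  apply/seteqP; split => w /= [Nw H]; split => //.
    by rewrite -H natr_sum; apply: eq_bigr => i _.
  by apply/eqP; rewrite -(eqr_nat R) -H natr_sum; apply/eqP; apply: eq_bigr.
transitivity (\int[P]_(w in [set w | N w = n])
   ((\prod_j (k j)`!)%:R * \1_Ev w)%:E)%E.
  rewrite -ge0_integral_sum.
  - apply: eq_integral => w; rewrite inE => /= Nw.
    rewrite sumEFin; congr (_%:E).
    pose g (i : 'I_n) := c (Y i w).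
    transitivity ((#|[set s : {perm 'I_n} | [forall i, g (s i) == f i]]%SET|)%:R : R).
      rewrite -sum1_card natr_sum [RHS]big_mkcond /=; apply: eq_bigr => s _.
      rewrite inE; case: ifPn => [/forallP H|/forallPn[i Hi]].
        by rewrite big1 // => i _; have /eqP := H i; rewrite /g indicE CE => ->; rewrite eqxx.
      by rewrite (bigD1 i) //= indicE CE; move: Hi; rewrite /g => /negbTE->; rewrite mul0r.
    rewrite perm_nat_card indicE.
    have -> : (w \in Ev) = [forall j, #|[set i | f i == j]%SET| == #|[set i | g i == j]%SET|].
      have E1 j : (\sum_(i < N w) (Y i w \in C j))%N = #|[set i | g i == j]%SET|.
        rewrite cntE // -sum1_card big_mkcond [RHS]big_mkcond /=.
        by apply: eq_bigr => i _; rewrite inE CE /g; case: (_ == j).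
      apply/idP/forallP; rewrite inE /Ev /= => H j; first by rewrite -E1 H.
      by rewrite E1 -(eqP (H j)).
    by case: ifP; rewrite ?mulr1 ?mulr0.
  - exact: measurable_level.
  - move=> s; apply/measurable_EFinP/measurable_funTS/measurable_prod => i _.
    by apply: measurableT_comp => //; exact: measurable_indic.
  - by move=> s w _; rewrite lee_fin; apply: prodr_ge0.
under eq_integral do rewrite EFinM.
rewrite ge0_integralZl_EFin //; last 2 first.
- exact: measurable_level.
- by apply/measurable_EFinP/measurable_funTS/measurable_indic.
rewrite integral_indic //; last exact: measurable_level.
rewrite (setIidl EvN); transitivity ((\prod_j (k j)`!)%:R%:E *
    (\prod_j (expR (- mean (C j)) * mean (C j) ^+ k j / (k j)`!%:R))%:E : \bar R)%E.
  by congr (_ * _)%E; exact: PEv.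
rewrite -EFinM; congr (_%:E).
rewrite natr_prod -big_split /=.
have sumnu : \sum_j fine (nu (C j)) = 1.
  apply: EFin_inj; rewrite -sumEFin.
  rewrite (eq_bigr (fun j => \int[nu]_x (\1_(C j) x)%:E)%E) => [|j _]; last first.
    by rewrite integral_indic // setIT fineK // fin_num_measure.
  rewrite -ge0_integral_sum //.
  - rewrite (eq_integral (cst 1%E)) ?integral_cst ?mul1e //; first exact: probability_setT.
    move=> x _ /=; rewrite sumEFin (bigD1 (c x)) //= indicE CE eqxx big1 ?addr0 // => j jc.
    by rewrite indicE CE eq_sym (negbTE jc).
  - by move=> j; apply/measurable_EFinP; exact: measurable_indic.
transitivity (\prod_j expR (- mean (C j)) * \prod_j mean (C j) ^+ k j).
  rewrite -big_split /=; apply: eq_bigr => j _.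
  by rewrite mulrC divfK // pnatr_eq0 -lt0n fact_gt0.
rewrite -expR_sum sumrN /mean -mulr_sumr sumnu mulr1 -mulrA; congr (_ * _).
under eq_bigr do rewrite exprMn.
rewrite big_split /= prodrXr sumk; congr (_ * _).
rewrite (partition_big f xpredT) //=; apply: eq_bigr => j _.
rewrite (eq_bigr (fun=> fine (nu (C j)))); last by move=> i /eqP->.
by rewrite prodr_const /k; congr (_ ^+ _); apply: eq_card => i; rewrite !inE.
Qed.

(** Arbitrary sets are cut into the atoms of the finite algebra they generate, the atom of [x] being
    labelled by the set of [i] with [x \in A i]. Multiplying out the indicators over atoms reduces
    to [cell_law]. *)
Lemma box_law n (A : 'I_n -> set E) : (forall i, measurable (A i)) ->
  (\sum_(s : {perm 'I_n}) \int[P]_(w in [set w | N w = n])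
     (\prod_i (\1_(A i) (Y (s i) w)))%:E =
  (expR (- lambda) * lambda ^+ n)%:E *
  iter_int nu n (fun s => (\prod_i \1_(A i) (nth x0 s i))%R))%E.
Proof.
move=> mA.
pose c x : {set 'I_n} := [set i | x \in A i]%SET.
have mC S : measurable (c @^-1` [set S]).
  rewrite (_ : _ @^-1` _ = \big[setI/setT]_(i < n) (if i \in S then A i else ~` A i)).
    by apply: bigsetI_measurable => i _; case: ifP => _ //; exact: measurableC.
  rewrite -bigcap_seq; apply/seteqP; split => x /=.
    move=> <- i _; rewrite inE; case: ifPn; first by rewrite inE.
    by rewrite notin_setE.
  move=> H; apply/setP => i; rewrite inE.
  have := H i (mem_index_enum i); case: ifP => _.
    by rewrite -inE.
  by move=> nA; rewrite memNset.
have AE i x : \1_(A i) x = \sum_(S : {set 'I_n}) (i \in S)%:R * \1_(c @^-1` [set S]) x :> R.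
  rewrite (bigD1 (c x)) //= [X in _ + X]big1 => [|S Sc].
    by rewrite addr0 !indicE inE (mem_set (A := _ @^-1` _)) //= mulr1.
  rewrite [X in _ * X]indicE (memNset (A := _ @^-1` _)) ?mulr0 //= => E1.
  by rewrite E1 eqxx in Sc.
have prodE (y : 'I_n -> E) : \prod_i \1_(A i) (y i) =
   \sum_(f : {ffun 'I_n -> {set 'I_n}}) (\prod_i (i \in f i)%:R) *
      \prod_i \1_(c @^-1` [set f i]) (y i) :> R.
  under eq_bigr do rewrite AE.
  by rewrite bigA_distr_bigA /=; apply: eq_bigr => f _; rewrite big_split.
have k0 (f : {ffun 'I_n -> {set 'I_n}}) : 0 <= \prod_i (i \in f i)%:R :> R.
  by apply: prodr_ge0 => i _; exact: ler0n.
transitivity (\sum_(s : {perm 'I_n}) \sum_(f : {ffun 'I_n -> {set 'I_n}})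
   (\prod_i (i \in f i)%:R)%:E * \int[P]_(w in [set w | N w = n])
     (\prod_i (\1_(c @^-1` [set f i]) (Y (s i) w)))%:E)%E.
  apply: eq_bigr => s _.
  have mp f : measurable_fun [set w | N w = n]
      (fun w => (\prod_i (\1_(c @^-1` [set (f : {ffun 'I_n -> {set 'I_n}}) i]) (Y (s i) w)))%:E : \bar R).
    apply/measurable_EFinP/measurable_funTS/measurable_prod => i _.
    by apply: measurableT_comp => //; exact: measurable_indic.
  transitivity (\int[P]_(w in [set w | N w = n]) (\sum_(f : {ffun 'I_n -> {set 'I_n}})
     ((\prod_i (i \in f i)%:R) * (\prod_i (\1_(c @^-1` [set f i]) (Y (s i) w)))%R)%:E))%E.
    by apply: eq_integral => w _; rewrite prodE sumEFin.
  rewrite ge0_integral_sum //.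
  - apply: eq_bigr => f _; rewrite -ge0_integralZl_EFin //.
    + exact: measurable_level.
    + by move=> w _; rewrite lee_fin; apply: prodr_ge0.
  - exact: measurable_level.
  - move=> f; have /measurable_EFinP mpf := mp f.
    by apply/measurable_EFinP; apply: measurable_funM.
  - by move=> f w _; rewrite lee_fin mulr_ge0 //; apply: prodr_ge0.
rewrite exchange_big /=.
under eq_iter_int do rewrite prodE.
have P0 (f : {ffun 'I_n -> {set 'I_n}}) s :
    0 <= \prod_i \1_(c @^-1` [set f i]) (nth x0 s i) :> R by apply: prodr_ge0.
have mP (f : {ffun 'I_n -> {set 'I_n}}) : measurable_fun [set: n.-tuple E]
    (fun s : n.-tuple E => \prod_i \1_(c @^-1` [set f i]) (nth x0 s i) : R).
  apply: (@measurable_prod_nth _ _ _ x0 n (fun i => \1_(c @^-1` [set f i]))) => i.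
  exact: measurable_indic.
rewrite iter_int_sum; last 2 first.
- by move=> f s; rewrite mulr_ge0.
- by move=> f; apply: measurable_funM.
rewrite ge0_sume_distrr; last first.
  by move=> f _; apply: iter_int_ge0 => s; rewrite mulr_ge0.
apply: eq_bigr => f _.
rewrite iter_intZ // -ge0_sume_distrr; last first.
  by move=> s _; apply: integral_ge0 => w _; rewrite lee_fin; apply: prodr_ge0.
rewrite cell_law // (@iter_int_prod_nth _ _ _ nu x0 n (fun i => \1_(c @^-1` [set f i]))
  (fun i => fine (nu (c @^-1` [set f i])))) //.
- by rewrite -!EFinM mulrCA.
- by move=> i; rewrite integral_indic // setIT fineK // fin_num_measure.
Qed.

(* The numbering of the points is arbitrary, so only the sum over all renumberings
   is determined by the law of the point process. *)
Lemma poisson_law n (F : seq E -> R) : (forall s, 0 <= F s) ->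
  measurable_fun [set: n.-tuple E] F ->
  (\sum_(s : {perm 'I_n}) \int[P]_(w in [set w | N w = n])
     (F [seq Y (s i) w | i <- enum 'I_n])%:E =
  (expR (- lambda) * lambda ^+ n)%:E * iter_int nu n F)%E.
Proof.
move=> F0 mF.
pose fs (s : {perm 'I_n}) w := [tuple Y (s i) w | i < n].
have mfs s : measurable_fun [set: T] (fs s).
  apply/measurable_fun_tnthP => i.
  by rewrite (_ : _ \o _ = Y (s i)) //; apply/funext => w /=; rewrite tnth_mktuple.
have [|m1 m1E] := @sum_image_measure _ T R _ (n.-tuple E) P [set w | N w = n]
   _ (index_enum {perm 'I_n}) fs (measurable_level n).
  exact: mfs.
have [m2 m2E] := iter_int_measure nu n.
have c0 : 0 <= expR (- lambda) * lambda ^+ n by rewrite mulr_ge0 ?expR_ge0 ?exprn_ge0.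
pose m2' : {measure set (n.-tuple E) -> \bar R} := mscale (NngNum c0) m2.
have m1F (G : seq E -> R) : (forall s, 0 <= G s) -> measurable_fun [set: n.-tuple E] G ->
   (\int[m1]_t (G t)%:E = \sum_(s : {perm 'I_n}) \int[P]_(w in [set w | N w = n])
     (G (fs s w))%:E)%E.
  move=> G0 mG; rewrite m1E.
  - by [].
  - by move=> x; rewrite lee_fin.
  - exact/measurable_EFinP.
have m2F (G : seq E -> R) : (forall s, 0 <= G s) -> measurable_fun [set: n.-tuple E] G ->
   (\int[m2']_t (G t)%:E = (expR (- lambda) * lambda ^+ n)%:E * iter_int nu n G)%E.
  move=> G0 mG; rewrite ge0_integral_mscale //= ?m2E //.
    exact/measurable_EFinP.
  by move=> t _; rewrite lee_fin.
(* Both sides become integrals of [F] against finite measures on tuples, which need to be compared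
   on boxes only. *)
rewrite -m2F // -m1F //.
apply: eq_measure_integral => B mB _.
apply: (measure_unique _ (fun=> setT) (measurable_tuple_boxes E n)) => //.
- move=> _ _ [A1 [mA1 ->]] [A2 [mA2 ->]]; exists (fun i => A1 i `&` A2 i); split.
    by move=> i; exact: measurableI.
  by apply/seteqP; split => t /= => [[H1 H2] i|H]; [split|split => i; have [] := H i].
- move=> _; exists (fun=> setT); split => //.
  by apply/seteqP; split.
- by rewrite bigcup_const.
- move=> _ [A [mA ->]]; set D := [set t | _].
  have mD : measurable D by rewrite measurable_tuple_boxes; apply: sub_sigma_algebra; exists A.
  have DE (t : n.-tuple E) : \1_D t = \prod_i \1_(A i) (nth x0 t i) :> R.
    rewrite indicE; case: (boolP (t \in D)) => [|].
      rewrite inE => tD; rewrite big1 // => i _.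
      by rewrite -tnth_nth indicE mem_set //; exact: tD.
    rewrite notin_setE => /existsNP[i Ai].
    by rewrite (bigD1 i) //= -tnth_nth indicE memNset // mul0r.
  have intE (m : {measure set (n.-tuple E) -> \bar R}) :
      m D = (\int[m]_t (\prod_i \1_(A i) (nth x0 t i))%:E)%E.
    transitivity (\int[m]_t (\1_D t)%:E)%E; first by rewrite integral_indic // setIT.
    by apply: eq_integral => t _; rewrite DE.
  rewrite !intE (m1F (fun s => \prod_i \1_(A i) (nth x0 s i))); last 2 first.
  + by move=> s; apply: prodr_ge0.
  + apply: (@measurable_prod_nth _ _ _ x0 n (fun i => \1_(A i))) => i.
    exact: measurable_indic.
  rewrite (m2F (fun s => \prod_i \1_(A i) (nth x0 s i))); last 2 first.
  + by move=> s; apply: prodr_ge0.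
  + apply: (@measurable_prod_nth _ _ _ x0 n (fun i => \1_(A i))) => i.
    exact: measurable_indic.
  rewrite -box_law //; apply: eq_bigr => s _; apply: eq_integral => w _.
  by congr (_%:E); apply: eq_bigr => i _; rewrite -tnth_nth tnth_mktuple.
- move=> _; have := m1F (fun=> 1) (fun=> ler01) (measurable_cst _).
  rewrite integral_cst // mul1e => ->.
  apply: lte_sum_pinfty => s _; rewrite integral_cst ?mul1e; last exact: measurable_level.
  by rewrite (le_lt_trans (probability_le1 P (measurable_level n))) // ltry.
Qed.

End poisson_law.

(** * The coupling inequality *)

Section omit.
Context (T : Type) (x0 : T).

Lemma nth_omit (n i : nat) (s : seq T) (j : nat) : size s = n.+1 -> (i <= n)%N ->
  nth x0 (take i s ++ drop i.+1 s) j = nth x0 s (bump i j).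
Proof.
move=> sn iN; rewrite nth_cat size_takel ?sn ?leqW // /bump.
case: (ltnP j i) => ij; first by rewrite nth_take.
by rewrite nth_drop addSn subnKC.
Qed.

Lemma size_omit n i (s : seq T) : size s = n.+1 -> (i <= n)%N ->
  size (take i s ++ drop i.+1 s) = n.
Proof. by move=> sn iN; rewrite size_cat size_takel ?size_drop sn ?leqW // subSS subnKC. Qed.

Lemma prod_omit (R : comNzRingType) n (i : 'I_n.+1) (s : seq T) (f : T -> R) :
  size s = n.+1 ->
  \prod_(j < n.+1 | j != i) f (nth x0 s j) = \prod_(y <- take i s ++ drop i.+1 s) f y.
Proof.
move=> sn; have iN : (i <= n)%N by rewrite -ltnS.
rewrite (big_nth x0) (size_omit sn iN) big_mkord big_mkcond (bigD1_ord i) //= eqxx mul1r.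
by apply: eq_bigr => j _; rewrite eq_sym neq_lift (nth_omit _ sn iN).
Qed.

End omit.

Lemma sume_const_ord (R : realDomainType) n (c : \bar R) :
  (\sum_(i < n) c = n%:R%:E * c)%E.
Proof.
rewrite -[in RHS](card_ord n) -sumr_const -sumEFin ge0_sume_distrl; last first.
  by move=> i _; rewrite lee_fin.
by apply: eq_bigr => i _; rewrite mul1e.
Qed.

Section isolated_counts.
Context d (E : measurableType d) (R : realType) (nu : probability E R) (x0 : E).
Variable w : E -> E -> R.
Hypothesis w01 : forall x y, 0 <= w x y <= 1.
Hypothesis wC : forall x y, w x y = w y x.
Hypothesis mw : measurable_fun [set: E * E] (fun p => w p.1 p.2).

Definition iso_coef n k (s : seq E) : R :=
  (iso_pgf (fun i j : 'I_n => w (nth x0 s i) (nth x0 s j)) [set: 'I_n]%SET)`_k.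

Lemma iso_coef_ge0 n k s : 0 <= iso_coef n k s.
Proof. by apply: coef_iso_pgf_ge0 => i j. Qed.

Lemma sum_iso_coef_le1 n m s : \sum_(k < m) iso_coef n k s <= 1.
Proof. by apply: sum_coef_iso_pgf => i j. Qed.

Let w_le1 x y : w x y <= 1. Proof. by have /andP[] := w01 x y. Qed.
Let w_ge0 x y : 0 <= w x y. Proof. by have /andP[] := w01 x y. Qed.

Lemma iso_coef0 n k s : size s = 0 -> n = 0 -> iso_coef n k.+1 s = 0.
Proof.
move=> _ n0; move: n0 s => -> s; rewrite /iso_coef /iso_pgf.
rewrite coef_sum big1 // => J _.
rewrite (_ : #|J| = 0) ?expr0 ?coefZ ?coef1 ?mulr0 //.
by apply: eq_card0 => -[].
Qed.

Lemma iso_coef_omit n k s : size s = n.+1 ->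
  k.+1%:R * iso_coef n.+1 k.+1 s =
  \sum_(i < n.+1) (\prod_(y <- take i s ++ drop i.+1 s) (1 - w (nth x0 s i) y)) *
     iso_coef n k (take i s ++ drop i.+1 s).
Proof.
move=> sn; rewrite /iso_coef mulr_natl -coef_deriv deriv_iso_pgf coef_sum.
apply: eq_big => [i|i _]; first by rewrite inE.
rewrite coefZ no_edge1E ?inE //; congr (_ * _).
  by rewrite -(prod_omit x0 i _ sn); apply: eq_bigl => j; rewrite inE.
have -> : ([set: 'I_n.+1] :\ i = lift i @: [set: 'I_n])%SET.
  apply/setP => j; rewrite !inE andbT; apply/idP/imsetP => [ji|[l _ ->]].
    by case: (unliftP i j) ji => [l -> _|->]; [exists l|rewrite eqxx].
  by rewrite eq_sym neq_lift.
rewrite iso_pgf_imset //; last exact: lift_inj.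
congr (_`_ _); congr iso_pgf; apply/funext => j; apply/funext => l.
by rewrite !(nth_omit x0 _ sn) // -ltnS.
Qed.

Lemma measurable_omit n (i : 'I_n.+1) (F : E -> seq E -> R) : param_measurable n F ->
  measurable_fun [set: n.+1.-tuple E]
    (fun s : n.+1.-tuple E => F (nth x0 s i) (take i s ++ drop i.+1 s)).
Proof.
move=> mF; have iN : (i <= n)%N by rewrite -ltnS.
have sz (s : n.+1.-tuple E) : size (take i s ++ drop i.+1 s) == n.
  by rewrite (@size_omit _ n) ?size_tuple.
apply: (measurableT_comp (f := fun p : E * n.-tuple E => F p.1 p.2)
  (g := fun s : n.+1.-tuple E => (nth x0 s i, Tuple (sz s)))) => //.
apply: measurable_fun_pair; first exact: measurable_nth.
apply/measurable_fun_tnthP => j.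
rewrite (_ : _ \o _ = fun s : n.+1.-tuple E => nth x0 s (bump i j)).
  exact: measurable_nth.
by apply/funext => s; rewrite /= (tnth_nth x0) /= (@nth_omit _ _ n) ?size_tuple.
Qed.

Lemma measurable_w_nth n i j :
  measurable_fun [set: n.-tuple E] (fun s : n.-tuple E => w (nth x0 s i) (nth x0 s j)).
Proof.
exact: (measurableT_comp mw (measurable_fun_pair (measurable_nth x0 i) (measurable_nth x0 j))).
Qed.

Lemma measurable_no_edge n m (h : 'I_m -> nat) (A J : {set 'I_m}) :
  measurable_fun [set: n.-tuple E] (fun s : n.-tuple E =>
    no_edge (fun i j : 'I_m => w (nth x0 s (h i)) (nth x0 s (h j))) A J).
Proof.
rewrite /no_edge; under eq_fun do rewrite big_mkcond /=.
apply: measurable_prod => p _.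
case: (boolP ((p \in touching A J) && (p.1 < p.2)%N)) => _ //.
by apply: measurable_funB => //; exact: measurable_w_nth.
Qed.

Lemma measurable_iso_pgf n m (h : 'I_m -> nat) k (A : {set 'I_m}) :
  measurable_fun [set: n.-tuple E] (fun s : n.-tuple E =>
    (iso_pgf (fun i j : 'I_m => w (nth x0 s (h i)) (nth x0 s (h j))) A)`_k).
Proof.
rewrite /iso_pgf; under eq_fun do rewrite coef_sum big_mkcond /=.
apply: measurable_sum => J; case: (boolP (J \subset A)) => _ //.
under eq_fun do rewrite coefZ.
by apply: measurable_funM => //; exact: measurable_no_edge.
Qed.

Lemma measurable_iso_coef n k : measurable_fun [set: n.-tuple E] (iso_coef n k).
Proof. exact: (@measurable_iso_pgf n n (fun i => i)). Qed.

Lemma measurable_w1 x : measurable_fun [set: E] (w x).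
Proof.
exact: (measurableT_comp mw (measurable_fun_pair (measurable_cst x) (@measurable_id _ _ _))).
Qed.

Lemma integral_Rintegral (h : E -> R) : (forall x, 0 <= h x <= 1) ->
  measurable_fun [set: E] h -> (\int[nu]_x (h x)%:E = (\int[nu]_x h x)%:E)%E.
Proof.
move=> h01 mh; rewrite /Rintegral fineK // ge0_fin_numE; last first.
  by apply: integral_ge0 => x _; rewrite lee_fin; have /andP[] := h01 x.
apply: (@le_lt_trans _ _ (\int[nu]_x (cst 1%E) x)%E).
  apply: ge0_le_integral => //.
  - by move=> x _; rewrite lee_fin; have /andP[] := h01 x.
  - exact/measurable_EFinP.
  - by move=> x _; rewrite lee_fin; have /andP[] := h01 x.
rewrite integral_cst // mul1e; apply: (@le_lt_trans _ _ 1%E); last exact: ltry.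
exact: probability_le1.
Qed.

Lemma integrable01 (h : E -> R) : (forall x, 0 <= h x <= 1) ->
  measurable_fun [set: E] h -> nu.-integrable [set: E] (EFin \o h).
Proof.
move=> h01 mh; apply/integrableP; split; first exact/measurable_EFinP.
rewrite (eq_integral (fun x => (h x)%:E)) => [|x _]; last first.
  by rewrite /= ger0_norm //; have /andP[] := h01 x.
by rewrite integral_Rintegral // ltry.
Qed.

Lemma Rintegral01 (h : E -> R) : (forall x, 0 <= h x <= 1) ->
  measurable_fun [set: E] h -> 0 <= (\int[nu]_x h x)%R <= 1.
Proof.
move=> h01 mh; rewrite -!lee_fin -integral_Rintegral //; apply/andP; split.
  by apply: integral_ge0 => x _; rewrite lee_fin; have /andP[] := h01 x.
apply: (@le_trans _ _ (\int[nu]_x (cst 1%E) x)%E).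
  apply: ge0_le_integral => //.
  - by move=> x _; rewrite lee_fin; have /andP[] := h01 x.
  - exact/measurable_EFinP.
  - by move=> x _; rewrite lee_fin; have /andP[] := h01 x.
by rewrite integral_cst // mul1e; exact: probability_le1.
Qed.

Lemma measurable_Rintegral dT (T : measurableType dT) (h : T -> E -> R) :
  (forall x y, 0 <= h x y) ->
  measurable_fun [set: T * E] (fun p => h p.1 p.2) ->
  measurable_fun [set: T] (fun x => (\int[nu]_y h x y)%R).
Proof.
move=> h0 mh.
apply: measurableT_comp => //.
have := @measurable_fun_fubini_tonelli_F _ _ _ _ R nu (fun p : T * E => (h p.1 p.2)%:E).
by apply => [|p]; [exact/measurable_EFinP|rewrite lee_fin].
Qed.

(** Common shape of the error terms of [coef_iso_pgf_thinning], so that one computation,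
    [series_sum_nth], evaluates all three of them. *)
Definition sum_nth (a : E -> R) (h : E -> E -> R) (n : nat) (s : seq E) : R :=
  \sum_(i < n) a (nth x0 s i) * \prod_(j < n | j != i) h (nth x0 s i) (nth x0 s j).

Lemma measurable_sum_nth_term n m (a : E -> R) (h : E -> E -> R) (i : 'I_m) :
  measurable_fun [set: E] a -> measurable_fun [set: E * E] (fun p => h p.1 p.2) ->
  measurable_fun [set: n.-tuple E] (fun s : n.-tuple E => a (nth x0 s i) *
    \prod_(j < m | j != i) h (nth x0 s i) (nth x0 s j)).
Proof.
move=> ma mh; apply: measurable_funM.
  exact: (measurableT_comp ma (measurable_nth x0 i)).
under eq_fun do rewrite big_mkcond /=.
apply: measurable_prod => j _; case: (j != i) => //.
exact: (measurableT_comp mh (measurable_fun_pair (measurable_nth x0 i) (measurable_nth x0 j))).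
Qed.

Lemma measurable_sum_nth n (a : E -> R) (h : E -> E -> R) :
  measurable_fun [set: E] a -> measurable_fun [set: E * E] (fun p => h p.1 p.2) ->
  measurable_fun [set: n.-tuple E] (sum_nth a h n).
Proof. by move=> ma mh; apply: measurable_sum => i; exact: measurable_sum_nth_term. Qed.

Lemma sum_nth_ge0 n (a : E -> R) (h : E -> E -> R) s :
  (forall x, 0 <= a x) -> (forall x y, 0 <= h x y) -> 0 <= sum_nth a h n s.
Proof. by move=> a0 h0; rewrite sumr_ge0 // => i _; rewrite mulr_ge0 // prodr_ge0. Qed.

Lemma iter_int_sum_nth n (a : E -> R) (h : E -> E -> R) :
  (forall x, 0 <= a x) -> measurable_fun [set: E] a ->
  (forall x y, 0 <= h x y <= 1) -> measurable_fun [set: E * E] (fun p => h p.1 p.2) ->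
  (iter_int nu n.+1 (sum_nth a h n.+1) =
   n.+1%:R%:E * \int[nu]_y (a y * (\int[nu]_z h y z)%R ^+ n)%:E)%E.
Proof.
move=> a0 ma h01 mh.
have h0 x y : 0 <= h x y by have /andP[] := h01 x y.
have mh1 x : measurable_fun [set: E] (h x).
  exact: (measurableT_comp mh (measurable_fun_pair (measurable_cst x) (@measurable_id _ _ _))).
rewrite iter_int_sum.
- rewrite (eq_bigr (fun=> \int[nu]_y (a y * (\int[nu]_z h y z)%R ^+ n)%:E)%E) => [|i _].
    exact: sume_const_ord.
  pose F y s := a y * \prod_(z <- s) h y z.
  rewrite (eq_iter_int _ (G := fun s => F (nth x0 s i) (take i s ++ drop i.+1 s))).
  + rewrite iter_int_nth; last 3 first.
    * by rewrite -ltnS.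
    * by move=> x s; rewrite mulr_ge0 // prodr_ge0.
    * rewrite /param_measurable /F; apply: measurable_funM.
        exact: (measurableT_comp ma measurable_fst).
      under eq_fun do rewrite big_tuple.
      apply: measurable_prod => j _.
      apply: (measurableT_comp mh (measurable_fun_pair measurable_fst _)).
      exact: (measurableT_comp (measurable_tnth j) measurable_snd).
    apply: eq_integral => x _; rewrite /F iter_intZ //.
    * rewrite (@iter_int_prod _ _ _ _ _ _ (\int[nu]_z h x z)%R) //.
      by rewrite integral_Rintegral.
    * by move=> s; rewrite prodr_ge0.
    * exact: measurable_prod_seq.
  + by move=> s sn; rewrite (prod_omit x0).
- by move=> i s; rewrite mulr_ge0 // prodr_ge0.
- by move=> i; exact: measurable_sum_nth_term.
Qed.

Variable lambda : R.
Hypothesis lambda_gt0 : 0 < lambda.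

Definition pois n : R := expR (- lambda) * lambda ^+ n / n`!%:R.

Lemma pois_ge0 n : 0 <= pois n.
Proof. by rewrite /pois !mulr_ge0 ?expR_ge0 ?exprn_ge0 ?invr_ge0 // ltW. Qed.

Lemma poisS n : pois n.+1 * n.+1%:R = lambda * pois n.
Proof.
have n1 : n.+1%:R != 0 :> R by rewrite pnatr_eq0.
rewrite /pois factS natrM exprS invfM (mulrC (n.+1%:R^-1)) !mulrA divfK //.
by rewrite (mulrC lambda).
Qed.

Lemma pois_pgf t : 0 <= t ->
  (\sum_(0 <= n <oo) (pois n * t ^+ n)%:E = (expR (- (lambda * (1 - t))))%:E)%E.
Proof.
move=> t0.
rewrite (eq_eseriesr (g := fun n => (expR (- lambda))%:E * (exp_coeff (lambda * t) n)%:E)%E); last first.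
  move=> n _; rewrite -EFinM exp_coeffE /pois exprMn; congr (_%:E).
  by rewrite -!mulrA; congr (_ * _); rewrite mulrC -!mulrA; congr (_ * _); rewrite mulrC.
rewrite nneseriesZl; last first.
  by move=> n _; rewrite lee_fin exp_coeff_ge0 // mulr_ge0 // ltW.
have -> : (\sum_(0 <= n <oo) (exp_coeff (lambda * t) n)%:E = (expR (lambda * t))%:E)%E.
  apply/cvg_lim => //.
  rewrite (_ : (fun n => _) = EFin \o series (exp_coeff (lambda * t))); last first.
    by apply/funext => n; rewrite /= sumEFin.
  by apply: cvg_EFin; [exact: nearW|exact: is_cvg_series_exp_coeff].
rewrite -EFinM -expRD; congr (_%:E); congr expR; ring.
Qed.

(** [lambda * deg x] is the mean degree of a vertex added at [x], [piso x] the probability that it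
    is isolated, and [lambda * codeg x y] the mean number of common neighbours of vertices added at
    [x] and [y]. *)
Definition deg x : R := (\int[nu]_y w x y)%R.
Definition piso x : R := expR (- (lambda * deg x)).
Definition codeg x y : R := (\int[nu]_z (w x z * w y z))%R.

Definition iso_prob k : \bar R :=
  (\sum_(0 <= n <oo) (pois n)%:E * iter_int nu n (iso_coef n k))%E.
(** The overview's Q_k(x). An added vertex that is isolated does not affect the isolation of the
    others, so the product with the [iso_coef] of the original points is the joint probability. *)
Definition iso_prob_at k x : \bar R :=
  (\sum_(0 <= n <oo) (pois n)%:E *
     iter_int nu n (fun s => (\prod_(y <- s) (1 - w x y)) * iso_coef n k s)%R)%E.

Let m1w : measurable_fun [set: E * E] (fun p => 1 - w p.1 p.2).
Proof. exact: measurable_funB. Qed.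

Lemma param_measurable_iso n k :
  param_measurable n (fun x s => (\prod_(y <- s) (1 - w x y)) * iso_coef n k s).
Proof.
rewrite /param_measurable; apply: measurable_funM.
  under eq_fun do rewrite big_tuple.
  apply: measurable_prod => j _.
  apply: (measurableT_comp m1w (measurable_fun_pair measurable_fst _)).
  exact: (measurableT_comp (measurable_tnth j) measurable_snd).
exact: (measurableT_comp (@measurable_iso_coef n k) measurable_snd).
Qed.

Let iso_ge0 n k x s : 0 <= (\prod_(y <- s) (1 - w x y)) * iso_coef n k s.
Proof. by rewrite mulr_ge0 ?iso_coef_ge0 // prodr_ge0 // => y _; rewrite subr_ge0. Qed.

Lemma measurable_iso_prob_at_term n k : measurable_fun [set: E] (fun x =>
  ((pois n)%:E * iter_int nu n (fun s => (\prod_(y <- s) (1 - w x y)) * iso_coef n k s)%R)%E).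
Proof.
apply: measurable_funeM; apply: measurable_iter_int => //.
exact: param_measurable_iso.
Qed.

(* Mecke's formula for the isolated vertices. *)
Lemma iso_probS k :
  (k.+1%:R%:E * iso_prob k.+1 = lambda%:E * \int[nu]_x iso_prob_at k x)%E.
Proof.
have t0 n : (0 <= (pois n)%:E * iter_int nu n (iso_coef n k.+1))%E.
  by rewrite mule_ge0 ?lee_fin ?pois_ge0 // iter_int_ge0 // => s; exact: iso_coef_ge0.
rewrite /iso_prob -nneseriesZl; last by move=> n _.
(* The empty configuration has no isolated vertex and drops out; after a shift by one, [poisS]
   matches the two series term by term. *)
rewrite nneseries_recl //; last by move=> n _; rewrite mule_ge0 ?lee_fin.
rewrite {1}/iter_int iso_coef0 // !mule0 add0e.
rewrite integral_nneseries //; last 2 first.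
- by move=> n; exact: measurable_iso_prob_at_term.
- by move=> n x _; rewrite mule_ge0 ?lee_fin ?pois_ge0 ?iter_int_ge0.
rewrite -nneseriesZl; last first.
  move=> n _; apply: integral_ge0 => x _.
  by rewrite mule_ge0 ?lee_fin ?pois_ge0 ?iter_int_ge0.
rewrite -(nneseries_addn 1); last by move=> n; rewrite mule_ge0 ?lee_fin.
under eq_eseriesr do rewrite addn1.
apply: eq_eseriesr => n _.
rewrite ge0_integralZl_EFin ?pois_ge0 //; last 2 first.
- by move=> x _; exact: iter_int_ge0.
- by apply: measurable_iter_int => //; exact: param_measurable_iso.
rewrite muleCA -iter_intZ //; last 2 first.
- by move=> s; exact: iso_coef_ge0.
- exact: measurable_iso_coef.
rewrite (eq_iter_int _ (@iso_coef_omit n k)) iter_int_sum; last 2 first.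
- by move=> i s; exact: iso_ge0.
- move=> i; apply: (@measurable_omit n i
    (fun x s => (\prod_(y <- s) (1 - w x y)) * iso_coef n k s)).
  exact: param_measurable_iso.
rewrite (eq_bigr (fun=> \int[nu]_x iter_int nu n
   (fun s => (\prod_(y <- s) (1 - w x y)) * iso_coef n k s)%R)%E) => [|i _].
  rewrite sume_const_ord muleA -EFinM poisS EFinM muleA //.
rewrite (@iter_int_nth _ _ _ _ x0 n i (fun x s => (\prod_(y <- s) (1 - w x y)) * iso_coef n k s)) //.
  by rewrite -ltnS.
exact: param_measurable_iso.
Qed.

Lemma iter_int_fin n (F : seq E -> R) :
  (forall s, 0 <= F s <= 1) -> measurable_fun [set: n.-tuple E] F ->
  iter_int nu n F = (fine (iter_int nu n F))%:E /\ 0 <= fine (iter_int nu n F) <= 1.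
Proof.
move=> F01 mF.
have F0 s : 0 <= F s by have /andP[] := F01 s.
have F1 s : F s <= 1 by have /andP[] := F01 s.
have I0 : (0 <= iter_int nu n F)%E by exact: iter_int_ge0.
have I1 : (iter_int nu n F <= 1)%E.
  rewrite -(iter_int_cst nu n 1); apply: le_iter_int => //; exact: measurable_cst.
have fin : iter_int nu n F \is a fin_num.
  by rewrite ge0_fin_numE // (le_lt_trans I1) // ltry.
by rewrite fineK // -!lee_fin fineK // I0 I1.
Qed.

Lemma iso_coef_le1 n k s : iso_coef n k s <= 1.
Proof.
apply: le_trans (sum_iso_coef_le1 n k.+1 s).
by rewrite big_ord_recr /= lerDr sumr_ge0 // => i _; exact: iso_coef_ge0.
Qed.

Let isox n k x s := (\prod_(y <- s) (1 - w x y)) * iso_coef n k s.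

Let isox01 n k x s : 0 <= isox n k x s <= 1.
Proof.
rewrite /isox iso_ge0 /= mulr_ile1 ?iso_coef_ge0 ?iso_coef_le1 //.
  by apply: prodr_ge0 => y _; rewrite subr_ge0.
by apply: prodr_ile1 => y _; rewrite subr_ge0 w_le1 gerBl w_ge0.
Qed.

Let misox n k x : measurable_fun [set: n.-tuple E] (isox n k x).
Proof. exact: param_measurable_fix (@param_measurable_iso n k). Qed.

(** [iter_int_mask] with the indicator of [S] as mask: each point in [S] contributes a factor
    [deg x], and the others keep their order, so the enumeration [h] of [~: S] carries one graph to
    the other. *)
Lemma iter_int_subset n k x (S : {set 'I_n}) :
  (iter_int nu n (fun s =>
     (\prod_i (if i \in S then w x (nth x0 s i) else 1 - w x (nth x0 s i))) *
     (iso_pgf (fun i j : 'I_n => w (nth x0 s i) (nth x0 s j)) (~: S)%SET)`_k)%R =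
   (deg x ^+ #|S|)%:E * iter_int nu (n - #|S|) (isox (n - #|S|) k x))%E.
Proof.
pose l := enum 'I_n; pose b := [seq i \in S | i <- l].
have bn : size b = n by rewrite size_map size_enum_ord.
have bS : count id b = #|S|.
  rewrite count_map cardE /enum_mem size_filter -enumT.
  by apply: eq_count => i.
have bC : count negb b = (n - #|S|)%N.
  by rewrite -bS -[in RHS]bn -(count_predC id b) addKn.
rewrite -bC -bS.
have := @iter_int_mask _ E R nu b (w x) (deg x) 1 (isox (count negb b) k x).
rewrite mul1r => <- //; last 3 first.
- exact: measurable_w1.
- by rewrite integral_Rintegral //; exact: measurable_w1.
- by move=> s; have /andP[] := isox01 (count negb b) k x s.
have -> : iter_int nu (size b) = iter_int nu n by rewrite bn.
apply: (@eq_iter_int _ E R nu n) => s sn.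
have sE : s = [seq nth x0 s i | i : 'I_n <- l].
  by rewrite (map_comp (nth x0 s) val) val_enum_ord -/(mkseq _ _) -sn mkseq_nth.
pose L := [seq i <- l | i \notin S].
have maskE : mask (map negb b) s = [seq nth x0 s i | i : 'I_n <- L].
  by rewrite {1}sE /b -map_comp -map_mask -filter_mask.
have zipE : zip b s = [seq (i \in S, nth x0 s i) | i : 'I_n <- l].
  by rewrite {1}sE zip_map.
rewrite maskE zipE /isox !big_map mul1r mulrA; congr (_ * _).
  rewrite /L big_filter /l enumT [X in _ = _ * X]big_mkcond -big_split /=.
  rewrite -enumT big_enum /=.
  by apply: eq_bigr => i _; case: (i \in S); rewrite ?mulr1 ?mul1r.
have Lm : size L == count negb b by rewrite size_filter /b count_map.
pose h (i : 'I_(count negb b)) : 'I_n := tnth (Tuple Lm) i.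
have hi : injective h.
  by apply/tuple_uniqP => /=; rewrite filter_uniq // enum_uniq.
have <- : (h @: [set: _] = ~: S)%SET.
  apply/setP => i; rewrite inE; apply/imsetP/idP => [[j _ ->]|iS].
    by have := mem_tnth j (Tuple Lm); rewrite mem_filter => /andP[].
  have /tnthP[j jE] : i \in Tuple Lm by rewrite mem_filter iS mem_enum.
  by exists j.
rewrite iso_pgf_imset // /iso_coef; congr (_`_ _); congr iso_pgf.
have hE (j : 'I_(count negb b)) : nth x0 [seq nth x0 s i | i : 'I_n <- L] j = nth x0 s (h j).
  have i0 : 'I_n := h j.
  rewrite (nth_map i0); last by rewrite (eqP Lm).
  by rewrite /h (tnth_nth i0).
by apply/funext => i; apply/funext => j; rewrite !hE.
Qed.

Lemma sum_subsets_card n (f : nat -> R) :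
  \sum_(S : {set 'I_n}) f #|S| = \sum_(l < n.+1) 'C(n, l)%:R * f l.
Proof.
rewrite (partition_big (fun S : {set 'I_n} => inord #|S| : 'I_n.+1) xpredT) //=.
apply: eq_bigr => l _.
have cardE (S : {set 'I_n}) : (inord #|S| == l :> 'I_n.+1) = (#|S| == l).
  rewrite -val_eqE /= inordK // ltnS -[X in (_ <= X)%N](card_ord n); exact: max_card.
rewrite (eq_bigr (fun=> f l)) => [|S]; last by rewrite cardE => /eqP->.
rewrite (eq_bigl _ _ cardE) sumr_const -[X in 'C(X, l)](card_ord n) -card_draws mulr_natl.
by congr (_ *+ _); apply: eq_card => S; rewrite !inE.
Qed.

(** The triangle of index pairs with sum below [M] lies in the square; with nonnegative terms this
    half of the Cauchy product is immediate, and it is the half that [le_thinned_series] uses. *)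
Lemma le_triangle_sum (x y : nat -> R) M : (forall i, 0 <= x i) -> (forall i, 0 <= y i) ->
  \sum_(n < M) \sum_(l < n.+1) x l * y (n - l)%N <= (\sum_(l < M) x l) * \sum_(m < M) y m.
Proof.
move=> X0 Y0; elim: M => [|M IH]; first by rewrite !big_ord0 mul0r.
have -> : \sum_(n < M.+1) \sum_(l < n.+1) x l * y (n - l)%N =
   \sum_(l < M.+1) \sum_(n < M.+1 | (l <= n)%N) x l * y (n - l)%N.
  rewrite (exchange_big_dep xpredT) //=; apply: eq_bigr => n _.
  by rewrite (big_ord_widen M.+1 (fun l => x l * y (n - l)%N)).
rewrite mulr_suml; apply: ler_sum => l _.
rewrite -mulr_sumr ler_wpM2l // -(big_geq_mkord l M.+1 xpredT (fun n => y (n - l)%N)).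
rewrite -[X in \sum_(X <= _ < _) _]add0n big_addn big_mkord.
rewrite (eq_bigr (fun i : 'I__ => y i)) => [|i _]; last by rewrite addnK.
rewrite (big_ord_widen M.+1) ?leq_subr // big_mkcond /=.
by apply: ler_sum => i _; case: ifP.
Qed.

Let J k x m := fine (iter_int nu m (isox m k x)).

Let JE k x m : iter_int nu m (isox m k x) = (J k x m)%:E.
Proof. by have [] := iter_int_fin (@isox01 m k x) (@misox m k x). Qed.

Let J_ge0 k x m : 0 <= J k x m.
Proof. by have [_ /andP[]] := iter_int_fin (@isox01 m k x) (@misox m k x). Qed.

Let deg01 x : 0 <= deg x <= 1.
Proof. by apply: Rintegral01 => //; exact: measurable_w1. Qed.

(* Conditioning on the neighbours of [x] splits the Poisson process into two
   independent ones; only one inequality between the two sides is needed. *)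
Lemma le_thinned_series k x :
  (\sum_(0 <= n <oo) (pois n)%:E *
     (\sum_(S : {set 'I_n}) deg x ^+ #|S| * J k x (n - #|S|))%:E <=
   (expR (lambda * deg x))%:E * iso_prob_at k x)%E.
Proof.
have /andP[d0 d1] := deg01 x.
pose a l := exp_coeff (lambda * deg x) l.
have a0 l : 0 <= a l by rewrite /a exp_coeff_ge0 // mulr_ge0 // ltW.
pose y m := pois m * J k x m.
have y0 m : 0 <= y m by rewrite mulr_ge0 ?pois_ge0 ?J_ge0.
(* With the sets [S] grouped by size [l], the binomial coefficient and the Poisson weight recombine
   into the [l]-th coefficient of [expR (lambda * deg x)] times [pois (n - l)]. *)
have sumE n : ((pois n)%:E * (\sum_(S : {set 'I_n}) deg x ^+ #|S| * J k x (n - #|S|))%:E =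
    (\sum_(l < n.+1) a l * y (n - l)%N)%:E)%E.
  rewrite -EFinM (sum_subsets_card n (fun l => deg x ^+ l * J k x (n - l))) mulr_sumr.
  congr (_%:E); apply: eq_bigr => l _; have ln : (l <= n)%N by rewrite -ltnS.
  rewrite /a exp_coeffE /y /pois exprMn -[in lambda ^+ n](subnKC ln) exprD.
  have := bin_fact ln => /(congr1 (fun m => m%:R : R)); rewrite !natrM => <-.
  have b0 : 'C(n, l)%:R != 0 :> R by rewrite pnatr_eq0 -lt0n bin_gt0.
  have f0 m : m`!%:R != 0 :> R by rewrite pnatr_eq0 -lt0n fact_gt0.
  move: (f0 l) (f0 (n - l)%N) b0.
  move: ('C(n, l)%:R : R) (l`!%:R : R) ((n - l)`!%:R : R) => c f g F0 G0 C0.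
  rewrite !invfM !mulrA -[LHS]mulr1; field.
  by rewrite F0 G0 C0.
under eq_eseriesr do rewrite sumE.
have aE : (\sum_(0 <= l <oo) (a l)%:E = (expR (lambda * deg x))%:E)%E.
  apply/cvg_lim => //.
  rewrite (_ : (fun n => _) = EFin \o series (exp_coeff (lambda * deg x))); last first.
    by apply/funext => n; rewrite /= sumEFin.
  by apply: cvg_EFin; [exact: nearW|exact: is_cvg_series_exp_coeff].
rewrite -aE /iso_prob_at.
have -> : (\sum_(0 <= n <oo) (pois n)%:E * iter_int nu n (fun s =>
    (\prod_(y <- s) (1 - w x y)) * iso_coef n k s)%R = \sum_(0 <= m <oo) (y m)%:E)%E.
  by apply: eq_eseriesr => n _; rewrite JE -EFinM.
apply: lime_le.
  by apply: is_cvg_nneseries => n _ _; rewrite lee_fin sumr_ge0 // => l _; rewrite mulr_ge0.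
apply: nearW => M; rewrite big_mkord sumEFin.
apply: (@le_trans _ _ ((\sum_(l < M) a l) * (\sum_(m < M) y m))%:E).
  by rewrite lee_fin le_triangle_sum.
rewrite EFinM lee_pmul ?lee_fin ?sumr_ge0 //.
  rewrite -sumEFin -(big_mkord xpredT (fun l => (a l)%:E)).
  by apply: nneseries_lim_ge => n _ _; rewrite lee_fin.
rewrite -sumEFin -(big_mkord xpredT (fun l => (y l)%:E)).
by apply: nneseries_lim_ge => n _ _; rewrite lee_fin.
Qed.

(** Mecke's formula for one marked point: exchangeability extracts it, and the remaining points sum
    through [pois_pgf] to an exponential, as for a void probability. *)
Lemma series_sum_nth (a : E -> R) (h : E -> E -> R) :
  (forall x, 0 <= a x) -> measurable_fun [set: E] a ->
  (forall x y, 0 <= h x y <= 1) -> measurable_fun [set: E * E] (fun p => h p.1 p.2) ->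
  (\sum_(0 <= n <oo) (pois n)%:E * iter_int nu n (sum_nth a h n) =
   lambda%:E * \int[nu]_y (a y * expR (- (lambda * (1 - \int[nu]_z h y z)%R)))%:E)%E.
Proof.
move=> a0 ma h01 mh.
have h0 x y : 0 <= h x y by have /andP[] := h01 x y.
have mh1 x : measurable_fun [set: E] (h x).
  exact: (measurableT_comp mh (measurable_fun_pair (measurable_cst x) (@measurable_id _ _ _))).
have H0 y : 0 <= (\int[nu]_z h y z)%R by have /andP[] := Rintegral01 (h01 y) (mh1 y).
have mH : measurable_fun [set: E] (fun y => (\int[nu]_z h y z)%R) by exact: measurable_Rintegral.
have t0 n : (0 <= iter_int nu n (sum_nth a h n))%E.
  by apply: iter_int_ge0 => s; exact: sum_nth_ge0.
rewrite nneseries_recl //; last by move=> n _; rewrite mule_ge0 ?lee_fin ?pois_ge0.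
rewrite /= /sum_nth big_ord0 mule0 add0e.
rewrite -(nneseries_addn 1); last by move=> n; rewrite mule_ge0 ?lee_fin ?pois_ge0.
transitivity (\sum_(0 <= n <oo) lambda%:E * \int[nu]_y
    ((pois n)%:E * (a y * (\int[nu]_z h y z)%R ^+ n)%:E))%E.
  apply: eq_eseriesr => n _; rewrite addn1 iter_int_sum_nth // muleA -EFinM poisS EFinM -muleA.
  rewrite ge0_integralZl_EFin ?pois_ge0 //.
  - by move=> y _; rewrite lee_fin mulr_ge0 ?exprn_ge0.
  - by apply/measurable_EFinP/measurable_funM => //; exact: measurable_funX.
rewrite nneseriesZl; last first.
  move=> n _; apply: integral_ge0 => y _.
  by rewrite -EFinM lee_fin mulr_ge0 ?pois_ge0 // mulr_ge0 ?exprn_ge0.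
congr (_ * _)%E; rewrite -integral_nneseries //; last 2 first.
- move=> n; apply: measurable_funeM; apply/measurable_EFinP/measurable_funM => //.
  exact: measurable_funX.
- by move=> n y _; rewrite -EFinM lee_fin mulr_ge0 ?pois_ge0 // mulr_ge0 ?exprn_ge0.
apply: eq_integral => y _; rewrite EFinM -pois_pgf // -nneseriesZl; last first.
  by move=> n _; rewrite lee_fin mulr_ge0 ?pois_ge0 ?exprn_ge0.
by apply: eq_eseriesr => n _; rewrite -!EFinM mulrCA.
Qed.

Lemma codeg_ge0 x y : 0 <= codeg x y.
Proof. by apply: Rintegral_ge0 => z _; rewrite mulr_ge0. Qed.

Let mw1 x : measurable_fun [set: E] (w x). Proof. exact: measurable_w1. Qed.

Lemma measurable_codeg : measurable_fun [set: E * E] (fun p => codeg p.1 p.2).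
Proof.
rewrite /codeg; apply: (@measurable_Rintegral _ (E * E)%type (fun p z => w p.1 z * w p.2 z)).
  by move=> p z; rewrite mulr_ge0.
apply: measurable_funM.
- exact: (measurableT_comp mw (measurable_fun_pair (measurableT_comp measurable_fst measurable_fst) measurable_snd)).
- exact: (measurableT_comp mw (measurable_fun_pair (measurableT_comp measurable_snd measurable_fst) measurable_snd)).
Qed.

Lemma measurable_piso : measurable_fun [set: E] piso.
Proof.
apply: measurableT_comp => //; apply: measurableT_comp => //.
by apply: measurable_funM => //; exact: measurable_Rintegral.
Qed.

Lemma piso01 x : 0 <= piso x <= 1.
Proof.
have /andP[d0 _] := deg01 x.
by rewrite expR_ge0 expR_le1 oppr_le0 mulr_ge0 // ltW.
Qed.

(** [coef_iso_pgf_thinning] with [w x] evaluated at the points as [a], averaged over the Poisson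
    points. The subtracted error term is moved to the other side before integrating, since the
    series are extended-real valued; being finite, it cancels at the end. *)
Lemma thinning_bound k x :
  (iso_prob k <= (expR (lambda * deg x))%:E * iso_prob_at k x +
    lambda%:E * \int[nu]_y
      (piso y * (w x y + (expR (lambda * codeg x y) - 1)))%:E)%E.
Proof.
pose h1 y z := 1 - w y z.
pose h2 y z := 1 - (1 - w x z) * w y z.
have h101 y z : 0 <= h1 y z <= 1 by rewrite /h1 subr_ge0 w_le1 gerBl w_ge0.
have h201 y z : 0 <= h2 y z <= 1.
  rewrite /h2 subr_ge0 gerBl mulr_ge0 ?subr_ge0 // andbT mulr_ile1 ?subr_ge0 //.
  by rewrite gerBl.
have mh2 : measurable_fun [set: E * E] (fun p => h2 p.1 p.2).
  rewrite /h2; apply: measurable_funB => //; apply: measurable_funM => //.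
  apply: measurable_funB => //.
  exact: (measurableT_comp (mw1 x) measurable_snd).
pose b y := 1 - w x y.
have b0 y : 0 <= b y by rewrite /b subr_ge0.
have mb : measurable_fun [set: E] b by exact: measurable_funB.
have w0x y : 0 <= w x y by [].
have h10 y z : 0 <= h1 y z by have /andP[] := h101 y z.
have h20 y z : 0 <= h2 y z by have /andP[] := h201 y z.
pose SS n s := \sum_(S : {set 'I_n})
   (\prod_i (if i \in S then w x (nth x0 s i) else 1 - w x (nth x0 s i))) *
     (iso_pgf (fun i j : 'I_n => w (nth x0 s i) (nth x0 s j)) (~: S)%SET)`_k.
have ST0 n (S : {set 'I_n}) s : 0 <=
   (\prod_i (if i \in S then w x (nth x0 s i) else 1 - w x (nth x0 s i))) *
     (iso_pgf (fun i j : 'I_n => w (nth x0 s i) (nth x0 s j)) (~: S)%SET)`_k.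
  rewrite mulr_ge0 ?coef_iso_pgf_ge0 // prodr_ge0 // => i _.
  by case: ifP => _; rewrite ?subr_ge0.
have mST n (S : {set 'I_n}) : measurable_fun [set: n.-tuple E] (fun s : n.-tuple E =>
   (\prod_i (if i \in S then w x (nth x0 s i) else 1 - w x (nth x0 s i))) *
     (iso_pgf (fun i j : 'I_n => w (nth x0 s i) (nth x0 s j)) (~: S)%SET)`_k).
  apply: measurable_funM; last exact: (@measurable_iso_pgf n n (fun i => i)).
  apply: measurable_prod => i _; case: (i \in S).
    exact: (measurableT_comp (mw1 x) (measurable_nth x0 i)).
  apply: measurable_funB => //.
  exact: (measurableT_comp (mw1 x) (measurable_nth x0 i)).
have SS0 n s : 0 <= SS n s by rewrite sumr_ge0.
have mSS n : measurable_fun [set: n.-tuple E] (SS n).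
  by apply: measurable_sum => S; exact: mST.
have iSS n : iter_int nu n (SS n) =
    (\sum_(S : {set 'I_n}) deg x ^+ #|S| * J k x (n - #|S|))%:E.
  rewrite iter_int_sum // -sumEFin; apply: eq_bigr => S _.
  by rewrite iter_int_subset JE -EFinM.
have key n : (iter_int nu n (iso_coef n k) + iter_int nu n (sum_nth b h1 n) <=
    iter_int nu n (SS n) + (iter_int nu n (sum_nth (w x) h1 n) +
                            iter_int nu n (sum_nth b h2 n)))%E.
  rewrite -!iter_intD //; try exact: measurable_sum_nth; try exact: measurable_iso_coef;
    try (by move=> s; exact: sum_nth_ge0); try (by move=> s; exact: iso_coef_ge0); last 2 first.
  - by move=> s; rewrite addr_ge0 // sum_nth_ge0.
  - by apply: measurable_funD; exact: measurable_sum_nth.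
  apply: le_iter_int.
  - by move=> s; rewrite addr_ge0 ?iso_coef_ge0 ?sum_nth_ge0.
  - move=> s sn.
    have := @coef_iso_pgf_thinning R n (fun i j => w (nth x0 s i) (nth x0 s j))
      (fun i => w x (nth x0 s i)) k.
    move=> /(_ (fun _ _ => w01 _ _) (fun _ _ => wC _ _) (fun _ => w01 _ _)).
    rewrite big_split /= => H.
    rewrite -lerBrDr (le_trans H) // -!addrA lerD2l lerD2l lerBrDr -big_split /=.
    rewrite ler_sum // => i _; rewrite /b /h1 /h2 mulrBr subrK //.
  - by move=> s; rewrite !addr_ge0 ?sum_nth_ge0.
  - by apply: measurable_funD; [exact: measurable_iso_coef|exact: measurable_sum_nth].
  - apply: measurable_funD; first exact: mSS.
    by apply: measurable_funD; exact: measurable_sum_nth.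
have G0 n F : (forall s, 0 <= F s) -> (0 <= (pois n)%:E * iter_int nu n F)%E.
  by move=> F0; rewrite mule_ge0 ?lee_fin ?pois_ge0 ?iter_int_ge0.
have sum_key : (iso_prob k + \sum_(0 <= n <oo) (pois n)%:E * iter_int nu n (sum_nth b h1 n) <=
   \sum_(0 <= n <oo) (pois n)%:E * iter_int nu n (SS n) +
   (\sum_(0 <= n <oo) (pois n)%:E * iter_int nu n (sum_nth (w x) h1 n) +
    \sum_(0 <= n <oo) (pois n)%:E * iter_int nu n (sum_nth b h2 n)))%E.
  have T1 n : (0 <= (pois n)%:E * iter_int nu n (iso_coef n k))%E.
    by apply: G0 => s; exact: iso_coef_ge0.
  have T2 n : (0 <= (pois n)%:E * iter_int nu n (sum_nth b h1 n))%E.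
    by apply: G0 => s; exact: sum_nth_ge0.
  have T3 n : (0 <= (pois n)%:E * iter_int nu n (sum_nth (w x) h1 n))%E.
    by apply: G0 => s; exact: sum_nth_ge0.
  have T4 n : (0 <= (pois n)%:E * iter_int nu n (sum_nth b h2 n))%E.
    by apply: G0 => s; exact: sum_nth_ge0.
  have T5 n : (0 <= (pois n)%:E * iter_int nu n (SS n))%E by exact: G0.
  rewrite /iso_prob -!nneseriesD; try by move=> n _ _; rewrite ?adde_ge0.
  apply: lee_nneseries; first by move=> n _ _; rewrite adde_ge0.
  move=> n _; rewrite -!ge0_muleDr; first by rewrite lee_wpmul2l // lee_fin pois_ge0.
  all: try by apply: iter_int_ge0 => s //; exact: sum_nth_ge0.
  all: try by apply: iter_int_ge0 => s //; exact: iso_coef_ge0.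
  by rewrite adde_ge0 //; apply: iter_int_ge0 => s; exact: sum_nth_ge0.
rewrite !series_sum_nth // in sum_key.
have int1 : (\int[nu]_z 1)%R = 1.
  rewrite Rintegral_cst // mul1r; transitivity (fine (1%E : \bar R)) => //.
  by congr fine; exact: probability_setT.
have cod01 y z : 0 <= w x z * w y z <= 1 by rewrite mulr_ge0 // mulr_ile1.
have mcod y : measurable_fun [set: E] (fun z => w x z * w y z) by exact: measurable_funM.
have h1E y : 1 - (\int[nu]_z h1 y z)%R = deg y.
  rewrite /h1 RintegralB // ?int1; first by rewrite subKr.
  - by apply: integrable01 => // z; rewrite ler01 lexx.
  - exact: integrable01.
(* The degree of [y] among the points not joined to [x]: the common neighbours are lost. *)
have h2E y : 1 - (\int[nu]_z h2 y z)%R = deg y - codeg x y.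
  rewrite (_ : h2 y = fun z => 1 - (w y z - w x z * w y z)); last first.
    by apply/funext => z; rewrite /h2; ring.
  rewrite RintegralB //; last 2 first.
  - by apply: integrable01 => // z; rewrite ler01 lexx.
  - apply: integrable01; last by apply: measurable_funB.
    by move=> z; rewrite -[X in X - _]mul1r -mulrBl mulr_ge0 ?b0 // mulr_ile1 ?b0 // /b gerBl.
  by rewrite int1 subKr RintegralB //; exact: integrable01.
have p0 y : 0 <= piso y by have /andP[] := piso01 y.
have c1 y : 0 <= expR (lambda * codeg x y) - 1.
  by rewrite subr_ge0 -expR0 ler_expR mulr_ge0 ?codeg_ge0 // ltW.
have mc : measurable_fun [set: E] (fun y => expR (lambda * codeg x y) - 1).
  apply: measurable_funB => //; apply: measurableT_comp => //.
  apply: measurable_funM => //.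
  exact: (measurableT_comp measurable_codeg (measurable_fun_pair (measurable_cst x) (@measurable_id _ _ _))).
have mp := measurable_piso.
pose I1 := (\int[nu]_y (b y * piso y)%:E)%E.
have I1fin : I1 \is a fin_num.
  rewrite /I1 integral_Rintegral //; last exact: measurable_funM.
  move=> y; rewrite mulr_ge0 // mulr_ile1 //; last by have /andP[] := piso01 y.
  by rewrite /b gerBl.
have E1 : (\int[nu]_y (b y * expR (- (lambda * (1 - \int[nu]_z h1 y z)%R)))%:E)%E = I1.
  by apply: eq_integral => y _; rewrite h1E.
have E2 : (\int[nu]_y (w x y * expR (- (lambda * (1 - \int[nu]_z h1 y z)%R)))%:E =
    \int[nu]_y (w x y * piso y)%:E)%E.
  by apply: eq_integral => y _; rewrite h1E.
have E3 : (\int[nu]_y (b y * expR (- (lambda * (1 - \int[nu]_z h2 y z)%R)))%:E =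
    \int[nu]_y (b y * (piso y * expR (lambda * codeg x y)))%:E)%E.
  apply: eq_integral => y _; rewrite h2E /piso -expRD; congr (_ * expR _)%:E; ring.
rewrite E1 E2 E3 in sum_key.
rewrite -(@leeD2rE _ (lambda%:E * I1)%E); last exact: fin_numM.
apply: le_trans sum_key _.
rewrite -addeA; apply: leeD.
  apply: le_trans (le_thinned_series k x).
  by rewrite le_eqVlt; apply/orP; left; apply/eqP/eq_eseriesr => n _; rewrite iSS.
clear iSS mSS SS0 mST ST0 key h1E h2E E1 E2 E3 h101 h201 mh2 h10 h20 cod01 mcod int1 I1fin.
have me : measurable_fun [set: E] (fun y => piso y * expR (lambda * codeg x y)).
  apply: measurable_funM => //; rewrite (_ : (fun _ => _) =
    fun y => 1 + (expR (lambda * codeg x y) - 1)); last first.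
    by apply/funext => y; rewrite addrC subrK.
  exact: measurable_funD.
have mE1 : measurable_fun [set: E] (fun y => (w x y * piso y)%:E).
  by apply/measurable_EFinP; apply: measurable_funM.
have mE2 : measurable_fun [set: E] (fun y => (b y * (piso y * expR (lambda * codeg x y)))%:E).
  by apply/measurable_EFinP; apply: measurable_funM.
have mE3 : measurable_fun [set: E] (fun y => (b y * piso y)%:E).
  by apply/measurable_EFinP; apply: measurable_funM.
have mE4 : measurable_fun [set: E] (fun y =>
    (piso y * (w x y + (expR (lambda * codeg x y) - 1)))%:E).
  by apply/measurable_EFinP; apply: measurable_funM => //; apply: measurable_funD.
have P1 y : (0 <= (w x y * piso y)%:E)%E by rewrite lee_fin mulr_ge0.
have P2 y : (0 <= (b y * (piso y * expR (lambda * codeg x y)))%:E)%E.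
  by rewrite lee_fin mulr_ge0 // mulr_ge0 ?expR_ge0.
have P3 y : (0 <= (b y * piso y)%:E)%E by rewrite lee_fin mulr_ge0.
have P4 y : (0 <= (piso y * (w x y + (expR (lambda * codeg x y) - 1)))%:E)%E.
  by rewrite lee_fin mulr_ge0 // addr_ge0.
rewrite -!ge0_muleDr; try by apply: integral_ge0.
rewrite lee_wpmul2l ?lee_fin ?(ltW lambda_gt0) //.
rewrite -!ge0_integralD //; apply: ge0_le_integral => //.
- by move=> y _; rewrite adde_ge0.
- exact: emeasurable_funD.
- exact: emeasurable_funD.
(* With [e] the exponential minus 1, the two sides differ by [w x y * piso y * e], which is
   nonnegative. *)
- move=> y _; rewrite -!EFinD lee_fin.
  set e := expR _ - 1; have e0 : 0 <= e by exact: c1.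
  have -> : expR (lambda * codeg x y) = e + 1 by rewrite /e subrK.
  have : 0 <= w x y * piso y * e by rewrite !mulr_ge0.
  rewrite /b; lra.
Qed.

Definition mean_iso : \bar R := (lambda%:E * \int[nu]_x (piso x)%:E)%E.
Definition coupling_error : \bar R := (\int[nu]_x \int[nu]_y
  (lambda ^+ 2 * (piso x * piso y * (w x y + (expR (lambda * codeg x y) - 1))))%:E)%E.

(** Multiply [thinning_bound] by [piso x], which cancels [expR (lambda * deg x)], and integrate over
    [x]; [iso_probS] recognises the first term on the right. *)
Lemma iso_prob_step k :
  (mean_iso * iso_prob k <= k.+1%:R%:E * iso_prob k.+1 + coupling_error)%E.
Proof.
have p0 x : 0 <= piso x by have /andP[] := piso01 x.
have l0 := ltW lambda_gt0.
have ip0 j : (0 <= iso_prob j)%E.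
  apply: nneseries_ge0 => n _ _; rewrite mule_ge0 ?lee_fin ?pois_ge0 // iter_int_ge0 // => s.
  exact: iso_coef_ge0.
have ipx0 x : (0 <= iso_prob_at k x)%E.
  by apply: nneseries_ge0 => n _ _; rewrite mule_ge0 ?lee_fin ?pois_ge0 // iter_int_ge0.
have mipx : measurable_fun [set: E] (iso_prob_at k).
  apply: ge0_emeasurable_sum => [n x _ _|n _].
    by rewrite mule_ge0 ?lee_fin ?pois_ge0 // iter_int_ge0.
  exact: measurable_iso_prob_at_term.
pose f x y := piso x * piso y * (w x y + (expR (lambda * codeg x y) - 1)).
have c1 x y : 0 <= expR (lambda * codeg x y) - 1.
  by rewrite subr_ge0 -expR0 ler_expR mulr_ge0 ?codeg_ge0.
have f0 x y : 0 <= f x y by rewrite !mulr_ge0 // addr_ge0.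
have mf : measurable_fun [set: E * E] (fun p => f p.1 p.2).
  apply: measurable_funM; first apply: measurable_funM.
  - exact: (measurableT_comp measurable_piso measurable_fst).
  - exact: (measurableT_comp measurable_piso measurable_snd).
  - apply: measurable_funD => //; apply: measurable_funB => //.
    apply: measurableT_comp => //; apply: measurable_funM => //.
    exact: measurable_codeg.
have mfx x : measurable_fun [set: E] (fun y => (f x y)%:E).
  apply/measurable_EFinP.
  exact: (measurableT_comp mf (measurable_fun_pair (measurable_cst x) (@measurable_id _ _ _))).
have mint : measurable_fun [set: E] (fun x => \int[nu]_y (f x y)%:E)%E.
  have := @measurable_fun_fubini_tonelli_F _ _ _ _ R nu (fun p : E * E => (f p.1 p.2)%:E).
  by apply => [|p]; [exact/measurable_EFinP|rewrite lee_fin].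
have -> : coupling_error = (lambda%:E * \int[nu]_x (lambda%:E * \int[nu]_y (f x y)%:E))%E.
  rewrite -ge0_integralZl_EFin //; last 2 first.
  - by move=> x _; rewrite mule_ge0 ?lee_fin // integral_ge0 // => y _; rewrite lee_fin.
  - exact: measurable_funeM.
  apply: eq_integral => x _; rewrite muleA -EFinM -ge0_integralZl_EFin ?mulr_ge0 //.
  by move=> y _; rewrite lee_fin.
rewrite iso_probS -ge0_muleDr; last 2 first.
- by apply: integral_ge0 => x _.
- apply: integral_ge0 => x _; rewrite mule_ge0 ?lee_fin // integral_ge0 // => y _.
  by rewrite lee_fin.
rewrite /mean_iso -muleA lee_wpmul2l ?lee_fin //.
rewrite -ge0_integralZr //; last 2 first.
- by apply/measurable_EFinP; exact: measurable_piso.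
- by move=> x _; rewrite lee_fin.
rewrite -ge0_integralD //; last 2 first.
- by move=> x _; rewrite mule_ge0 ?lee_fin // integral_ge0 // => y _; rewrite lee_fin.
- exact: measurable_funeM.
apply: ge0_le_integral => //.
- by move=> x _; rewrite mule_ge0 ?lee_fin.
- by apply: emeasurable_funM => //; apply/measurable_EFinP; exact: measurable_piso.
- by apply: emeasurable_funD => //; exact: measurable_funeM.
move=> x _; apply: le_trans (_ : (piso x)%:E * ((expR (lambda * deg x))%:E * iso_prob_at k x +
    lambda%:E * \int[nu]_y
      (piso y * (w x y + (expR (lambda * codeg x y) - 1)))%:E) <= _)%E.
  by rewrite lee_wpmul2l ?lee_fin // thinning_bound.
rewrite ge0_muleDr; last 2 first.
- by rewrite mule_ge0 ?lee_fin ?expR_ge0.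
- rewrite mule_ge0 ?lee_fin // integral_ge0 // => y _.
  by rewrite lee_fin mulr_ge0 // addr_ge0.
rewrite muleA -EFinM {1}/piso -expRD addNr expR0 mul1e leeD // muleCA.
rewrite lee_wpmul2l ?lee_fin // -ge0_integralZl_EFin //.
- by rewrite le_eqVlt; apply/orP; left; apply/eqP/eq_integral => y _; rewrite -EFinM mulrA.
- by move=> y _; rewrite lee_fin mulr_ge0 // addr_ge0.
- apply/measurable_EFinP; apply: measurable_funM; first exact: measurable_piso.
  apply: measurable_funD; first exact: mw1.
  apply: measurable_funB => //; apply: measurableT_comp => //; apply: measurable_funM => //.
  exact: (measurableT_comp measurable_codeg (measurable_fun_pair (measurable_cst x) (@measurable_id _ _ _))).
Qed.

(** By Mecke's formula the sum is an integral over [x] of the probability that [x] is isolated and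
    fewer than [m] others are; dropping the second condition leaves [piso x]. *)
Lemma iso_prob_mean m :
  (\sum_(k < m) k.+1%:R%:E * iso_prob k.+1 <= mean_iso)%E.
Proof.
have l0 := ltW lambda_gt0.
have ipx0 k x : (0 <= iso_prob_at k x)%E.
  by apply: nneseries_ge0 => n _ _; rewrite mule_ge0 ?lee_fin ?pois_ge0 // iter_int_ge0.
have mipx k : measurable_fun [set: E] (iso_prob_at k).
  apply: ge0_emeasurable_sum => [n x _ _|n _].
    by rewrite mule_ge0 ?lee_fin ?pois_ge0 // iter_int_ge0.
  exact: measurable_iso_prob_at_term.
under eq_bigr do rewrite iso_probS.
rewrite -ge0_sume_distrr; last by move=> k _; exact: integral_ge0.
rewrite lee_wpmul2l ?lee_fin // -ge0_integral_sum //.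
apply: ge0_le_integral => //.
- by move=> x _; exact: sume_ge0.
- exact: emeasurable_sum.
- by apply/measurable_EFinP; exact: measurable_piso.
move=> x _; have /andP[d0 d1] := deg01 x.
rewrite /iso_prob_at -nneseries_sum; last first.
  by move=> k n _; rewrite mule_ge0 ?lee_fin ?pois_ge0 // iter_int_ge0.
have -> : (piso x)%:E = (\sum_(0 <= n <oo) (pois n * (1 - deg x) ^+ n)%:E)%E.
  by rewrite pois_pgf ?subr_ge0 // subKr.
apply: lee_nneseries.
  move=> n _ _; apply: sume_ge0 => k _.
  by rewrite mule_ge0 ?lee_fin ?pois_ge0 // iter_int_ge0.
move=> n _; rewrite -ge0_sume_distrr; last by move=> k _; rewrite iter_int_ge0.
rewrite [leRHS]EFinM lee_wpmul2l ?lee_fin ?pois_ge0 //.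
have m1 : measurable_fun [set: E] (fun y => 1 - w x y) by exact: measurable_funB.
have g0 y : 0 <= 1 - w x y by rewrite subr_ge0.
rewrite -(@iter_int_prod _ E R nu n (fun y => 1 - w x y) _ g0 m1); last first.
  rewrite integral_Rintegral //; last by move=> y; rewrite g0 /= gerBl w_ge0.
  rewrite RintegralB //; last 2 first.
  - by apply: integrable01 => // z; rewrite ler01 lexx.
  - exact: integrable01.
  rewrite Rintegral_cst // mul1r; congr (_ - _)%:E.
  transitivity (fine (1%E : \bar R)) => //.
  by congr fine; exact: probability_setT.
rewrite -[leLHS]iter_int_sum //; last by move=> k; exact: misox.
apply: le_iter_int.
- by move=> s; apply: sumr_ge0.
- move=> s _; rewrite -mulr_sumr ler_piMr ?prodr_ge0 //.
  exact: sum_iso_coef_le1.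
- by move=> s; rewrite prodr_ge0.
- by apply: measurable_sum => k; exact: misox.
- exact: measurable_prod_seq.
Qed.

End isolated_counts.

(** * Lebesgue measure on R^n: translation invariance and the uniform law on the cube *)

Section lebesgue_translation.
Context (R : realType).
Local Notation L := (@lebesgue_measure R).

Lemma ge0_integral_translation1 (f : R -> \bar R) (a : R) :
  measurable_fun [set: measurableTypeR R] f -> (forall x, 0 <= f x)%E ->
  (\int[L]_x f (x + a)%R = \int[L]_x f x)%E.
Proof.
move=> mf f0.
have ma : measurable_fun [set: measurableTypeR R] (fun x => x + a : measurableTypeR R).
  by apply: measurable_funD.
pose m0 mf : {measure set (measurableTypeR R) -> \bar R} :=
  measure_function_pushforward__canonical__measure_function_Measure L
    (f := fun x => x + a : measurableTypeR R) mf.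
have -> : (\int[L]_x f x = \int[m0 ma]_x f x)%E.
  apply: eq_measure_integral => A mA _.
  apply: lebesgue_measure_unique => // _ [[b c]] _ <-.
  rewrite /= /pushforward /=.
  rewrite (_ : _ @^-1` _ = `]b - a, c - a]%classic); last first.
    by apply/seteqP; split => x /=; rewrite !in_itv /= ltrBlDr lerBrDr.
  rewrite !lebesgue_measure_itv /= !lte_fin ltrD2r -!EFinB.
  by case: ifP => // _; congr (_%:E); ring.
by rewrite (ge0_integral_pushforward ma).
Qed.

Lemma ge0_integral_rV_cons n (f : 'rV[R]_n.+1 -> \bar R) :
  measurable_fun [set: 'rV[R]_n.+1] f -> (forall x, 0 <= f x)%E ->
  (\int[lebesgue_rV R n.+1]_v f v =
   \int[L]_x \int[lebesgue_rV R n]_v f (rV_cons (x, v)))%E.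
Proof.
move=> mf f0.
pose c (p : measurableTypeR R * 'rV[R]_n) : 'rV[R]_n.+1 := rV_cons p.
have mc : measurable_fun [set: measurableTypeR R * 'rV[R]_n] c.
  exact: (@measurable_rV_cons R n).
pose m1 : {measure set (measurableTypeR R * 'rV[R]_n)%type -> \bar R} :=
  (L \x lebesgue_rV R n)%E.
pose m0 mf : {measure set 'rV[R]_n.+1 -> \bar R} :=
  measure_function_pushforward__canonical__measure_function_Measure m1 (f := c) mf.
transitivity (\int[m0 mc]_v f v)%E.
  by apply: eq_measure_integral.
transitivity (\int[m1]_p f (c p))%E.
  by rewrite [LHS](ge0_integral_pushforward mc m1 measurableT mf (fun x _ => f0 x)).
rewrite /m1 fubini_tonelli1 //.
exact: (measurableT_comp mf mc).
Qed.

Lemma measurable_rV_add n (a : 'rV[R]_n) : measurable_fun [set: 'rV[R]_n] (fun v => v + a).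
Proof.
apply/measurable_fun_rVP => i; under eq_fun do rewrite mxE.
by apply: measurable_funD => //; exact: measurable_rV_coord.
Qed.

Lemma ge0_integral_translation n (f : 'rV[R]_n -> \bar R) (a : 'rV[R]_n) :
  measurable_fun [set: 'rV[R]_n] f -> (forall x, 0 <= f x)%E ->
  (\int[lebesgue_rV R n]_v f (v + a)%R = \int[lebesgue_rV R n]_v f v)%E.
Proof.
elim: n f a => [|n IH] f a mf f0.
  by apply: eq_integral => v _; congr f; apply/rowP => -[].
have mfa : measurable_fun [set: 'rV[R]_n.+1] (fun v => f (v + a)).
  exact: (measurableT_comp mf (measurable_rV_add a)).
have mfx x : measurable_fun [set: 'rV[R]_n] (fun v => f (rV_cons (x, v))).
  apply: (measurableT_comp mf); apply: (measurableT_comp (@measurable_rV_cons R n)).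
  by apply: measurable_fun_pair => //.
rewrite (ge0_integral_rV_cons mfa (fun v => f0 (v + a))) (ge0_integral_rV_cons mf f0).
have mg : measurable_fun [set: measurableTypeR R]
    (fun x => \int[lebesgue_rV R n]_v f (rV_cons (x, v)))%E.
  have := @measurable_fun_fubini_tonelli_F _ _ (measurableTypeR R) _ R (lebesgue_rV R n)
    (fun p => f (rV_cons p)).
  by apply => // ; exact: (measurableT_comp mf (@measurable_rV_cons R n)).
rewrite -(ge0_integral_translation1 (a ord0 ord0) mg); last first.
  by move=> x; exact: integral_ge0.
apply: eq_integral => x _.
rewrite -(IH (fun v => f (rV_cons (x + a ord0 ord0, v)))
  (\row_j a ord0 (lift ord0 j))) //.
apply: eq_integral => v _; congr f; apply/rowP => i; rewrite !mxE.
by case: unliftP => [j ->|->] /=; rewrite ?mxE.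
Qed.

Lemma cube_probability n : exists nu : probability 'rV[R]_n R,
  forall A, nu A = lebesgue_rV R n (A `&` unit_cube R n).
Proof.
have mC : measurable (unit_cube R n) by exact: measurable_rV_box.
pose m0 : {measure set 'rV[R]_n -> \bar R} := mrestr (lebesgue_rV R n) mC.
pose m1 : set 'rV[R]_n -> \bar R := m0.
have m1T : m1 setT = 1%E.
  rewrite /m1 /m0 /= /mrestr setTI /unit_cube lebesgue_rV_box // ?ler01 //.
  by rewrite big1 // => i _; rewrite subr0.
pose muM := isMeasure.Build _ _ _ m1 (measure0 m0) (measure_ge0 m0)
  (@measure_semi_sigma_additive _ _ _ m0).
pose m2 : {measure set 'rV[R]_n -> \bar R} := HB.pack m1 muM.
pose pM := Measure_isProbability.Build _ _ _ (m2 : set 'rV[R]_n -> \bar R) m1T.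
pose nu : probability 'rV[R]_n R := HB.pack m1 muM pM.
by exists nu.
Qed.

Lemma measurable_rV_sub n :
  measurable_fun [set: 'rV[R]_n * 'rV[R]_n] (fun p => p.2 - p.1).
Proof.
apply/measurable_fun_rVP => i; under eq_fun do rewrite !mxE.
apply: measurable_funD; first exact: (measurableT_comp (measurable_rV_coord i) measurable_snd).
by apply: measurableT_comp => //; exact: (measurableT_comp (measurable_rV_coord i) measurable_fst).
Qed.

End lebesgue_translation.

(** * Kernels of the class Phi *)

(* The sup norm replaces the Euclidean one at the cost of constants. *)
Record decaying_kernel (R : realType) d (eta C mu rho : R) (phi : 'rV[R]_d -> R) : Prop := {
  dk_connection : connection_function phi ;
  dk_mu : 0 < mu <= 1 ;
  dk_rho : 0 < rho ;
  dk_le : forall x, phi x <= mu ;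
  dk_ball : forall x : 'rV[R]_d, (forall i, `|x ord0 i| <= rho / (2 * d%:R)) -> eta * mu <= phi x ;
  dk_decay : forall (x : 'rV[R]_d) (t : R) i, 1 <= t -> t * rho <= `|x ord0 i| -> phi x <= C * mu / t ^+ d.+1 ;
  dk_mono : (3 <= d)%N -> forall x y : 'rV[R]_d,
    \sum_(i < d) x ord0 i ^+ 2 <= \sum_(i < d) y ord0 i ^+ 2 -> phi y <= phi x }.

Section Phi_class_bounds.
Context (R : realType).

Lemma le_coord_enorm d (x : 'rV[R]_d) i : `|x ord0 i| <= enorm x.
Proof.
rewrite /enorm -sqrtr_sqr ler_wsqrtr // (bigD1 i) //= lerDl.
by apply: sumr_ge0 => j _; exact: sqr_ge0.
Qed.

Lemma enorm_le d (x : 'rV[R]_d) r : 0 <= r ->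
  (forall i, `|x ord0 i| <= r) -> enorm x <= d%:R * r.
Proof.
move=> r0 xr; rewrite /enorm -[leRHS]ger0_norm ?mulr_ge0 // -sqrtr_sqr ler_wsqrtr //.
apply: (@le_trans _ _ (\sum_(i < d) r ^+ 2)).
  apply: ler_sum => i _; rewrite -real_normK ?num_real // lerXn2r ?nnegrE //.
rewrite sumr_const card_ord -[leLHS]mulr_natl exprMn ler_wpM2r ?sqr_ge0 //.
by case: d {x xr} => [|d]; rewrite ?expr0n // ler_eXnr // ler1n.
Qed.

Lemma expRN_le_pow (J : nat) (u : R) : 0 < u -> expR (- u) <= J.+1`!%:R / u ^+ J.+1.
Proof.
move=> u0; rewrite expRN -[leRHS]invrK invf_div lef_pV2 ?posrE ?expR_gt0 //; last first.
  by rewrite divr_gt0 ?exprn_gt0 // ltr0n fact_gt0.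
by apply: le_trans (expR_ge1Dxn J (ltW u0)); rewrite lerDr.
Qed.

(** The stretched exponential is traded for a power by [expRN_le_pow], with [J] so large that
    [eta * J.+1] reaches [d.+1], the exponent that makes the dyadic sum in [deg_le] converge. On the
    sup-norm ball of radius [rho / (2 * d)] the Euclidean norm is at most [rho / 2 < rho], hence
    [phi] is at least [eta * mu] there. *)
Lemma Phi_class_decaying d (eta : R) : (0 < d)%N -> 0 < eta <= 1 ->
  exists2 C, 1 <= C & forall phi : 'rV[R]_d -> R, Phi_class eta phi ->
    exists mu rho, decaying_kernel eta C mu rho phi.
Proof.
move=> d0 /andP[e0 e1].
have [J JE] : exists J : nat, d.+1%:R <= eta * J.+1%:R.
  exists (Num.trunc (d.+1%:R / eta)).
  rewrite mulrC -ler_pdivrMr // ltW //.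
  by have /andP[] := truncn_itv (divr_ge0 (ler0n R d.+1) (ltW e0)).
pose C := 1 + 3 * eta^-1 * (J.+1`!%:R / eta ^+ J.+1).
have C0 : 0 <= 3 * eta^-1 * (J.+1`!%:R / eta ^+ J.+1).
  by rewrite !mulr_ge0 ?invr_ge0 ?exprn_ge0 // ltW.
exists C; first by rewrite lerDl.
move=> phi [cphi /andP[rad0 radoo] dec mono].
pose mu := conn_sup phi; pose rho := fine (conn_radius eta phi).
have radfin : conn_radius eta phi \is a fin_num by rewrite ge0_fin_numE // ltW.
have radE : conn_radius eta phi = rho%:E by rewrite fineK.
have rho0 : 0 < rho by rewrite -lte_fin -radE.
have p01 x : 0 <= phi x <= 1 by exact: connection_itv cphi x.
have hs : has_sup (range phi).
  split; first by exists (phi 0); exists 0.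
  by exists 1 => _ [x _ <-]; have /andP[] := p01 x.
have lemu x : phi x <= mu by apply: sup_upper_bound => //; exists x.
have mu1 : mu <= 1 by apply: ge_sup => [|_ [x _ <-]]; [case: hs|have /andP[] := p01 x].
(* A finite radius means that [phi] drops below [eta * mu] somewhere; since [phi] is nonnegative
   this forces [mu > 0]. *)
have [z zE] : exists z, phi z < eta * mu.
  apply: contrapT => H; move: radoo; rewrite /conn_radius.
  rewrite (_ : [set x | phi x < eta * conn_sup phi] = set0) ?image_set0 ?ereal_inf0 ?ltxx //.
  by apply/seteqP; split => // x xE; apply: H; exists x.
have mu0 : 0 < mu.
  have /andP[z0 _] := p01 z.
  by have := le_lt_trans z0 zE; rewrite pmulr_rgt0.
exists mu, rho; split => //.
- by rewrite mu0.
- move=> x xr; rewrite leNgt; apply/negP => xE.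
  have : (conn_radius eta phi <= (enorm x)%:E)%E by apply: ereal_inf_lbound; exists x.
  rewrite radE lee_fin leNgt => /negP; apply.
  have d0R : 0 < d%:R :> R by rewrite ltr0n.
  have r0 : 0 <= rho / (2 * d%:R) by rewrite divr_ge0 ?mulr_ge0 // ltW.
  rewrite (le_lt_trans (enorm_le r0 xr)) // [X in X < _](_ : _ = rho / 2); first lra.
  by field; rewrite gt_eqF.
- move=> x t i t1 tx; apply: (le_trans (dec x)).
  have t0 : 0 < t by lra.
  set s := enorm x / _.
  have ts : t <= s.
    by rewrite /s ler_pdivlMr // (le_trans tx) // le_coord_enorm.
  have s1 : 1 <= s by lra.
  have s0 : 0 < s by lra.
  have u0 : 0 < eta * s `^ eta by rewrite mulr_gt0 // powR_gt0.
  apply: (@le_trans _ _ (3 * eta^-1 * mu * (J.+1`!%:R / (eta * s `^ eta) ^+ J.+1))).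
    rewrite ler_wpM2l ?mulr_ge0 ?invr_ge0 ?(ltW e0) ?(ltW mu0) // mulNr.
    exact: expRN_le_pow.
  apply: (@le_trans _ _ (3 * eta^-1 * mu * (J.+1`!%:R / (eta ^+ J.+1 * t ^+ d.+1)))).
    rewrite ler_wpM2l ?mulr_ge0 ?invr_ge0 ?(ltW e0) ?(ltW mu0) //.
    rewrite ler_wpM2l // lef_pV2 ?posrE ?exprn_gt0 ?mulr_gt0 ?exprn_gt0 ?powR_gt0 //.
    rewrite exprMn ler_wpM2l ?exprn_ge0 ?(ltW e0) //.
    rewrite -[leRHS]powR_mulrn ?powR_ge0 // -powRrM.
    apply: (@le_trans _ _ (s `^ d.+1%:R)); last by rewrite ler_powR.
    by rewrite powR_mulrn ?(ltW s0) // lerXn2r ?nnegrE ?(ltW s0) ?(ltW t0).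
  rewrite [leLHS](_ : _ = (3 * eta^-1 * (J.+1`!%:R / eta ^+ J.+1)) * mu / t ^+ d.+1).
    by rewrite ler_wpM2r ?invr_ge0 ?exprn_ge0 ?(ltW t0) // ler_wpM2r ?(ltW mu0) // /C lerDr.
  by rewrite invfM; ring.
- move=> d3 x y xy; have [_] := mono d3; apply.
  by rewrite /enorm ler_wsqrtr.
Qed.

End Phi_class_bounds.

Section kernel_integrals.
Context (R : realType) (d : nat).
Local Notation E := 'rV[R]_d.
Local Notation leb := (lebesgue_rV R d).
Variable nu : probability E R.
Hypothesis nuE : forall A, nu A = leb (A `&` unit_cube R d).

Lemma nu_box_le (a b : 'I_d -> R) : (forall i, a i <= b i) ->
  (nu (rV_box a b) <= (\prod_i (b i - a i))%:E)%E.
Proof.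
move=> ab; rewrite nuE -lebesgue_rV_box //; apply: le_measure => //.
- by rewrite inE; apply: measurableI; exact: measurable_rV_box.
- by rewrite inE; exact: measurable_rV_box.
Qed.

Lemma nu_box (a b : 'I_d -> R) : (forall i, a i <= b i) ->
  rV_box a b `<=` unit_cube R d -> nu (rV_box a b) = (\prod_i (b i - a i))%:E.
Proof. by move=> ab sub; rewrite nuE setIidl // lebesgue_rV_box. Qed.

Lemma ge0_integral_nu (f : E -> \bar R) : measurable_fun [set: E] f -> (forall x, 0 <= f x)%E ->
  (\int[nu]_x f x = \int[leb]_(x in unit_cube R d) f x)%E.
Proof.
move=> mf f0; have mC : measurable (unit_cube R d) by exact: measurable_rV_box.
rewrite -(ge0_integral_mrestr leb mC) //.
by apply: eq_measure_integral => A _ _; exact: nuE.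
Qed.

Lemma nu_ae_cube (f g : E -> \bar R) : measurable_fun [set: E] f -> (forall x, 0 <= f x)%E ->
  measurable_fun [set: E] g -> (forall x, 0 <= g x)%E ->
  (forall x, unit_cube R d x -> f x <= g x)%E -> (\int[nu]_x f x <= \int[nu]_x g x)%E.
Proof.
move=> mf f0 mg g0 fg; rewrite !ge0_integral_nu //.
have mC : measurable (unit_cube R d) by exact: measurable_rV_box.
by apply: ge0_le_integral => //; [exact: measurable_funTS|exact: measurable_funTS].
Qed.

Lemma box_lower_bound (h : E -> R) (c : R) (a b : 'I_d -> R) :
  (forall x, 0 <= h x <= 1) -> measurable_fun [set: E] h -> 0 <= c ->
  (forall i, a i <= b i) -> rV_box a b `<=` unit_cube R d ->
  (forall x, rV_box a b x -> c <= h x) ->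
  c * \prod_i (b i - a i) <= (\int[nu]_x h x)%R.
Proof.
move=> h01 mh c0 ab sub hc.
have mB : measurable (rV_box a b) by exact: measurable_rV_box.
rewrite -lee_fin -integral_Rintegral // EFinM -nu_box //.
apply: (@le_trans _ _ (\int[nu]_x (c * \1_(rV_box a b) x)%:E)%E).
  under eq_integral do rewrite EFinM.
  rewrite ge0_integralZl_EFin //.
  - by rewrite integral_indic // setIT.
  - by apply/measurable_EFinP; exact: measurable_indic.
apply: ge0_le_integral => //.
- by move=> x _; rewrite lee_fin mulr_ge0.
- by apply/measurable_EFinP; apply: measurable_funM => //; exact: measurable_indic.
- exact/measurable_EFinP.
- move=> x _; rewrite lee_fin indicE; case: (boolP (x \in _)) => [|_].
    by rewrite inE mulr1; exact: hc.
  by rewrite mulr0; have /andP[] := h01 x.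
Qed.

Variables (eta C mu rho : R) (phi : E -> R).
Hypothesis d_gt0 : (0 < d)%N.
Hypothesis eta01 : 0 < eta <= 1.
Hypothesis C_ge1 : 1 <= C.
Hypothesis dk : decaying_kernel eta C mu rho phi.

Definition kernel_pair (x y : E) : R := phi (y - x).
Local Notation w := kernel_pair.

Lemma kernel_pair01 x y : 0 <= w x y <= 1.
Proof. exact: connection_itv (dk_connection dk) _. Qed.

Lemma kernel_pairC x y : w x y = w y x.
Proof. by rewrite /w -(connection_even (dk_connection dk)) opprB. Qed.

Lemma measurable_kernel_pair : measurable_fun [set: E * E] (fun p => w p.1 p.2).
Proof.
exact: (measurableT_comp (connection_measurable (dk_connection dk)) (@measurable_rV_sub R d)).
Qed.

Let mw1 x : measurable_fun [set: E] (w x).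
Proof. exact: measurable_w1 measurable_kernel_pair x. Qed.

Let rho0 : 0 < rho := dk_rho dk.
Let mu0 : 0 < mu. Proof. by have /andP[] := dk_mu dk. Qed.
Let mu1 : mu <= 1. Proof. by have /andP[] := dk_mu dk. Qed.
Let eta0 : 0 < eta. Proof. by have /andP[] := eta01. Qed.
Let dR0 : 0 < d%:R :> R. Proof. by rewrite ltr0n. Qed.

(** Range of the kernel as seen from inside the unit cube; [deg_ge] and [deg_le] show that
    [mu * min1 ^+ d] is the order of [deg] at every point of the cube. *)
Definition min1 : R := Num.min 1 rho.

Let r0 : 0 < min1. Proof. by rewrite /min1 lt_min ltr01 rho0. Qed.
Let r1 : min1 <= 1. Proof. by rewrite /min1 ge_min lexx. Qed.
Let rrho : min1 <= rho. Proof. by rewrite /min1 ge_min lexx orbT. Qed.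

(** In each coordinate a box of side [min1 / (2 * d)] at [x] can be directed into the cube, and it
    lies in the ball where [phi] is at least [eta * mu]. *)
Lemma deg_ge x : unit_cube R d x ->
  eta / (2 * d%:R) ^+ d * (mu * min1 ^+ d) <= deg nu w x.
Proof.
move=> xC; pose s := min1 / (2 * d%:R).
have s0 : 0 < s by rewrite divr_gt0 // mulr_gt0.
have d1 : 1 <= d%:R :> R by rewrite ler1n.
have s1 : s <= 2^-1.
  rewrite /s ler_pdivrMr ?mulr_gt0 // mulrA mulVf ?mul1r ?pnatr_eq0 //.
  exact: le_trans r1 d1.
have srho : s <= rho / (2 * d%:R) by rewrite ler_pM2r // invr_gt0 mulr_gt0.
pose a i := if x ord0 i <= 2^-1 then x ord0 i else x ord0 i - s.
pose b i := a i + s.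
have := @box_lower_bound (w x) (eta * mu) a b (kernel_pair01 x) (mw1 x).
have -> : \prod_i (b i - a i) = s ^+ d.
  under eq_bigr do rewrite /b addrAC subrr add0r.
  by rewrite prodr_const card_ord.
move=> H; apply: le_trans (H _ _ _ _).
- rewrite /s expr_div_n le_eqVlt; apply/orP; left; apply/eqP; ring.
- by rewrite mulr_ge0 // ltW.
- by move=> i; rewrite /b lerDl ltW.
- move=> y yB i; have := yB i; have := xC i; rewrite /b /a => /andP[x0 x1].
  by case: ifP => [xi|/negbT]; rewrite -?ltNge => *; apply/andP; split; lra.
- move=> y yB; apply: (dk_ball dk) => i; rewrite !mxE (le_trans _ srho) //.
  have := yB i; rewrite /b /a; case: ifP => _ /andP[y0 y1]; rewrite ler_norml; apply/andP; split; lra.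
Qed.

(** Dyadic boxes of half-side [2 ^+ k * rho] around [x]: the volume grows like the [d]-th power of
    [2 ^+ k] while the kernel decays like its [d.+1]-st power, which leaves a geometric series. If
    [rho >= 1], the bound by [mu] alone suffices. *)
Lemma deg_le x : unit_cube R d x ->
  deg nu w x <= C * 2 ^+ (2 * d).+2 * (mu * min1 ^+ d).
Proof.
move=> xC.
have C0 : 0 < C by exact: lt_le_trans ltr01 C_ge1.
have mC : measurable (unit_cube R d) by exact: measurable_rV_box.
have p2 : 1 <= 2 ^+ (2 * d).+2 :> R by rewrite exprn_ege1 // ler1n.
rewrite -lee_fin -integral_Rintegral //; last exact: kernel_pair01.
have [rho1|rho1] := leP 1 rho.
  have -> : min1 = 1 by rewrite /min1 min_l.
  rewrite expr1n mulr1.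
  apply: (@le_trans _ _ (\int[nu]_y (cst mu%:E) y)%E).
    apply: ge0_le_integral => //.
    - by move=> y _; rewrite lee_fin; have /andP[] := kernel_pair01 x y.
    - exact/measurable_EFinP.
    - by move=> y _; rewrite lee_fin; exact: dk_le dk _.
  rewrite integral_cst //; apply: (@le_trans _ _ (mu%:E * 1)%E).
    by rewrite le_eqVlt; apply/orP; left; apply/eqP; congr (_ * _)%E; exact: probability_setT.
  rewrite mule1.
  by rewrite lee_fin ler_peMl ?(ltW mu0) // mulr_ege1.
have -> : min1 = rho by rewrite /min1 min_r // ltW.
have [K KE] : exists K : nat, 1 <= 2 ^+ K * rho.
  exists (Num.trunc rho^-1).+1.
  have ri0 : 0 <= rho^-1 by rewrite invr_ge0 ltW.
  have /andP[_ H] := truncn_itv ri0.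
  rewrite -ler_pdivrMr // div1r (le_trans (ltW H)) //.
  by rewrite -natrX ler_nat ltnW // ltn_expl.
pose B k := rV_box (fun i => x ord0 i - 2 ^+ k * rho) (fun i => x ord0 i + 2 ^+ k * rho).
(* Outside [B k] the decay is known with [t = 2 ^+ k] but is charged to [B k.+1]; the factor
   [2 ^+ d.+1] pays for this shift. *)
pose c k : R := C * mu * 2 ^+ d.+1 / (2 ^+ k) ^+ d.+1.
have c0 k : 0 <= c k by rewrite /c !mulr_ge0 ?invr_ge0 ?exprn_ge0 // ltW.
have mB k : measurable (B k) by exact: measurable_rV_box.
have dom y : unit_cube R d y -> w x y <= \sum_(k < K.+1) c k * \1_(B k) y.
  move=> yC.
  have BK : B K y.
    move=> i; have := xC i; have := yC i; move=> /andP[y0 y1] /andP[x0 x1].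
    by apply/andP; split; lra.
  have [k kB kmin] : exists2 k, B k y & forall j, (j < k)%N -> ~ B j y.
    have ex : exists k, `[< B k y >] by exists K; exact/asboolP.
    have [k /asboolP Bk kmin] := ex_minnP ex.
    by exists k => // j jk /asboolP Bj; have := kmin _ Bj; rewrite leqNgt jk.
  have kK : (k < K.+1)%N by rewrite ltnS leqNgt; apply/negP => /kmin.
  rewrite (bigD1 (Ordinal kK)) //= indicE mem_set // mulr1 -[leLHS]addr0 lerD //; last first.
    by apply: sumr_ge0 => j _; rewrite mulr_ge0.
  case: k kB kmin kK => [|k] kB kmin kK.
    rewrite /c expr0 expr1n divr1 (le_trans (dk_le dk _)) // -mulrA mulrCA ler_peMr ?(ltW mu0) //.
    by rewrite mulr_ege1 // exprn_ege1 // ler1n.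
  have /existsNP[i iB] := kmin k (ltnSn k).
  have i2 : 2 ^+ k * rho <= `|(y - x) ord0 i|.
    rewrite !mxE leNgt; apply/negP; rewrite ltr_norml => /andP[l1 l2]; apply: iB.
    by apply/andP; split; lra.
  have k1 : 1 <= 2 ^+ k :> R by rewrite exprn_ege1 // ler1n.
  rewrite /w (le_trans (dk_decay dk k1 i2)) // /c [(2 : R) ^+ k.+1]exprS exprMn invfM.
  rewrite [leRHS](_ : _ = C * mu / (2 ^+ k) ^+ d.+1 * (2 ^+ d.+1 / 2 ^+ d.+1)); last ring.
  by rewrite divff ?mulr1 // expf_neq0 // pnatr_eq0.
apply: (@le_trans _ _ (\int[nu]_y (\sum_(k < K.+1) c k * \1_(B k) y)%:E)%E).
  apply: nu_ae_cube.
  - exact/measurable_EFinP.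
  - by move=> y; rewrite lee_fin; have /andP[] := kernel_pair01 x y.
  - apply/measurable_EFinP; apply: measurable_sum => k.
    by apply: measurable_funM => //; exact: measurable_indic.
  - by move=> y; rewrite lee_fin sumr_ge0 // => k _; rewrite mulr_ge0.
  - by move=> y yC; rewrite lee_fin dom.
under eq_integral do rewrite -sumEFin.
rewrite ge0_integral_sum //; last 2 first.
- move=> k; apply/measurable_EFinP.
  by apply: measurable_funM => //; exact: measurable_indic.
- by move=> k y _; rewrite lee_fin mulr_ge0.
apply: (@le_trans _ _ (\sum_(k < K.+1) (c k * (2 * (2 ^+ k * rho)) ^+ d)%:E)%E).
  apply: lee_sum => k _; under eq_integral do rewrite EFinM.
  rewrite ge0_integralZl_EFin //; last by apply/measurable_EFinP; exact: measurable_indic.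
  rewrite integral_indic // setIT [leRHS]EFinM lee_wpmul2l ?lee_fin //.
  have k0 : 0 <= 2 ^+ k * rho by rewrite mulr_ge0 ?exprn_ge0 // ltW.
  apply: le_trans (nu_box_le _) _; first by move=> i; lra.
  rewrite lee_fin (eq_bigr (fun=> 2 * (2 ^+ k * rho))); last by move=> i _; ring.
  by rewrite prodr_const card_ord.
rewrite sumEFin lee_fin.
have cE k : c k * (2 * (2 ^+ k * rho)) ^+ d = C * mu * rho ^+ d * 2 ^+ (2 * d).+1 * 2^-1 ^+ k.
  rewrite /c !exprMn exprSr exprVn.
  have k2 : (2 ^+ k : R) != 0 by rewrite expf_neq0 // pnatr_eq0.
  have kd : ((2 ^+ k) ^+ d : R) != 0 by rewrite expf_neq0.
  rewrite [in RHS]exprS mul2n -addnn exprD exprSr invfM.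
  rewrite [LHS](_ : _ = C * mu * rho ^+ d * (2 * (2 ^+ d * 2 ^+ d)) / 2 ^+ k *
    ((2 ^+ k) ^+ d / (2 ^+ k) ^+ d)); last ring.
  by rewrite divff // mulr1.
under eq_bigr do rewrite cE.
rewrite -mulr_sumr.
have geo : \sum_(k < K.+1) 2^-1 ^+ k <= 2 :> R.
  suff -> : \sum_(k < K.+1) 2^-1 ^+ k = 2 - 2^-1 ^+ K :> R by rewrite gerBl exprn_ge0.
  elim: K {KE dom} => [|K IH]; first by rewrite big_ord1 !expr0; ring.
  by rewrite big_ord_recr /= IH exprS; field.
apply: (@le_trans _ _ (C * mu * rho ^+ d * 2 ^+ (2 * d).+1 * 2)).
  rewrite ler_wpM2l // !mulr_ge0 ?exprn_ge0 // ?(ltW C0) ?(ltW mu0) ?(ltW rho0) //.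
by rewrite le_eqVlt; apply/orP; left; apply/eqP; rewrite [in RHS]exprSr; ring.
Qed.

End kernel_integrals.

(** * Lower bounds on the mass that only one of two vertices sees *)

Section telescoping.
Context (R : realType) (d : nat).
Local Notation E := 'rV[R]_d.
Local Notation leb := (lebesgue_rV R d).
Variable nu : probability E R.
Hypothesis nuE : forall A, nu A = leb (A `&` unit_cube R d).
Variable phi : E -> R.
Hypothesis phiP : connection_function phi.

Definition private_mass (x y : E) : R :=
  (\int[nu]_z (kernel_pair phi y z * (1 - kernel_pair phi x z)))%R.

Let phi01 x : 0 <= phi x <= 1 := connection_itv phiP x.

Let mshift (a : E) : measurable_fun [set: E] (fun z => phi (z + a)).
Proof. exact: measurableT_comp (connection_measurable phiP) (measurable_rV_add a). Qed.

(* The translates of the box by multiples of [u] are disjoint and the integrals of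
   [phi - phi (_ + u)] over them telescope. *)
Lemma private_mass_ge (x y u : E) (M : nat) (lo hi : 'I_d -> R) (c : R) : 0 <= c ->
  (forall i, lo i <= hi i) ->
  (exists i, hi i - lo i < `|u ord0 i|) ->
  (forall b, rV_box lo hi b -> forall k, (k < M)%N -> unit_cube R d (b + u *+ k + y)) ->
  (forall b, rV_box lo hi b -> forall k, (k < M)%N ->
     phi (b + u *+ k + (y - x)) <= phi (b + u *+ k.+1)) ->
  (forall b, rV_box lo hi b -> c <= phi b - phi (b + u *+ M)) ->
  c * \prod_i (hi i - lo i) <= private_mass x y.
Proof.
move=> c0 lohi [i0 ui0] cube step drop.
pose B := rV_box lo hi.
have mB : measurable B by exact: measurable_rV_box.
have mC : measurable (unit_cube R d) by exact: measurable_rV_box.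
pose h (z : E) := phi (z - y) * (1 - phi (z - x)).
have h01 z : 0 <= h z <= 1.
  have := phi01 (z - y); have := phi01 (z - x) => /andP[? ?] /andP[? ?].
  by rewrite /h; apply/andP; split; nra.
have mh : measurable_fun [set: E] h.
  by apply: measurable_funM; [exact: mshift|apply: measurable_funB => //; exact: mshift].
rewrite -lee_fin /private_mass -[X in (_ <= (X)%:E)%E]/(\int[nu]_z h z)%R -integral_Rintegral //.
rewrite ge0_integral_nu //; last 2 first.
- exact/measurable_EFinP.
- by move=> z; rewrite lee_fin; have /andP[] := h01 z.
rewrite integral_mkcond.
pose g k (z : E) := \1_B (z - (u *+ k + y)) * h z.
have mI a : measurable_fun [set: E] (fun z : E => \1_B (z - a) : R).
  have mi : measurable_fun [set: E] (\1_B : E -> R) by exact: measurable_indic.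
  exact: measurableT_comp mi (measurable_rV_add (- a)).
have g0 k z : 0 <= g k z by rewrite mulr_ge0 //; have /andP[] := h01 z.
have mg k : measurable_fun [set: E] (g k) by apply: measurable_funM.
apply: (@le_trans _ _ (\int[leb]_z (\sum_(k < M) g k z)%:E)%E); last first.
  apply: ge0_le_integral => //.
  - by move=> z _; rewrite lee_fin sumr_ge0.
  - by apply/measurable_EFinP; apply: measurable_sum.
  - by apply/(measurable_restrictT _ mC); apply: measurable_funTS; exact/measurable_EFinP.
  - move=> z _; rewrite patchE.
    have [[k kB]|none] := pselect (exists k : 'I_M, B (z - (u *+ k + y))); last first.
      rewrite big1 => [|k _]; last first.
        by rewrite /g indicE memNset ?mul0r // => kB; apply: none; exists k.
      by case: ifP => // _; rewrite lee_fin; have /andP[] := h01 z.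
    have zC : unit_cube R d z.
      by have := cube _ kB k (ltn_ord k); rewrite -addrA subrK.
    rewrite mem_set // lee_fin (bigD1 k) //= big1 ?addr0 => [|l lk].
      by rewrite /g indicE mem_set // mul1r.
    rewrite /g indicE memNset ?mul0r // => lB.
    (* A point in two translates would make a nonzero multiple of [u] no longer than the box in
       direction [i0], contrary to the choice of [i0]. *)
    have := kB i0; have := lB i0; rewrite !mxE !mulmxnE => /andP[l1 l2] /andP[k1 k2].
    move: ui0; rewrite ltNge => /negP; apply.
    have [lk'|kl|e] := ltngtP l k; last by case/eqP: lk; exact/val_inj.
    - have e : u ord0 i0 *+ k = u ord0 i0 *+ l + u ord0 i0 *+ (k - l) by rewrite -mulrnDr subnKC // ltnW.
      have : `|u ord0 i0| <= `|u ord0 i0 *+ (k - l)|.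
        by rewrite normrMn -[leRHS]mulr_natr ler_peMr // ler1n subn_gt0.
      move=> /le_trans; apply; move: e l1 l2 k1 k2; set p := _ *+ _; set q := _ *+ _; set r := _ *+ _ => *; rewrite ler_norml; apply/andP; split; lra.
    - have e : u ord0 i0 *+ l = u ord0 i0 *+ k + u ord0 i0 *+ (l - k) by rewrite -mulrnDr subnKC // ltnW.
      have : `|u ord0 i0| <= `|u ord0 i0 *+ (l - k)|.
        by rewrite normrMn -[leRHS]mulr_natr ler_peMr // ler1n subn_gt0.
      move=> /le_trans; apply; move: e l1 l2 k1 k2; set p := _ *+ _; set q := _ *+ _; set r := _ *+ _ => *; rewrite ler_norml; apply/andP; split; lra.
under eq_integral do rewrite -sumEFin.
rewrite ge0_integral_sum //; last 2 first.
- by move=> k; exact/measurable_EFinP.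
- by move=> k z _; rewrite lee_fin.
have shift (k : 'I_M) : (\int[leb]_z (g k z)%:E = \int[leb]_b (g k (b + (u *+ k + y)))%:E)%E.
  rewrite [RHS](@ge0_integral_translation _ _ (fun z => (g k z)%:E)) //; last by move=> z; rewrite lee_fin.
  by apply/measurable_EFinP; exact: mg.
have gS (k : 'I_M) b : g k (b + (u *+ k + y)) = \1_B b * (phi (b + u *+ k) * (1 - phi (b + u *+ k + (y - x)))).
  by rewrite /g addrK /h !addrA addrK.
pose g' (k : nat) (b : E) := \1_B b * (phi (b + u *+ k) * (1 - phi (b + u *+ k + (y - x)))).
have mg' k : measurable_fun [set: E] (fun b => (g' k b)%:E).
  apply/measurable_EFinP; apply: measurable_funM; first exact: measurable_indic.
  apply: measurable_funM; first exact: mshift.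
  apply: measurable_funB => //; under eq_fun do rewrite -addrA; exact: mshift.
have g'0 k b : 0 <= g' k b.
  have := phi01 (b + u *+ k); have := phi01 (b + u *+ k + (y - x)) => /andP[? ?] /andP[? ?].
  by rewrite /g' !mulr_ge0 // subr_ge0.
rewrite (eq_bigr (fun k : 'I_M => (\int[leb]_b (g' k b)%:E)%E)); last first.
  by move=> k _; rewrite [LHS]shift; apply: eq_integral => b _; rewrite gS.
rewrite -(ge0_integral_sum leb measurableT (fun k : 'I_M => mg' k)); last first.
  by move=> k b _; rewrite lee_fin.
rewrite EFinM -lebesgue_rV_box // -/B -[in leLHS](setIT B) -integral_indic //.
rewrite -ge0_integralZl_EFin //; last by apply/measurable_EFinP; exact: measurable_indic.
apply: ge0_le_integral => //.
- by move=> b _; rewrite -EFinM lee_fin mulr_ge0.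
- by apply: emeasurable_funM => //; apply/measurable_EFinP; exact: measurable_indic.
- by apply: emeasurable_sum.
move=> b _; rewrite sumEFin -EFinM lee_fin /g' -mulr_sumr mulrC.
have [bB|bB] := boolP (b \in B); last by rewrite indicE (negbTE bB) !mul0r.
rewrite indicE bB !mul1r; rewrite inE in bB.
apply: le_trans (drop _ bB) _.
(* For values in [0,1], [p * (1 - p')] is at least [p - p'], and here [p'] is at most the value of
   [phi] at the next point of the progression, so the sum dominates a telescoping one. *)
rewrite -[leLHS]opprB -[X in _ - X](_ : phi (b + u *+ 0) = _); last by rewrite mulr0n addr0.
rewrite -(telescope_sumr (fun k => phi (b + u *+ k))) // -sumrN big_mkord.
apply: ler_sum => k _; have := step b bB k (ltn_ord k).
have := phi01 (b + u *+ k); have := phi01 (b + u *+ k.+1); have := phi01 (b + u *+ k + (y - x)).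
by move=> /andP[? ?] /andP[? ?] /andP[? ?] ?; nra.
Qed.

End telescoping.

(** The first bound makes the walk long enough for [phi] to decay, the second keeps all earlier
    positions inside the cube. *)
Lemma step_count (R : realType) (q del : R) : 0 <= q -> 0 < del ->
  exists2 M : nat, q <= M%:R * del & forall k, (k < M)%N -> k%:R * del <= q.
Proof.
move=> q0 del0; have qd0 : 0 <= q / del by rewrite divr_ge0 // ltW.
have /andP[H1 H2] := truncn_itv qd0; exists (Num.trunc (q / del)).+1.
  by rewrite -ler_pdivrMr // ltW.
by move=> k kM; rewrite -ler_pdivlMr // (le_trans _ H1) // ler_nat -ltnS.
Qed.

Lemma ord2_other d (i : 'I_d) : d = 2 -> exists j, forall k : 'I_d, k = i \/ k = j.
Proof.
move=> d2; subst d; exists (if i == ord0 then ord_max else ord0) => k.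
by case: i k => [[|[|//]] ?] [[|[|//]] ?]; (left + right); apply/val_inj.
Qed.

Section separation.
Context (R : realType) (d : nat).
Local Notation E := 'rV[R]_d.
Local Notation leb := (lebesgue_rV R d).
Variable nu : probability E R.
Hypothesis nuE : forall A, nu A = leb (A `&` unit_cube R d).
Variables (eta C mu rho : R) (phi : E -> R).
Hypothesis d_gt0 : (0 < d)%N.
Hypothesis eta01 : 0 < eta <= 1.
Hypothesis C_ge1 : 1 <= C.
Hypothesis dk : decaying_kernel eta C mu rho phi.

Local Notation D := (private_mass nu phi).
Let K0 : R := 2 * C / eta.

Let rho0 : 0 < rho := dk_rho dk.
Let mu0 : 0 < mu. Proof. by have /andP[] := dk_mu dk. Qed.
Let mu1 : mu <= 1. Proof. by have /andP[] := dk_mu dk. Qed.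
Let eta0 : 0 < eta. Proof. by have /andP[] := eta01. Qed.
Let eta1 : eta <= 1. Proof. by have /andP[] := eta01. Qed.
Let dR1 : 1 <= d%:R :> R. Proof. by rewrite ler1n. Qed.
Let dR0 : 0 < d%:R :> R. Proof. by rewrite ltr0n. Qed.

Let K02 : 2 <= K0. Proof. by rewrite /K0 ler_pdivlMr //; have := eta1; have := C_ge1; lra. Qed.

Lemma small_ball_radius : 0 < rho / (2 * d%:R) <= rho / 2.
Proof.
rewrite divr_gt0 ?mulr_gt0 //= ler_pM2l // lef_pV2 ?posrE ?mulr_gt0 //.
by rewrite ler_peMr.
Qed.

(** The origin of [K0 = 2 * C / eta]: at that many radii the decay bound, with all but one power of
    [K0] dropped, is half of the value [eta * mu] guaranteed on the small ball. *)
Lemma kernel_far_le (z : E) i : K0 * rho <= `|z ord0 i| -> phi z <= eta * mu / 2.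
Proof.
move: (K02) => hK H; have K01 : 1 <= K0 by lra.
apply: le_trans (dk_decay dk K01 H) _.
have p1 : K0 <= K0 ^+ d.+1 by rewrite exprS ler_peMr ?exprn_ege1 //; lra.
rewrite ler_pdivrMr; last by apply: lt_le_trans p1; lra.
apply: (@le_trans _ _ (eta * mu / 2 * K0)); last first.
  by rewrite ler_wpM2l // !mulr_ge0 // ltW.
rewrite /K0 le_eqVlt; apply/orP; left; apply/eqP; field.
by rewrite gt_eqF.
Qed.

(** With step [u = y - x] the comparison required at each step is an equality. The signs [o] choose
    the side of each axis on which the box lies, so that it can point into the cube; its side in
    direction [i] is shrunk by [t] to be shorter than the step. The [1] in [K0 + 1] absorbs the
    extent of the box. *)
Lemma private_mass_chain (x y : E) i (o : 'I_d -> bool) M (t : R) : 0 < t <= 1 ->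
  t * rho <= `|(y - x) ord0 i| -> (K0 + 1) * rho <= M%:R * `|(y - x) ord0 i| ->
  (forall j k c, (k < M)%N -> 0 <= c <= rho / (2 * d%:R) ->
    0 <= y ord0 j + (if o j then c else - c) + k%:R * (y - x) ord0 j <= 1) ->
  eta * mu / 2 * (t * (rho / (2 * d%:R)) ^+ d) <= D x y.
Proof.
move=> /andP[t0 t1] tv Mv cube; move: (K02) => hK.
have /andP[br0 br1] := small_ball_radius; set r := rho / (2 * d%:R) in br0 br1 cube *.
pose W j := if j == i then t * r else r.
pose lo j := if o j then 0 else - W j.
pose hi j := if o j then W j else 0.
have W0 j : 0 < W j by rewrite /W; case: ifP => // _; rewrite mulr_gt0.
have Wr j : W j <= r by rewrite /W; case: ifP => // _; rewrite ler_piMl // ltW.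
have HW j : hi j - lo j = W j by rewrite /hi /lo; case: ifP => _; lra.
have -> : t * r ^+ d = \prod_j (hi j - lo j).
  under eq_bigr do rewrite HW.
  rewrite (bigD1 i) //= {1}/W eqxx (eq_bigr (fun=> r)) => [|j /negbTE ji]; last by rewrite /W ji.
  rewrite prodr_const (_ : #|_| = d.-1); last by rewrite cardC1 card_ord.
  by rewrite -mulrA -exprS prednK.
have Bb b : rV_box lo hi b -> forall j, exists2 c, 0 <= c <= r & b ord0 j = if o j then c else - c.
  move=> bB j; have := bB j; rewrite /lo /hi; have := Wr j; case: ifP => _ wr /andP[b0 b1].
    by exists (b ord0 j) => //; apply/andP; split; lra.
  by exists (- b ord0 j) => //; [apply/andP; split; lra|rewrite opprK].
have Babs b : rV_box lo hi b -> forall j, `|b ord0 j| <= r.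
  by move=> /Bb + j => /(_ j)[c /andP[c0 c1] ->]; case: ifP => _; rewrite ?normrN ger0_norm.
apply: (@private_mass_ge _ _ nu nuE phi (dk_connection dk) x y (y - x) M lo hi).
- by rewrite !mulr_ge0 // ltW.
- by move=> j; rewrite -subr_ge0 HW ltW.
- exists i; rewrite HW /W eqxx (lt_le_trans _ tv) // ltr_pM2l //; lra.
- move=> b bB k kM j; have [c c01 bj] := Bb b bB j; have := cube j k c kM c01.
  by rewrite -bj !mxE !mulmxnE !mxE -[_ *+ k]mulr_natl => /andP[? ?]; apply/andP; split; lra.
- by move=> b _ k _; rewrite mulrSr [in leRHS]addrA.
- move=> b bB.
  have : eta * mu <= phi b by apply: dk_ball dk _ _ => j; exact: Babs.
  suff : phi (b + (y - x) *+ M) <= eta * mu / 2 by lra.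
  apply: (@kernel_far_le _ i); have := Babs b bB i; rewrite !mxE !mulmxnE !mxE -[_ *+ M]mulr_natl.
  have := lerB_normD (M%:R * (y ord0 i - x ord0 i)) (b ord0 i).
  rewrite normrM normr_nat [b _ _ + _]addrC; move: Mv; rewrite !mxE => *; lra.
Qed.

End separation.

(* Here the step is a small multiple of the [i]-th unit vector; the box sits where the
   [i]-th coordinate dominates, so that moving by [y - x] increases the norm more
   than moving by one step. *)
Lemma private_mass_mono (R : realType) d (nu : probability 'rV[R]_d R) (eta C mu rho : R)
    (phi : 'rV[R]_d -> R) (x y : 'rV[R]_d) i (s : bool) (t : R) :
  (forall A, nu A = lebesgue_rV R d (A `&` unit_cube R d)) ->
  (0 < d)%N -> 0 < eta <= 1 -> 1 <= C -> decaying_kernel eta C mu rho phi ->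
  (3 <= d)%N -> 0 < t <= 1 ->
  (2 * C / eta + 1) * rho <= 4^-1 -> unit_cube R d y ->
  (forall j, `|(y - x) ord0 j| <= `|(y - x) ord0 i|) ->
  t * rho <= (if s then (y - x) ord0 i else - (y - x) ord0 i) ->
  (if s then y ord0 i <= 3 / 4 else 4^-1 <= y ord0 i) ->
  eta * mu / 2 * (t * (rho / (8 * d%:R ^+ 2)) ^+ d) <= private_mass nu phi x y.
Proof.
move=> nuE d_gt0 eta01 C_ge1 dk.
have rho0 : 0 < rho := dk_rho dk.
have /andP[mu0 mu1] := dk_mu dk; have /andP[eta0 eta1] := eta01.
have hd1 : 1 <= d%:R :> R by rewrite ler1n.
have dR0 : 0 < d%:R :> R by rewrite ltr0n.
pose K0 := 2 * C / eta; rewrite -/K0.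
have hK : 2 <= K0 by rewrite /K0 ler_pdivlMr //; clear - eta1 C_ge1; lra.
have hr := rho0; move=> d3 /andP[t0 t1] Krho yC vmax tv ys.
(* The box has [i]-th coordinate between [a] and [a + t * a] up to sign, and the others at most
   [th]. Moving by [y - x] lowers the square of each other coordinate by at most [2 * th * m], in
   total by at most [a * m] as [a = 2 * d * th]; the gain in coordinate [i] has to beat this. *)
pose a := rho / (4 * d%:R); pose th := rho / (8 * d%:R ^+ 2); rewrite -/th.
pose del := t * rho / 2; pose m := `|(y - x) ord0 i|.
have a0 : 0 < a by rewrite divr_gt0 // mulr_gt0.
have th0 : 0 < th by rewrite divr_gt0 // mulr_gt0 // exprn_gt0.
have del0 : 0 < del by rewrite !divr_gt0 // mulr_gt0.
have aE : a = 2 * d%:R * th by rewrite /a /th; field; rewrite gt_eqF.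
have a2 : a + a = rho / (2 * d%:R) by rewrite /a; field; rewrite gt_eqF.
have /andP[_ br1] := small_ball_radius d_gt0 dk; rewrite -a2 in br1.
have rho4 : 3 * rho <= 4^-1 by apply: le_trans Krho; rewrite ler_wpM2r ?(ltW hr) //; clear - hK; lra.
have tha : th <= a by rewrite aE ler_peMl ?(ltW th0) //; clear - hd1; lra.
have mE : (y - x) ord0 i = if s then m else - m.
  rewrite /m; move: (tv); case: (s) => H; first by rewrite ger0_norm //; apply: le_trans H; rewrite mulr_ge0 // ltW.
  rewrite -normrN ger0_norm ?opprK //; by apply: le_trans H; rewrite mulr_ge0 // ltW.
have tm : t * rho <= m by move: tv; rewrite mE; case: (s); rewrite ?opprK.
have [M M1 M2] : exists2 M : nat, K0 * rho <= M%:R * del &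
    forall k, (k < M)%N -> k%:R * del <= K0 * rho.
  by apply: step_count => //; rewrite mulr_ge0 ?(ltW rho0) //; clear - hK; lra.
pose sg (c : R) := if s then c else - c.
pose u : 'rV[R]_d := \row_j if j == i then sg del else 0.
pose W j := if j == i then t * a else th.
pose lo j := if j == i then (if s then a else - (a + t * a))
             else if y ord0 j <= 2^-1 then 0 else - th.
pose hi j := lo j + W j.
have ta : 0 < t * a <= a by rewrite mulr_gt0 //= ler_piMl // ltW.
have /andP[ta0 ta1] := ta.
have W0 j : 0 < W j by rewrite /W; case: ifP.
have HW j : hi j - lo j = W j by rewrite /hi addrAC subrr add0r.
have uk k j : (u *+ k) ord0 j = if j == i then sg (k%:R * del) else 0.
  rewrite mulmxnE mxE -[_ *+ k]mulr_natl /sg.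
  by case: ifP => _; rewrite ?mulr0 //; case: (s); rewrite ?mulrN.
have Bi b : rV_box lo hi b -> exists2 c, a <= c <= a + t * a & b ord0 i = sg c.
  move=> bB; have := bB i; rewrite /hi /lo /W /sg !eqxx.
  clear - ta0; case: (s) => /andP[b0 b1]; first by exists (b ord0 i) => //; apply/andP; split; lra.
  by exists (- b ord0 i); rewrite ?opprK //; apply/andP; split; lra.
have Bj b : rV_box lo hi b -> forall j, j != i -> `|b ord0 j| <= th.
  move=> bB j /negbTE ji; have := bB j; rewrite /hi /lo /W !ji.
  by clear - th0; case: ifP => _ /andP[b0 b1]; rewrite ler_norml; apply/andP; split; lra.
apply: (@le_trans _ _ (eta * mu / 2 * \prod_j (hi j - lo j))).
  have c0 : 0 <= eta * mu / 2 by rewrite !mulr_ge0 // ltW.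
  rewrite ler_wpM2l //.
  under eq_bigr do rewrite HW.
  rewrite (bigD1 i) //= {1}/W eqxx (eq_bigr (fun=> th)) => [|j /negbTE ji]; last by rewrite /W ji.
  rewrite prodr_const (_ : #|_| = d.-1); last by rewrite cardC1 card_ord.
  rewrite -[in leLHS](prednK d_gt0) exprS mulrA ler_wpM2r ?exprn_ge0 ?(ltW th0) //.
  by rewrite ler_wpM2l // ltW.
apply: (@private_mass_ge _ _ nu nuE phi (dk_connection dk) x y u M lo hi).
- by rewrite !mulr_ge0 // ltW.
- by move=> j; rewrite -subr_ge0 HW ltW.
- exists i; rewrite HW /W eqxx mxE eqxx /sg.
  have -> : `|if s then del else - del| = del by case: (s); rewrite ?normrN gtr0_norm.
  by rewrite /del -mulrA ltr_pM2l //; clear - br1 a0; lra.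
- move=> b bB k kM j; rewrite !mxE uk; have := yC j => /andP[y0 y1].
  have [ji|ji] := boolP (j == i); last first.
    have := bB j; rewrite addr0 /hi /lo /W (negbTE ji).
    by clear - y0 y1 th0 tha br1 rho4 hr a0; case: ifP => [yj|/negbT]; rewrite -?ltNge => *; apply/andP; split; lra.
  rewrite (eqP ji) in y0 y1 *; have [c /andP[c0 c1] ->] := Bi b bB.
  have := M2 k kM; have : 0 <= k%:R * del by rewrite mulr_ge0 // ltW.
  set q := k%:R * del; move: ys Krho; rewrite /sg.
  by clear - y0 y1 c0 c1 a0 ta0 ta1 br1 rho4 hr hK; case: (s) => *; apply/andP; split; lra.
- move=> b bB k kM; apply: dk_mono dk d3 _ _ _.
  rewrite (bigD1 i) //= [leRHS](bigD1 i) //=.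
  have [c /andP[c0 c1] bi] := Bi b bB.
  have -> : (b + u *+ k.+1) ord0 i = sg (c + k.+1%:R * del).
    by rewrite !mxE uk eqxx bi /sg; clear - a0; case: (s); lra.
  have -> : (b + u *+ k + (y - x)) ord0 i = sg (c + k%:R * del + m).
    by rewrite mxE mE mxE uk eqxx bi /sg; clear - a0; case: (s); lra.
  have sg2 q : sg q ^+ 2 = q ^+ 2 by rewrite /sg; case: (s); rewrite ?sqrrN.
  rewrite !sg2.
  have sumle : \sum_(j < d | j != i) (b + u *+ k.+1) ord0 j ^+ 2 <=
      \sum_(j < d | j != i) (b + u *+ k + (y - x)) ord0 j ^+ 2 + d%:R * (2 * th * m).
    apply: (@le_trans _ _ (\sum_(j < d | j != i)
        ((b + u *+ k + (y - x)) ord0 j ^+ 2 + 2 * th * m))).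
      apply: ler_sum => j ji; rewrite mxE uk (negbTE ji) addr0.
      rewrite mxE [X in _ <= (X + _) ^+ 2 + _]mxE uk (negbTE ji) addr0.
      have b1 := Bj b bB j ji; have v1 := vmax j; rewrite -/m in v1.
      move: v1 b1; set p := b ord0 j; set q := (y - x) ord0 j => v1 b1.
      have : `|p * q| <= th * m by rewrite normrM ler_pM.
      by rewrite ler_norml => /andP[l1 l2]; have := sqr_ge0 q; nra.
    rewrite big_split /= lerD2l sumr_const -[leLHS]mulr_natl ler_wpM2r //.
      by rewrite mulr_ge0 ?normr_ge0 // mulr_ge0 // ltW.
    by rewrite ler_nat (leq_trans (max_card _)) // card_ord.
  have dth : d%:R * (2 * th * m) = a * m by rewrite aE; ring.
  suff : (c + k.+1%:R * del) ^+ 2 + a * m <= (c + k%:R * del + m) ^+ 2.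
    by move: sumle; rewrite dth; clear - a0; set p1 := \sum_(_ < d | _) _; set p2 := \sum_(_ < d | _) _ => *; lra.
  have q0 : 0 <= k%:R * del by rewrite mulr_ge0 // ltW.
  rewrite -natr1 mulrDl mul1r; move: q0; set q := k%:R * del => q0.
  have dm : del <= m / 2 by rewrite /del; clear - tm; lra.
  have m0 : 0 < m by clear - del0 dm; lra.
  (* The gain [(m - del) * (2 * c + 2 * q + del + m)] is at least [m / 2 * (2 * a)], because
     [del <= m / 2] and [c >= a]. *)
  have -> : (c + q + m) ^+ 2 = (c + (q + del)) ^+ 2 + (m - del) * (2 * c + 2 * q + del + m) by ring.
  rewrite lerD2l; apply: (@le_trans _ _ (m / 2 * (2 * a))); first by rewrite le_eqVlt; apply/orP; left; apply/eqP; field.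
  by apply: ler_pM; clear - a0 del0 c0 q0 dm m0; lra.
- move=> b bB; have [c /andP[c0 c1] bi] := Bi b bB.
  have : eta * mu <= phi b.
    apply: dk_ball dk _ _ => j; rewrite -a2; have [->|ji] := eqVneq j i; last first.
      by apply: le_trans (Bj b bB j ji) _; clear - tha a0; lra.
    by rewrite bi /sg; have -> : `|if s then c else - c| = c;
      [case: (s); rewrite ?normrN ger0_norm //; clear - c0 a0; lra|clear - c1 ta1; lra].
  suff : phi (b + u *+ M) <= eta * mu / 2 by clear - a0; lra.
  apply: (kernel_far_le eta01 C_ge1 dk (i := i)); rewrite mxE uk eqxx bi /sg.
  have -> : `|(if s then c else - c) + (if s then M%:R * del else - (M%:R * del))| = c + M%:R * del.
    have Md : 0 <= M%:R * del by rewrite mulr_ge0 // ltW.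
    by case: (s); rewrite -?opprD ?normrN ger0_norm //; clear - c0 a0 Md; lra.
  rewrite -/K0; clear - M1 c0 a0; lra.
Qed.

(** Either order of the pair suffices for the coupling error, so [x] and [y] are exchanged when the
    walk from [y] away from [x] would leave the cube. With [K0 = 2 * C / eta], the margin of
    [2 * K0 + 4] radii at [x] covers [K0 + 1] radii from [x] to [y], a walk of [K0 + 1] radii, and
    the box. *)
Lemma private_mass_near (R : realType) d (nu : probability 'rV[R]_d R) (eta C mu rho : R)
    (phi : 'rV[R]_d -> R) (x y : 'rV[R]_d) (t : R) :
  (forall A, nu A = lebesgue_rV R d (A `&` unit_cube R d)) ->
  (0 < d)%N -> 0 < eta <= 1 -> 1 <= C -> decaying_kernel eta C mu rho phi ->
  (2 <= d)%N -> 0 < t <= 1 ->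
  (2 * (2 * C / eta) + 4) * rho <= 4^-1 -> unit_cube R d x -> unit_cube R d y ->
  (exists i, t * rho <= `|(y - x) ord0 i|) ->
  (d = 2 -> exists j, (2 * (2 * C / eta) + 4) * rho <= x ord0 j <= 1 - (2 * (2 * C / eta) + 4) * rho) ->
  eta * mu / 2 * (t * (rho / (8 * d%:R ^+ 2)) ^+ d) <= private_mass nu phi x y \/
  eta * mu / 2 * (t * (rho / (8 * d%:R ^+ 2)) ^+ d) <= private_mass nu phi y x.
Proof.
move=> nuE d_gt0 eta01 C_ge1 dk.
have rho0 : 0 < rho := dk_rho dk.
have /andP[mu0 mu1] := dk_mu dk; have /andP[eta0 eta1] := eta01.
have hd1 : 1 <= d%:R :> R by rewrite ler1n.
have dR0 : 0 < d%:R :> R by rewrite ltr0n.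
pose K0 := 2 * C / eta; rewrite -/K0.
have hK : 2 <= K0 by rewrite /K0 ler_pdivlMr //; clear - eta1 C_ge1; lra.
have hr := rho0; move=> d2 /andP[t0 t1] Krho xC yC [i1 ti1] inter.
set B := eta * mu / 2 * _.
pose i := [arg max_(i > i1) `|(y - x) ord0 i|]%O.
have vmax j : `|(y - x) ord0 j| <= `|(y - x) ord0 i|.
  by rewrite /i; case: arg_maxP => //= k _; apply.
have ti : t * rho <= `|(y - x) ord0 i| := le_trans ti1 (vmax i1).
have vN : x - y = - (y - x) by rewrite opprB.
have BB : B <= eta * mu / 2 * (t * (rho / (2 * d%:R)) ^+ d).
  have em : 0 <= eta * mu / 2 by rewrite !mulr_ge0 // ltW.
  rewrite ler_wpM2l // ler_wpM2l ?(ltW t0) // lerXn2r ?nnegrE ?divr_ge0 ?mulr_ge0 ?exprn_ge0 ?(ltW hr) //.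
  rewrite ler_wpM2l ?(ltW hr) // lef_pV2 ?posrE ?mulr_gt0 ?exprn_gt0 //; nra.
have K0rho : 2 * rho <= K0 * rho by rewrite ler_wpM2r // ltW.
have /andP[br0 br1] := small_ball_radius d_gt0 dk.
(* Beyond [K0 + 1] radii a single step already brings [phi] down, so one translate of a box pointing
   into the cube suffices. *)
have [far|near] := leP ((K0 + 1) * rho) `|(y - x) ord0 i|.
  left; apply: le_trans BB _.
  apply: (@private_mass_chain R d nu nuE eta C mu rho phi d_gt0 eta01 C_ge1 dk x y i (fun j => y ord0 j <= 2^-1) 1) => //.
  - by rewrite t0.
  - by rewrite mul1r.
  - move=> j k c; rewrite ltnS leqn0 => /eqP -> /andP[c0 c1]; rewrite mul0r addr0.
    have := yC j => /andP[y0 y1].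
    by clear - y0 y1 c0 c1 br1 Krho K0rho hr; case: ifP => [yj|/negbT]; rewrite -?ltNge => *; apply/andP; split; lra.
have vle j : `|(y - x) ord0 j| <= (K0 + 1) * rho by apply: le_trans (vmax j) (ltW near).
have [d3|d3] := leqP 3 d.
  have K4 : (K0 + 1) * rho <= 4^-1 by clear - Krho K0rho hr; lra.
  have t01 : 0 < t <= 1 by rewrite t0.
  have vmax' j : `|(x - y) ord0 j| <= `|(x - y) ord0 i|.
    by rewrite vN ![(- (y - x)) ord0 _]mxE !normrN.
  have vi := vle i; move: vi ti; rewrite /B.
  have [v0|v0] := leP 0 ((y - x) ord0 i); [rewrite (ger0_norm v0)|rewrite (ltr0_norm v0)] => vi ti.
    have [y34|y34] := leP (y ord0 i) (3 / 4); [left|right].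
      exact: (@private_mass_mono R d nu eta C mu rho phi x y i true t nuE d_gt0 eta01 C_ge1 dk).
    apply: (@private_mass_mono R d nu eta C mu rho phi y x i false t nuE d_gt0 eta01 C_ge1 dk) => //; first by rewrite vN mxE opprK.
    by move: vi; rewrite !mxE => vi; clear - vi y34 K4; lra.
  have [y14|y14] := leP 4^-1 (y ord0 i); [left|right].
    exact: (@private_mass_mono R d nu eta C mu rho phi x y i false t nuE d_gt0 eta01 C_ge1 dk).
  apply: (@private_mass_mono R d nu eta C mu rho phi y x i true t nuE d_gt0 eta01 C_ge1 dk) => //; first by rewrite vN mxE.
  by move: vi; rewrite !mxE => vi; clear - vi y14 K4; lra.
have dE : d = 2 by apply/eqP; rewrite eqn_leq d2 andbT -ltnS.
have [j1 /andP[j10 j11]] := inter dE.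
have v0 : 0 < `|(y - x) ord0 i| by apply: lt_le_trans ti; rewrite mulr_gt0.
have [M M1 M2] : exists2 M : nat, (K0 + 1) * rho <= M%:R * `|(y - x) ord0 i| &
    forall k, (k < M)%N -> k%:R * `|(y - x) ord0 i| <= (K0 + 1) * rho.
  by apply: step_count => //; rewrite mulr_ge0 ?(ltW hr) //; clear - hK; lra.
have kv k j : (k < M)%N -> `|k%:R * (y - x) ord0 j| <= (K0 + 1) * rho.
  move=> kM; rewrite normrM normr_nat; apply: le_trans (M2 k kM).
  by rewrite ler_wpM2l.
have [j2 jP] : exists j2, forall j, j = j1 \/ j = j2.
  exact: ord2_other.
have t01 : 0 < t <= 1 by rewrite t0.
(* In the plane, coordinate [j1] has room on both sides, whereas along [j2] the walk is monotone and
   needs room only in its own direction: [z'] at most 3/4 going up, at least 1/4 going down. If [y]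
   violates this, [x] satisfies it for the opposite direction. *)
have core (z z' : 'rV[R]_d) : unit_cube R d z' -> (forall k j, (k < M)%N -> `|k%:R * (z' - z) ord0 j| <= (K0 + 1) * rho) ->
  `|(z' - z) ord0 i| = `|(y - x) ord0 i| ->
  (K0 + 3) * rho <= z' ord0 j1 <= 1 - (K0 + 3) * rho ->
  (0 <= (z' - z) ord0 j2 /\ z' ord0 j2 <= 3 / 4) \/ ((z' - z) ord0 j2 <= 0 /\ 4^-1 <= z' ord0 j2) ->
  B <= private_mass nu phi z z'.
  move=> zC zk vE /andP[z1 z2] H; apply: le_trans BB _.
  have base (o : 'I_d -> bool) : (forall k c, (k < M)%N -> 0 <= c <= rho / (2 * d%:R) ->
     0 <= z' ord0 j2 + (if o j2 then c else - c) + k%:R * (z' - z) ord0 j2 <= 1) ->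
     eta * mu / 2 * (t * (rho / (2 * d%:R)) ^+ d) <= private_mass nu phi z z'.
    move=> h2; apply: (@private_mass_chain R d nu nuE eta C mu rho phi d_gt0 eta01 C_ge1 dk z z' i o M) => //; rewrite ?vE //.
    move=> j k c kM c01; have [->|->] := jP j; last exact: h2.
    have := zk k j1 kM; move: c01 => /andP[c0 c1]; rewrite ler_norml => /andP[k1 k2].
    by clear - k1 k2 c0 c1 z1 z2 br1 hr; case: ifP => _; apply/andP; split; lra.
  have := zC j2 => /andP[y0 y1].
  case: H => -[s1 s2]; [apply: (base (fun=> true))|apply: (base (fun=> false))] => k c kM /andP[c0 c1].
    have := zk k j2 kM; have : 0 <= k%:R * (z' - z) ord0 j2 by rewrite mulr_ge0.
    by set q := k%:R * _; rewrite ler_norml => q0 /andP[k1 k2]; clear - q0 k2 c0 c1 y0 y1 s2 br1 Krho K0rho hr; apply/andP; split; lra.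
  have := zk k j2 kM; have : k%:R * (z' - z) ord0 j2 <= 0 by rewrite mulr_ge0_le0.
  by set q := k%:R * _; rewrite ler_norml => q0 /andP[k1 k2]; clear - q0 k1 c0 c1 y0 y1 s2 br1 Krho K0rho hr; apply/andP; split; lra.
have y1 : (K0 + 3) * rho <= y ord0 j1 <= 1 - (K0 + 3) * rho.
  by have := vle j1; rewrite !mxE ler_norml => /andP[k1 k2]; clear - k1 k2 j10 j11; apply/andP; split; lra.
have x1 : (K0 + 3) * rho <= x ord0 j1 <= 1 - (K0 + 3) * rho by clear - j10 j11 K0rho hr; apply/andP; split; lra.
have kv' k j : (k < M)%N -> `|k%:R * (x - y) ord0 j| <= (K0 + 1) * rho.
  by move=> kM; rewrite vN mxE mulrN normrN; exact: kv.
have vE : `|(x - y) ord0 i| = `|(y - x) ord0 i| by rewrite vN mxE normrN.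
have vj := vle j2; rewrite !mxE ler_norml in vj; have /andP[vj0 vj1] := vj.
have [v20|v20] := leP 0 ((y - x) ord0 j2); rewrite !mxE in v20.
  have [y34|y34] := leP (y ord0 j2) (3 / 4); [left|right].
    by apply: core => //; left; rewrite !mxE.
  by apply: core => //; right; rewrite !mxE; split; clear - v20 y34 vj0 vj1 Krho K0rho hr; lra.
have [y14|y14] := leP 4^-1 (y ord0 j2); [left|right].
  by apply: core => //; right; rewrite !mxE; split=> //; clear - v20 y14 vj0 vj1 Krho K0rho hr; lra.
by apply: core => //; left; rewrite !mxE; split; clear - v20 y14 vj0 vj1 Krho K0rho hr; lra.
Qed.

(** * The coupling error *)

Section double_integral.
Context dT (T : measurableType dT) (R : realType) (nu : probability T R).

Definition dint (f : T -> T -> R) : \bar R := (\int[nu]_x \int[nu]_y (f x y)%:E)%E.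

Lemma measurable_dint (f : T -> T -> R) : measurable_fun [set: T * T] (fun p => f p.1 p.2) ->
  (forall x y, 0 <= f x y) -> measurable_fun [set: T] (fun x => \int[nu]_y (f x y)%:E)%E.
Proof.
move=> mf f0; have := @measurable_fun_fubini_tonelli_F _ _ _ _ R nu (fun p : T * T => (f p.1 p.2)%:E).
by apply => [|p]; [exact/measurable_EFinP|rewrite lee_fin].
Qed.

Lemma measurable_section (f : T -> T -> R) x : measurable_fun [set: T * T] (fun p => f p.1 p.2) ->
  measurable_fun [set: T] (f x).
Proof.
move=> mf; apply: (measurableT_comp (f := fun p : T * T => f p.1 p.2) (g := fun y => (x, y))) => //.
exact: measurable_fun_pair (measurable_cst x) (@measurable_id _ _ _).
Qed.

Lemma dintD (f g : T -> T -> R) : measurable_fun [set: T * T] (fun p => f p.1 p.2) ->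
  measurable_fun [set: T * T] (fun p => g p.1 p.2) ->
  (forall x y, 0 <= f x y) -> (forall x y, 0 <= g x y) ->
  dint (fun x y => f x y + g x y) = (dint f + dint g)%E.
Proof.
move=> mf mg f0 g0; rewrite /dint -ge0_integralD //; last 4 first.
- by move=> x _; apply: integral_ge0 => y _; rewrite lee_fin.
- exact: measurable_dint.
- by move=> x _; apply: integral_ge0 => y _; rewrite lee_fin.
- exact: measurable_dint.
apply: eq_integral => x _; under eq_integral do rewrite EFinD.
rewrite ge0_integralD //; try by move=> y _; rewrite lee_fin.
- by apply/measurable_EFinP; exact: measurable_section.
- by apply/measurable_EFinP; exact: measurable_section.
Qed.

Lemma dint_swap (f : T -> T -> R) : measurable_fun [set: T * T] (fun p => f p.1 p.2) ->
  (forall x y, 0 <= f x y) -> dint f = dint (fun x y => f y x).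
Proof.
move=> mf f0; rewrite /dint.
rewrite (@fubini_tonelli _ _ _ _ _ nu nu (fun p : T * T => (f p.1 p.2)%:E)) //.
- exact/measurable_EFinP.
- by move=> p; rewrite lee_fin.
Qed.

Lemma dintZ_prod (c : R) (g h : T -> R) : 0 <= c -> (forall x, 0 <= g x) -> (forall x, 0 <= h x) ->
  measurable_fun [set: T] g -> measurable_fun [set: T] h ->
  dint (fun x y => c * (g x * h y)) = (c%:E * ((\int[nu]_x (g x)%:E) * (\int[nu]_x (h x)%:E)))%E.
Proof.
move=> c0 g0 h0 mg mh; rewrite /dint.
transitivity (\int[nu]_x ((c * g x)%:E * \int[nu]_y (h y)%:E))%E.
  apply: eq_integral => x _; under eq_integral do rewrite mulrA EFinM.
  rewrite ge0_integralZl_EFin ?mulr_ge0 //; first by move=> y _; rewrite lee_fin.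
  exact/measurable_EFinP.
rewrite ge0_integralZr //; last 3 first.
- by apply/measurable_EFinP; apply: measurable_funM.
- by move=> x _; rewrite lee_fin mulr_ge0.
- by apply: integral_ge0 => y _; rewrite lee_fin.
under eq_integral do rewrite EFinM.
rewrite ge0_integralZl_EFin ?muleA //; first by move=> y _; rewrite lee_fin.
exact/measurable_EFinP.
Qed.

End double_integral.

Section close_pairs.
Context (R : realType) (d : nat).
Local Notation E := 'rV[R]_d.
Local Notation leb := (lebesgue_rV R d).
Variable nu : probability E R.
Hypothesis nuE : forall A, nu A = leb (A `&` unit_cube R d).

Lemma dint_le_cube (f g : E -> E -> R) : measurable_fun [set: E * E] (fun p => f p.1 p.2) ->
  measurable_fun [set: E * E] (fun p => g p.1 p.2) ->
  (forall x y, 0 <= f x y) -> (forall x y, 0 <= g x y) ->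
  (forall x y, unit_cube R d x -> unit_cube R d y -> f x y <= g x y) ->
  (dint nu f <= dint nu g)%E.
Proof.
move=> mf mg f0 g0 fg; apply: (nu_ae_cube nuE); try exact: measurable_dint.
- by move=> x; apply: integral_ge0 => y _; rewrite lee_fin.
- by move=> x; apply: integral_ge0 => y _; rewrite lee_fin.
move=> x xC; apply: (nu_ae_cube nuE); try by move=> y; rewrite lee_fin.
- by apply/measurable_EFinP; exact: measurable_section.
- by apply/measurable_EFinP; exact: measurable_section.
- by move=> y yC; rewrite lee_fin fg.
Qed.

Definition near_pair (r : R) (x y : E) : R := \1_(rV_box (fun=> - r) (fun=> r)) (y - x).

Lemma near_pairC r x y : near_pair r x y = near_pair r y x.
Proof.
rewrite /near_pair !indicE; congr (nat_of_bool _)%:R.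
by apply/idP/idP => /set_mem H; apply/mem_set => i; have := H i; rewrite !mxE => /andP[? ?];
  apply/andP; split; lra.
Qed.

Lemma near_pair1 r (x y : E) : (forall i, `|(y - x) ord0 i| <= r) -> near_pair r x y = 1.
Proof.
by move=> H; rewrite /near_pair indicE mem_set // => i; have := H i; rewrite ler_norml.
Qed.

Lemma near_pairP r (x y : E) : (exists i, r <= `|(y - x) ord0 i|) \/ near_pair r x y = 1.
Proof.
have [H|/existsNP[i]] := pselect (forall i, `|(y - x) ord0 i| <= r).
  by right; exact: near_pair1.
by move=> /negP; rewrite -ltNge => H; left; exists i; exact: ltW.
Qed.

Lemma measurable_near_pair r : measurable_fun [set: E * E] (fun p => near_pair r p.1 p.2).
Proof.
have mi : measurable_fun [set: E] (\1_(rV_box (fun=> - r) (fun=> r)) : E -> R).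
  by apply: measurable_indic; exact: measurable_rV_box.
exact: (measurableT_comp mi (@measurable_rV_sub R d)).
Qed.

Lemma integral_near_pair r x : 0 <= r -> (\int[nu]_y (near_pair r x y)%:E <= ((2 * r) ^+ d)%:E)%E.
Proof.
move=> r0; pose B := rV_box (fun i => x ord0 i - r) (fun i => x ord0 i + r).
have mB : measurable B by exact: measurable_rV_box.
rewrite (eq_integral (fun y => (\1_B y)%:E)); last first.
  move=> y _; congr EFin; rewrite /near_pair !indicE; congr (nat_of_bool _)%:R.
  by apply/idP/idP => /set_mem H; apply/mem_set => i; have := H i; rewrite !mxE => /andP[? ?];
    apply/andP; split; lra.
rewrite integral_indic // setIT (le_trans (nu_box_le nuE _)) // => [i|]; first lra.
rewrite lee_fin (eq_bigr (fun=> 2 * r)); last by move=> i _; ring.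
by rewrite prodr_const card_ord.
Qed.

Lemma dint_near (l c r : R) (h : E -> R) : 0 <= l -> 0 <= c -> 0 <= r ->
  (forall x, 0 <= h x) -> measurable_fun [set: E] h ->
  (dint nu (fun x y => (l ^+ 2 * (c * (h x * near_pair r x y)))%R) <=
   (c * (l * (2 * r) ^+ d))%:E * (l%:E * \int[nu]_x (h x)%:E))%E.
Proof.
move=> l0 c0 r0 h0 mh; rewrite /dint.
have mE : measurable_fun [set: E] (fun x => (h x)%:E) by exact/measurable_EFinP.
apply: (@le_trans _ _ (\int[nu]_x ((l ^+ 2 * c * (2 * r) ^+ d)%:E * (h x)%:E))%E).
  apply: ge0_le_integral => //.
  - by move=> x _; apply: integral_ge0 => y _; rewrite lee_fin !mulr_ge0.
  - apply: (@measurable_dint _ _ _ nu (fun x y => (l ^+ 2 * (c * (h x * near_pair r x y)))%R)).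
      apply: measurable_funM => //; apply: measurable_funM => //; apply: measurable_funM.
        exact: measurableT_comp mh measurable_fst.
      exact: measurable_near_pair.
    by move=> x y; rewrite !mulr_ge0.
  - by apply: measurable_funeM.
  move=> x _; under eq_integral do rewrite !mulrA EFinM.
  rewrite ge0_integralZl_EFin ?mulr_ge0 ?exprn_ge0 //; last 2 first.
  - by move=> y _; rewrite lee_fin.
  - by apply/measurable_EFinP; exact: measurable_section (measurable_near_pair r).
  rewrite -EFinM [leRHS](_ : _ = ((l ^+ 2 * c * h x)%:E * ((2 * r) ^+ d)%:E)%E); last first.
    by rewrite -EFinM; congr EFin; ring.
  apply: lee_wpmul2l; first by rewrite lee_fin !mulr_ge0.
  exact: integral_near_pair.
rewrite ge0_integralZl_EFin //; last 2 first.
- by move=> x _; rewrite lee_fin.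
- by rewrite !mulr_ge0 ?exprn_ge0 // mulr_ge0.
rewrite muleA -EFinM le_eqVlt; apply/orP; left; apply/eqP; congr (_%:E * _)%E; ring.
Qed.

End close_pairs.

Section error_terms.
Context (R : realType) (d : nat).
Local Notation E := 'rV[R]_d.
Local Notation leb := (lebesgue_rV R d).
Variable nu : probability E R.
Hypothesis nuE : forall A, nu A = leb (A `&` unit_cube R d).

(** A sum of indicators over the corners instead of the indicator of their union: only the lower
    bound 1 on the corner boxes and an upper bound on the integral are used. *)
Definition corner_count (K : R) (x : E) : R := \sum_(o : {ffun 'I_d -> bool})
  \1_(rV_box (fun i => if o i then 0 else 1 - K) (fun i => if o i then K else 1)) x.

Lemma corner_count_ge0 K x : 0 <= corner_count K x.
Proof. by apply: sumr_ge0. Qed.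

Lemma measurable_corner_count K : measurable_fun [set: E] (corner_count K).
Proof.
by apply: measurable_sum => o; apply: measurable_indic; exact: measurable_rV_box.
Qed.

Lemma corner_countP K x : unit_cube R d x ->
  (exists i, K <= x ord0 i <= 1 - K) \/ 1 <= corner_count K x.
Proof.
move=> xC; have [|none] := pselect (exists i, K <= x ord0 i <= 1 - K); [by left|right].
pose o := [ffun i => x ord0 i <= K].
rewrite /corner_count (bigD1 o) //= indicE mem_set ?lerDl ?sumr_ge0 // => i.
have := xC i; rewrite ffunE => /andP[x0 x1].
have [xK|xK] := leP (x ord0 i) K; first by rewrite x0.
rewrite x1 andbT leNgt; apply/negP => xK'; apply: none; exists i.
by rewrite (ltW xK) /= ltW //; lra.
Qed.

Lemma integral_corner_count K : 0 <= K -> (\int[nu]_x (corner_count K x)%:E <= ((2 * K) ^+ d)%:E)%E.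
Proof.
move=> K0; under eq_integral do rewrite /corner_count -sumEFin.
rewrite ge0_integral_sum //; last first.
- by move=> o; apply/measurable_EFinP; apply: measurable_indic; exact: measurable_rV_box.
apply: (@le_trans _ _ (\sum_(o : {ffun 'I_d -> bool}) (K ^+ d)%:E)%E).
  apply: lee_sum => o _; rewrite integral_indic // ?setIT; last exact: measurable_rV_box.
  rewrite (le_trans (nu_box_le nuE _)) // => [i|]; first by case: ifP => _; lra.
  rewrite lee_fin (eq_bigr (fun=> K)); last by move=> i _; case: ifP => _; lra.
  by rewrite prodr_const card_ord.
rewrite sumEFin lee_fin sumr_const card_ffun card_bool card_ord -[leLHS]mulr_natl.
by rewrite exprMn natrX.
Qed.

Variables (w : E -> E -> R) (l : R).
Hypothesis w01 : forall x y, 0 <= w x y <= 1.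
Hypothesis mw : measurable_fun [set: E * E] (fun p => w p.1 p.2).
Hypothesis l0 : 0 < l.
Local Notation p := (piso nu w l).

(** The five terms are meant for five kinds of pairs: far apart with small codegree; [private_mass]
    of (x,y) large; that of (y,x) large; closer than [r2]; near a corner. In the terms with
    [near_pair], one point integrates to a volume and the other gives back the mean [m], or [c] for
    corners. *)
Lemma coupling_error_le (a b g r1 r2 m c : R) (h : E -> R) :
  0 <= a -> 0 <= b -> 0 <= g -> 0 <= r1 -> 0 <= r2 -> 0 <= m ->
  (forall x, 0 <= h x) -> measurable_fun [set: E] h ->
  (mean_iso nu w l <= m%:E)%E -> (\int[nu]_x (h x)%:E <= c%:E)%E ->
  (forall x y, unit_cube R d x -> unit_cube R d y ->
     p x * p y * (w x y + (expR (l * codeg nu w x y) - 1)) <=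
     a * (p x * p y) + (b * (p x * near_pair r1 x y) + (b * (p y * near_pair r1 y x) +
     (1 * (p x * near_pair r2 x y) + g * (h x * near_pair r1 x y))))) ->
  (coupling_error nu w l <= (a * m ^+ 2 + (b * (l * (2 * r1) ^+ d) * m + (b * (l * (2 * r1) ^+ d) * m +
     (1 * (l * (2 * r2) ^+ d) * m + g * (l * (2 * r1) ^+ d) * (l * c)))))%:E)%E.
Proof.
move=> a0 b0 g0 r10 r20 m0 h0 mh pm hc H; have l0' := ltW l0.
have p01 x : 0 <= p x by have /andP[] := piso01 nu w01 mw l0 x.
have mp : measurable_fun [set: E] p by exact: measurable_piso.
have c0 x y : 0 <= expR (l * codeg nu w x y) - 1.
  by rewrite subr_ge0 -expR0 ler_expR mulr_ge0 ?codeg_ge0.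
have w0 x y : 0 <= w x y by have /andP[] := w01 x y.
pose f x y := l ^+ 2 * (p x * p y * (w x y + (expR (l * codeg nu w x y) - 1))).
have mp1 : measurable_fun [set: E * E] (fun q : E * E => p q.1) by exact: measurableT_comp mp measurable_fst.
have mp2 : measurable_fun [set: E * E] (fun q : E * E => p q.2) by exact: measurableT_comp mp measurable_snd.
have mf : measurable_fun [set: E * E] (fun q => f q.1 q.2).
  apply: measurable_funM => //; apply: measurable_funM; first exact: measurable_funM.
  apply: measurable_funD => //; apply: measurable_funB => //.
  by apply: measurableT_comp => //; apply: measurable_funM => //; exact: measurable_codeg.
pose tn (c : R) (k : E -> R) r x y := l ^+ 2 * (c * (k x * near_pair r x y)).
have tn0 c' k r x y : 0 <= c' -> (forall x, 0 <= k x) -> 0 <= tn c' k r x y.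
  by move=> c'0 k0; rewrite /tn mulr_ge0 ?sqr_ge0 // mulr_ge0 // mulr_ge0.
have mtn c' k r : measurable_fun [set: E] k -> measurable_fun [set: E * E] (fun q : E * E => tn c' k r q.1 q.2).
  move=> mk; apply: measurable_funM => //; apply: measurable_funM => //; apply: measurable_funM.
    exact: measurableT_comp mk measurable_fst.
  exact: measurable_near_pair.
have mtn' c' k r : measurable_fun [set: E] k -> measurable_fun [set: E * E] (fun q : E * E => tn c' k r q.2 q.1).
  move=> mk; apply: measurable_funM => //; apply: measurable_funM => //; apply: measurable_funM.
    exact: measurableT_comp mk measurable_snd.
  under eq_fun do rewrite near_pairC; exact: measurable_near_pair.
pose T1 x y := l ^+ 2 * a * (p x * p y).
have T10 x y : 0 <= T1 x y by rewrite /T1 !mulr_ge0.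
have mT1 : measurable_fun [set: E * E] (fun q : E * E => T1 q.1 q.2).
  by apply: measurable_funM => //; apply: measurable_funM.
have -> : coupling_error nu w l = dint nu f.
  by apply: eq_integral => x _; apply: eq_integral => y _; rewrite /f mulrA.
have mp_int : (l%:E * \int[nu]_x (p x)%:E <= m%:E)%E by [].
apply: (@le_trans _ _ (dint nu (fun x y => T1 x y + (tn b p r1 x y + (tn b p r1 y x +
   (tn 1 p r2 x y + tn g h r1 x y)))))).
  apply: dint_le_cube => //.
  - apply: measurable_funD => //; apply: measurable_funD; first exact: mtn.
    apply: measurable_funD; first exact: mtn'.
    by apply: measurable_funD; apply: mtn.
  - by move=> x y; apply: mulr_ge0; [exact: sqr_ge0|apply: mulr_ge0; [exact: mulr_ge0|exact: addr_ge0]].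
  - by move=> x y; rewrite !addr_ge0 // tn0.
  - move=> x y xC yC; apply: le_trans (ler_wpM2l (sqr_ge0 l) (H x y xC yC)) _.
    by rewrite le_eqVlt; apply/orP; left; apply/eqP; rewrite /T1 /tn; ring.
have tn_le c' r : 0 <= c' -> 0 <= r -> (dint nu (tn c' p r) <= (c' * (l * (2 * r) ^+ d) * m)%:E)%E.
  move=> c'0 r0; apply: le_trans (dint_near nuE _ _ _ _ _) _ => //.
  by rewrite [leRHS]EFinM lee_wpmul2l // lee_fin !mulr_ge0 ?exprn_ge0 // mulr_ge0.
have s1 : forall x y, 0 <= tn 1 p r2 x y + tn g h r1 x y by move=> x y; rewrite addr_ge0 // tn0.
have s2 : forall x y, 0 <= tn b p r1 y x + (tn 1 p r2 x y + tn g h r1 x y).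
  by move=> x y; rewrite addr_ge0 // tn0.
have s3 : forall x y, 0 <= tn b p r1 x y + (tn b p r1 y x + (tn 1 p r2 x y + tn g h r1 x y)).
  by move=> x y; rewrite addr_ge0 // tn0.
have ms1 : measurable_fun [set: E * E] (fun q => tn 1 p r2 q.1 q.2 + tn g h r1 q.1 q.2).
  by apply: measurable_funD; apply: mtn.
have ms2 : measurable_fun [set: E * E] (fun q => tn b p r1 q.2 q.1 + (tn 1 p r2 q.1 q.2 + tn g h r1 q.1 q.2)).
  by apply: measurable_funD => //; apply: mtn'.
have ms3 : measurable_fun [set: E * E] (fun q => tn b p r1 q.1 q.2 + (tn b p r1 q.2 q.1 + (tn 1 p r2 q.1 q.2 + tn g h r1 q.1 q.2))).
  by apply: measurable_funD => //; apply: mtn.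
rewrite (dintD nu mT1 ms3) // (dintD nu (mtn _ _ _ mp) ms2) //; last by move=> x y; rewrite tn0.
rewrite (@dintD _ _ _ nu (fun x y => tn b p r1 y x) (fun x y => tn 1 p r2 x y + tn g h r1 x y)) //; last 2 first.
- exact: mtn'.
- by move=> x y; rewrite tn0.
rewrite (dintD nu (mtn _ _ _ mp) (mtn _ _ _ mh)); last 2 first.
- by move=> x y; rewrite tn0.
- by move=> x y; rewrite tn0.
rewrite !EFinD !leeD //.
- rewrite dintZ_prod ?mulr_ge0 ?sqr_ge0 //.
  rewrite (_ : (_ * _)%:E * _ = a%:E * ((l%:E * \int[nu]_x (p x)%:E) * (l%:E * \int[nu]_x (p x)%:E)))%E; last first.
    by rewrite !EFinM -!muleA; rewrite [RHS]muleC -!muleA; congr (_ * _)%E; rewrite [RHS]muleCA; congr (_ * _)%E; rewrite [RHS]muleA [RHS]muleC.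
  rewrite EFinM lee_wpmul2l ?lee_fin // expr2 EFinM.
  by apply: lee_pmul => //; rewrite mule_ge0 ?lee_fin // integral_ge0 // => x _; rewrite lee_fin.
- exact: tn_le.
- by rewrite -dint_swap ?tn_le //; [exact: mtn|move=> x y; rewrite tn0].
- exact: tn_le.
- apply: le_trans (dint_near nuE _ _ _ _ _) _ => //.
  rewrite [leRHS]EFinM lee_wpmul2l //; first by rewrite lee_fin !mulr_ge0 ?exprn_ge0 // mulr_ge0.
  by rewrite [leRHS]EFinM lee_wpmul2l // lee_fin.
Qed.

End error_terms.

Lemma expRN_poly_le (R : realType) (c : R) (N : nat) : 0 < c -> exists2 K, 0 <= K &
  forall s, 1 <= s -> expR (- (c * s)) * s ^+ N <= K / s.
Proof.
move=> c0; exists (N.+1`!%:R / c ^+ N.+1); first by rewrite divr_ge0 ?exprn_ge0 // ltW.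
move=> s s1; have s0 : 0 < s by lra.
have cs0 : 0 < c * s by rewrite mulr_gt0.
apply: (@le_trans _ _ (N.+1`!%:R / (c * s) ^+ N.+1 * s ^+ N)).
  by rewrite ler_wpM2r ?exprn_ge0 ?(ltW s0) // expRN_le_pow.
rewrite exprMn le_eqVlt; apply/orP; left; apply/eqP; rewrite [s ^+ N.+1]exprS; field.
by rewrite !gt_eqF ?exprn_gt0.
Qed.

Lemma expRB1_le (R : realType) (u : R) : 0 <= u <= 2^-1 -> expR u - 1 <= 2 * u.
Proof.
move=> /andP[u0 u1].
have : expR u * (1 - u) <= 1.
  rewrite -[leRHS](expR0 R) -(subrr u) expRD ler_wpM2l ?expR_ge0 //.
  by have := expR_ge1Dx (- u).
have := expR_gt0 u; set e := expR u => e0 H; nra.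
Qed.

Lemma le_add5 (R : realDomainType) (z a b c d e : R) :
  0 <= a -> 0 <= b -> 0 <= c -> 0 <= d -> 0 <= e ->
  z <= a \/ z <= b \/ z <= c \/ z <= d \/ z <= e -> z <= a + (b + (c + (d + e))).
Proof. lra. Qed.

Section kernel_error.
Context (R : realType) (d : nat).
Local Notation E := 'rV[R]_d.
Local Notation leb := (lebesgue_rV R d).
Variable nu : probability E R.
Hypothesis nuE : forall A, nu A = leb (A `&` unit_cube R d).
Variables (eta C mu rho : R) (phi : E -> R).
Hypothesis d_gt0 : (0 < d)%N.
Hypothesis eta01 : 0 < eta <= 1.
Hypothesis C_ge1 : 1 <= C.
Hypothesis dk : decaying_kernel eta C mu rho phi.
Variable l : R.
Hypothesis l0 : 0 < l.

Local Notation w := (kernel_pair phi).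
Local Notation p := (piso nu w l).
Local Notation D := (private_mass nu phi).
Local Notation q := (mu * min1 rho ^+ d).

Definition deg_lower : R := eta / (2 * d%:R) ^+ d.
Definition deg_upper : R := C * 2 ^+ (2 * d).+2.

Lemma deg_lower_gt0 : 0 < deg_lower.
Proof.
have /andP[eta0 _] := eta01.
by rewrite divr_gt0 // exprn_gt0 // mulr_gt0 // ltr0n.
Qed.

Lemma deg_upper_gt0 : 0 < deg_upper.
Proof. by rewrite mulr_gt0 ?exprn_gt0 // (lt_le_trans ltr01). Qed.

Let w01 x y : 0 <= w x y <= 1. Proof. exact: (kernel_pair01 dk). Qed.
Let w0 x y : 0 <= w x y. Proof. by have /andP[] := w01 x y. Qed.
Let w1 x y : w x y <= 1. Proof. by have /andP[] := w01 x y. Qed.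
Let wC x y : w x y = w y x. Proof. exact: (kernel_pairC dk). Qed.
Let mw : measurable_fun [set: E * E] (fun p => w p.1 p.2). Proof. exact: (measurable_kernel_pair dk). Qed.
Let mw1 x : measurable_fun [set: E] (w x). Proof. exact: measurable_w1 mw x. Qed.
Let p01 x : 0 <= p x <= 1. Proof. exact: piso01. Qed.
Let p0 x : 0 <= p x. Proof. by have /andP[] := p01 x. Qed.
Let mp : measurable_fun [set: E] p. Proof. exact: measurable_piso. Qed.
Let rho0 : 0 < rho := dk_rho dk.
Let mu0 : 0 < mu. Proof. by have /andP[] := dk_mu dk. Qed.
Let mu1 : mu <= 1. Proof. by have /andP[] := dk_mu dk. Qed.

Lemma deg_bounds x : unit_cube R d x -> deg_lower * q <= deg nu w x <= deg_upper * q.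
Proof. by move=> xC; rewrite (deg_ge nuE d_gt0 eta01 dk xC) (deg_le nuE C_ge1 dk xC). Qed.

Lemma mean_iso_bounds :
  ((l * expR (- (l * (deg_upper * q))))%:E <= mean_iso nu w l <= (l * expR (- (l * (deg_lower * q))))%:E)%E.
Proof.
have cst_int (c : R) : (c%:E = \int[nu]_x (cst c%:E x))%E.
  by rewrite integral_cst //; rewrite -[LHS]mule1; congr (_ * _)%E; exact/esym/probability_setT.
have mpE : measurable_fun [set: E] (fun x => (p x)%:E) by exact/measurable_EFinP.
rewrite /mean_iso !EFinM; apply/andP; split; rewrite lee_wpmul2l ?lee_fin ?(ltW l0) //.
  rewrite cst_int; apply: (nu_ae_cube nuE) => //; try by move=> x; rewrite lee_fin ?expR_ge0.
  by move=> x xC; rewrite lee_fin ler_expR lerN2 ler_wpM2l ?(ltW l0) //; have /andP[] := deg_bounds xC.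
rewrite cst_int; apply: (nu_ae_cube nuE) => //; try by move=> x; rewrite lee_fin ?expR_ge0.
by move=> x xC; rewrite lee_fin ler_expR lerN2 ler_wpM2l ?(ltW l0) //; have /andP[] := deg_bounds xC.
Qed.

Let intg (h : E -> R) : (forall x, 0 <= h x <= 1) -> measurable_fun [set: E] h ->
  nu.-integrable [set: E] (EFin \o h).
Proof. exact: integrable01. Qed.

Let ww01 x y z : 0 <= w x z * w y z <= 1.
Proof. by rewrite mulr_ge0 //= mulr_ile1. Qed.

Lemma private_massE x y : D x y = deg nu w y - codeg nu w x y.
Proof.
rewrite /codeg /deg /private_mass -RintegralB //; last 2 first.
- exact: intg.
- by apply: intg => //; exact: measurable_funM.
by congr fine; apply: eq_integral => z _; congr EFin; ring.
Qed.

Lemma codegC x y : codeg nu w x y = codeg nu w y x.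
Proof. by congr fine; apply: eq_integral => z _; rewrite mulrC. Qed.

Lemma codeg_le_deg x y : codeg nu w x y <= mu * deg nu w y.
Proof.
rewrite /codeg /deg -RintegralZl //; last by apply: intg.
apply: le_Rintegral => //.
- by apply: intg => //; exact: measurable_funM.
- apply: intg; last by apply: measurable_funM.
  by move=> z; rewrite mulr_ge0 ?(ltW mu0) //= mulr_ile1 // ltW.
- by move=> z _; rewrite ler_wpM2r // (dk_le dk).
Qed.

Lemma coupling_integrand_le x y : p x * p y * (w x y + (expR (l * codeg nu w x y) - 1)) <=
  p x * expR (- (l * D x y)).
Proof.
have -> : expR (- (l * D x y)) = p y * expR (l * codeg nu w x y).
  by rewrite private_massE /piso -expRD; congr expR; ring.
by rewrite -mulrA ler_wpM2l // ler_wpM2l //; have := w1 x y; lra.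
Qed.

Lemma coupling_integrand_leC x y : p x * p y * (w x y + (expR (l * codeg nu w x y) - 1)) <=
  p y * expR (- (l * D y x)).
Proof.
have -> : expR (- (l * D y x)) = p x * expR (l * codeg nu w x y).
  by rewrite private_massE codegC /piso -expRD; congr expR; ring.
by rewrite (mulrC (p x)) -mulrA ler_wpM2l // ler_wpM2l //; have := w1 x y; lra.
Qed.

Lemma private_mass_half x y : mu <= 2^-1 -> deg nu w y / 2 <= D x y.
Proof.
move=> mu2; rewrite private_massE; have := codeg_le_deg x y.
have : 0 <= deg nu w y by apply: Rintegral_ge0 => z _.
nra.
Qed.

(** If [x] and [y] are [2 * a] radii apart along a coordinate, every [z] is [a] radii away from one
    of them, and the decay bound applies to the corresponding factor. *)
Lemma codeg_far (x y : E) i (a : R) : 1 <= a -> 2 * a * rho <= `|(y - x) ord0 i| ->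
  codeg nu w x y <= C * mu / a ^+ d.+1 * (deg nu w x + deg nu w y).
Proof.
move=> a1 far; set c := C * mu / _.
have c0 : 0 <= c by rewrite divr_ge0 ?exprn_ge0 ?mulr_ge0 ?(ltW mu0) //; have := C_ge1; lra.
have dec (z z' : E) : a * rho <= `|(z' - z) ord0 i| -> w z z' <= c by rewrite /kernel_pair => H; exact: (dk_decay dk a1 H).
rewrite /deg -RintegralD //; last 2 first.
- exact: intg.
- exact: intg.
have sI : nu.-integrable [set: E] (EFin \o (fun z => w x z + w y z)).
  rewrite (_ : _ \o _ = fun z => ((w x z)%:E + (w y z)%:E)%E); last by apply/funext.
  by apply: integrableD => //; apply: intg.
rewrite -RintegralZl //; apply: le_Rintegral => //.
- by apply: intg => //; exact: measurable_funM.
- rewrite (_ : _ \o _ = fun z => (c%:E * (w x z + w y z)%:E)%E); last by apply/funext.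
  exact: integrableZl.
- move=> z _; have [xz|xz] := leP (a * rho) `|(z - x) ord0 i|.
    rewrite (le_trans (ler_wpM2r (w0 y z) (dec _ _ xz))) // ler_wpM2l // lerDr //.
  have yz : a * rho <= `|(z - y) ord0 i|.
    have := ler_normB ((z - x) ord0 i) ((z - y) ord0 i).
    by move: far xz; rewrite !mxE (_ : z ord0 i - x ord0 i - (z ord0 i - y ord0 i) = y ord0 i - x ord0 i); [lra|ring].
  rewrite (le_trans (ler_wpM2l (w0 x z) (dec _ _ yz))) // mulrC ler_wpM2l // lerDl //.
Qed.

Let p_le x : unit_cube R d x -> p x <= expR (- (deg_lower * (l * q))).
Proof.
move=> xC; rewrite ler_expR lerN2 mulrCA ler_wpM2l ?(ltW l0) //.
by have /andP[] := deg_bounds xC.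
Qed.

Let pp0 x y : 0 <= p x * p y. Proof. exact: mulr_ge0. Qed.

Let expR_codeg_le x y u : l * codeg nu w x y <= u -> u <= 2^-1 ->
  expR (l * codeg nu w x y) - 1 <= 2 * u.
Proof.
move=> cu u2; apply: le_trans (expRB1_le _) _; last by rewrite ler_wpM2l.
by rewrite mulr_ge0 ?(ltW l0) ?codeg_ge0 //= (le_trans cu).
Qed.

(** When [mu] is tiny, [codeg_le_deg] already makes the exponent small for all pairs; the four
    distance-dependent terms of [coupling_error_le] are switched off. *)
Lemma coupling_error_flat (m a u : R) : 0 <= m -> 0 <= u -> (mean_iso nu w l <= m%:E)%E ->
  mu <= a -> mu * (deg_upper * (l * q)) <= u -> u <= 2^-1 ->
  (coupling_error nu w l <= ((a + 2 * u) * m ^+ 2)%:E)%E.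
Proof.
move=> m0 u0 pm mua Su u2.
have a0 : 0 <= a by apply: le_trans mua; exact: ltW.
have int0 : (\int[nu]_x (0 : R)%:E <= (0 : R)%:E)%E by rewrite integral0.
have := @coupling_error_le R d nu nuE w l w01 mw l0 (a + 2 * u) 0 0 0 0 m 0 (fun=> 0)
  _ _ _ _ _ m0 _ _ pm int0.
rewrite !(mulr0, mul0r, addr0, expr0n) gtn_eqF // !(mulr0, mul0r, addr0) => H.
apply: H => //; first by rewrite addr_ge0 // mulr_ge0.
move=> x y xC yC; rewrite !(mul0r, add0r).
have n2 : 0 <= 1 * (p x * near_pair 0 x y) by rewrite mul1r mulr_ge0.
rewrite addr0; apply: (@le_trans _ _ ((a + 2 * u) * (p x * p y))); last by rewrite lerDl.
rewrite mulrC ler_wpM2r // lerD //; first exact: le_trans (dk_le dk _) mua.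
apply: expR_codeg_le u2; apply: le_trans Su; rewrite mulrCA [leRHS]mulrCA.
rewrite [X in _ <= X](_ : _ = l * (mu * (deg_upper * q))); last ring.
rewrite ler_wpM2l ?(ltW l0) // (le_trans (codeg_le_deg x y)) // ler_wpM2l ?(ltW mu0) //.
by have /andP[] := deg_bounds yC.
Qed.

(** Pairs [2 * t * rho] apart along some coordinate are handled by [codeg_far], and the last
    hypothesis offers four ways out for the others. The constants stay free, to be chosen as
    functions of [s] in [coupling_error_small]. *)
Lemma coupling_error_local (m a t u b g r2 c : R) (h : E -> R) :
  0 <= m -> (mean_iso nu w l <= m%:E)%E ->
  1 <= t -> C / t ^+ d.+1 <= a -> 2 * (C / t ^+ d.+1) * (deg_upper * (l * q)) <= u -> 0 <= u <= 2^-1 ->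
  0 <= b -> 0 <= g -> 0 <= r2 ->
  (forall x, 0 <= h x) -> measurable_fun [set: E] h -> (\int[nu]_x (h x)%:E <= c%:E)%E ->
  (forall x y, unit_cube R d x -> unit_cube R d y ->
    near_pair r2 x y = 1 \/ expR (- (l * D x y)) <= b \/ expR (- (l * D y x)) <= b \/
    (1 <= h x /\ expR (- (deg_lower * (l * q))) <= g)) ->
  (coupling_error nu w l <= ((a + 2 * u) * m ^+ 2 +
    (b * (l * (2 * (2 * t * rho)) ^+ d) * m + (b * (l * (2 * (2 * t * rho)) ^+ d) * m +
     (1 * (l * (2 * r2) ^+ d) * m + g * (l * (2 * (2 * t * rho)) ^+ d) * (l * c)))))%:E)%E.
Proof.
move=> m0 pm t1 Ca Su /andP[u0 u2] b0 g0 r20 h0 mh hc sep.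
have t0 : 0 < t by lra.
have C0 : 0 <= C by have := C_ge1; lra.
have a0 : 0 <= a by apply: le_trans Ca; rewrite divr_ge0 ?exprn_ge0 // ltW.
apply: (@coupling_error_le R d nu nuE w l w01 mw l0 (a + 2 * u) b g (2 * t * rho) r2 m c h) => //.
- by rewrite addr_ge0 // mulr_ge0.
- by rewrite mulr_ge0 ?(ltW rho0) // mulr_ge0 // ltW.
move=> x y xC yC; set r1 := 2 * t * rho.
have P0 : 0 <= p x * p y := pp0 x y.
have n1 : 0 <= b * (p x * near_pair r1 x y) by rewrite mulr_ge0 // mulr_ge0.
have n1' : 0 <= b * (p y * near_pair r1 y x) by rewrite mulr_ge0 // mulr_ge0.
have n2 : 0 <= 1 * (p x * near_pair r2 x y) by rewrite mul1r mulr_ge0.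
have n3 : 0 <= g * (h x * near_pair r1 x y) by rewrite mulr_ge0 // mulr_ge0.
have n0 : 0 <= (a + 2 * u) * (p x * p y) by rewrite mulr_ge0 // addr_ge0 // mulr_ge0.
have [[i far]|near] := near_pairP r1 x y.
  apply: le_add5 => //; left.
  rewrite mulrC ler_wpM2r // lerD //.
    have tr : t * rho <= `|(y - x) ord0 i|.
      by apply: le_trans far; rewrite /r1 -mulrA ler_peMl ?ler1n // mulr_ge0 // ltW.
    apply: le_trans (dk_decay dk t1 tr) _; apply: le_trans Ca.
    by rewrite ler_wpM2r ?invr_ge0 ?exprn_ge0 ?(ltW t0) // ler_piMr.
  apply: expR_codeg_le u2; apply: le_trans Su.
  apply: (@le_trans _ _ (l * (C * mu / t ^+ d.+1 * (deg_upper * q + deg_upper * q)))).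
    rewrite ler_wpM2l ?(ltW l0) // (le_trans (codeg_far t1 far)) // ler_wpM2l //.
      by rewrite divr_ge0 ?exprn_ge0 ?(ltW t0) // mulr_ge0 ?(ltW mu0).
    by rewrite lerD //; [have /andP[] := deg_bounds xC|have /andP[] := deg_bounds yC].
  have X0 : 0 <= 2 * (C / t ^+ d.+1) * (deg_upper * (l * q)).
    have q0 : 0 <= q by rewrite mulr_ge0 ?(ltW mu0) // exprn_ge0 // /min1 le_min ler01 ltW.
    rewrite mulr_ge0 //; last by rewrite mulr_ge0 ?(ltW deg_upper_gt0) // mulr_ge0 // ltW.
    by rewrite mulr_ge0 // divr_ge0 // exprn_ge0 // ltW.
  rewrite [leLHS](_ : _ = mu * (2 * (C / t ^+ d.+1) * (deg_upper * (l * q)))); last ring.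
  by rewrite ler_piMl.
have near' : near_pair r1 y x = 1 by rewrite near_pairC.
have [near2|[bx|[by_|[h1 gx]]]] := sep x y xC yC.
- apply: le_add5 => //; right; right; right; left.
  apply: le_trans (coupling_integrand_le x y) _; rewrite near2 mulr1 mul1r ler_piMr // expR_le1 oppr_le0.
    rewrite mulr_ge0 ?(ltW l0) //; apply: Rintegral_ge0 => z _; rewrite mulr_ge0 // subr_ge0 //.
- apply: le_add5 => //; right; left.
  by apply: le_trans (coupling_integrand_le x y) _; rewrite near mulr1 mulrC ler_wpM2r.
- apply: le_add5 => //; right; right; left.
  by apply: le_trans (coupling_integrand_leC x y) _; rewrite near' mulr1 mulrC ler_wpM2r.
- apply: le_add5 => //; right; right; right; right.
  apply: le_trans (coupling_integrand_le x y) _; rewrite near mulr1.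
    apply: (@le_trans _ _ (p x)).
      rewrite ler_piMr // expR_le1 oppr_le0.
      rewrite mulr_ge0 ?(ltW l0) //; apply: Rintegral_ge0 => z _; rewrite mulr_ge0 // subr_ge0 //.
    by apply: le_trans (p_le xC) _; apply: le_trans gx _; rewrite ler_peMr.
Qed.

End kernel_error.

Section vanishing_error.
Context (R : realType) (d : nat).
Local Notation E := 'rV[R]_d.
Local Notation leb := (lebesgue_rV R d).
Variable nu : probability E R.
Hypothesis nuE : forall A, nu A = leb (A `&` unit_cube R d).
Variables (eta C alpha : R).
Hypothesis d_gt1 : (2 <= d)%N.
Hypothesis eta01 : 0 < eta <= 1.
Hypothesis C_ge1 : 1 <= C.
Hypothesis alpha_gt0 : 0 < alpha.

Let d_gt0 : (0 < d)%N. Proof. exact: ltnW. Qed.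

(** By [mean_iso_bounds] the mean lies between [l * expR (- X)] for two multiples [X] of [l * q],
    with [l = expR (s ^+ 4)]. If [l * q] were much larger than [s ^+ 4] the mean would fall below
    [alpha / 2]; if much smaller, it would exceed [2 * alpha]. *)
Lemma expected_degree_bounds (s mu rho : R) (phi : E -> R) : 1 <= s -> 2 / alpha <= s -> 4 * alpha <= s ->
  decaying_kernel eta C mu rho phi ->
  ((alpha / 2)%:E <= mean_iso nu (kernel_pair phi) (expR (s ^+ 4)) <= (2 * alpha)%:E)%E ->
  deg_lower d eta * (expR (s ^+ 4) * (mu * min1 rho ^+ d)) <= 2 * s ^+ 4 /\
  s ^+ 4 <= 2 * deg_upper d C * (expR (s ^+ 4) * (mu * min1 rho ^+ d)).
Proof.
move=> s1 sa1 sa2 dk /andP[m1 m2]; set l := expR _; set q := mu * _.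
have s4 : s <= s ^+ 4 by rewrite ler_eXnr.
have /andP[lo hi] := mean_iso_bounds nuE d_gt0 eta01 C_ge1 dk (expR_gt0 (s ^+ 4)).
have := le_trans m1 hi; have := le_trans lo m2; rewrite !lee_fin -!expRD -/l -/q.
move: (alpha_gt0) => a0 h1 h2.
move: h1 h2; set c1 := deg_lower _ _; set C1 := deg_upper _ _ => h1 h2; split; rewrite leNgt; apply/negP => big.
  have : expR (s ^+ 4 - l * (c1 * q)) < expR (- s ^+ 4) by rewrite ltr_expR; lra.
  have u0 : 0 < s ^+ 4 by lra.
  have := expRN_le_pow 0 u0; rewrite expr1 factS fact0 muln1.
  have : 1%:R / s ^+ 4 <= alpha / 2.
    by rewrite ler_pdivrMr // mulrC -ler_pdivrMr ?divr_gt0 // invf_div mul1r (le_trans sa1).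
  lra.
have : 1 + s ^+ 4 / 2 < expR (s ^+ 4 - l * (C1 * q)).
  by apply: le_lt_trans (expR_ge1Dx _) _; rewrite ltr_expR; lra.
lra.
Qed.

End vanishing_error.

(* [s] is the fourth root of log lambda; pairs at distance below [s^-3 rho] are
   controlled by volume, and beyond that [lambda * private_mass] is at least a
   constant times [s]. *)
Lemma coupling_error_small (R : realType) d (nu : probability 'rV[R]_d R) (eta C alpha : R) :
  (forall A, nu A = lebesgue_rV R d (A `&` unit_cube R d)) ->
  (2 <= d)%N -> 0 < eta <= 1 -> 1 <= C -> 0 < alpha -> exists Cst s0, forall s, s0 <= s ->
  forall mu rho (phi : 'rV[R]_d -> R), decaying_kernel eta C mu rho phi ->
  ((alpha / 2)%:E <= mean_iso nu (kernel_pair phi) (expR (s ^+ 4)) <= (2 * alpha)%:E)%E ->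
  (coupling_error nu (kernel_pair phi) (expR (s ^+ 4)) <= (Cst / s)%:E)%E.
Proof.
move=> nuE d_gt1 eta01 C_ge1 a0; have C1' := C_ge1; have d_gt0 : (0 < d)%N by exact: ltnW.
have [c1 c1E] : exists c, deg_lower d eta = c by exists (deg_lower d eta).
have [C1 C1E] : exists c, deg_upper d C = c by exists (deg_upper d C).
have hc1 : 0 < c1 by rewrite -c1E; exact: deg_lower_gt0.
have hC1 : 0 < C1 by rewrite -C1E; exact: deg_upper_gt0.
have /andP[eta0 eta1] := eta01.
(* [Kap] bounds the mean degree in units of [s ^+ 4]; [K] is the margin of [private_mass_near], and
   [rho < e0] gives the [K * rho <= 1 / 4] required there. *)
pose Kap := 2 * C1 / c1; pose K := 2 * (2 * C / eta) + 4; pose e0 := (4 * K)^-1.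
have Kap0 : 0 < Kap by rewrite divr_gt0 // mulr_gt0.
have C0' : 0 <= C by lra.
have CK0 : 0 <= 2 * C * Kap := mulr_ge0 (mulr_ge0 (ler0n R 2) C0') (ltW Kap0).
have K4 : 4 <= K.
  by rewrite /K lerDr !mulr_ge0 ?invr_ge0 ?(ltW eta0) //; lra.
have K0 : 0 < K by lra.
have e00 : 0 < e0 by rewrite invr_gt0 mulr_gt0.
have dR : 0 < 8 * d%:R ^+ 2 :> R by rewrite mulr_gt0 // exprn_gt0 // ltr0n.
(* [c3 * t * (mu * rho ^+ d)] is the private mass given by [private_mass_near]; [c5] is a rate for
   which either that bound or half the minimal degree yields [expR (- (c5 * s))]. *)
pose c3 := eta / 2 / (8 * d%:R ^+ 2) ^+ d.
have c30 : 0 < c3 by rewrite !divr_gt0 // exprn_gt0.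
pose c5 := Num.min (c1 / (4 * C1)) (c3 / (2 * C1)).
have C41 : 0 < 4 * C1 by rewrite mulr_gt0.
have C21 : 0 < 2 * C1 by rewrite mulr_gt0.
have c50 : 0 < c5 by rewrite /c5 lt_min (divr_gt0 hc1 C41) (divr_gt0 c30 C21).
have c51 : c5 * (4 * C1) <= c1 by rewrite -(ler_pdivlMr _ _ C41) /c5 ge_min lexx.
have c52 : c5 * (2 * C1) <= c3 by rewrite -(ler_pdivlMr _ _ C21) /c5 ge_min lexx orbT.
(* Powers of [s] to be absorbed: with [L = s ^+ 4], a box of side of order [L * rho] carries a mean
   number of points of order at most [L ^+ (d + 3)], and the corners contribute another [L ^+ 3]. *)
have [K1 K10 HK1] := expRN_poly_le (4 * d + 12) c50.
have [K2 K20 HK2] := expRN_poly_le (4 * d + 24) c50.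
pose G := 2 / c1 * 4 ^+ d; pose G2 := 2 ^+ d * (4 / c1); pose G3 := (2 * K) ^+ d * (2 / c1).
have ci0 : 0 < 2 / c1 by rewrite divr_gt0.
have ci40 : 0 < 4 / c1 by rewrite divr_gt0.
have G0 : 0 <= G by rewrite mulr_ge0 ?exprn_ge0 // ltW.
have G20 : 0 <= G2 by rewrite mulr_ge0 ?exprn_ge0 // ltW.
have G30 : 0 <= G3 by rewrite mulr_ge0 ?exprn_ge0 ?(ltW ci0) // mulr_ge0 // ltW.
pose m := 2 * alpha.
have m0 : 0 < m by rewrite mulr_gt0.
pose CA := (1 + 2 * Kap) * m ^+ 2.
pose CB := (C + 2 * (2 * C * Kap)) * m ^+ 2 + (G * K1 * m + (G * K1 * m + (G2 * m + G * G3 * K2))).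
have CA0 : 0 <= CA by rewrite mulr_ge0 ?sqr_ge0 // addr_ge0 // mulr_ge0 // ltW.
have CB0 : 0 <= CB.
  have CKap : 0 <= C * Kap by rewrite mulr_ge0 ?(ltW Kap0) //; lra.
  have CC : 0 <= C + 2 * (2 * C * Kap) by lra.
  have GK := mulr_ge0 (mulr_ge0 G0 K10) (ltW m0).
  apply: addr_ge0; first exact: mulr_ge0 CC (sqr_ge0 _).
  do 2 apply: addr_ge0 => //; apply: addr_ge0; first exact: mulr_ge0 G20 (ltW m0).
  exact: mulr_ge0 (mulr_ge0 G0 G30) K20.
exists (CA + CB), (1 + 2 / alpha + 4 * alpha + 4 * C * Kap + 2 * Kap + 48 / c1 / e0 ^+ d).
move=> s hs mu rho phi dk hm.
have pos1 : 0 < 2 / alpha by rewrite divr_gt0.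
have pos2 : 0 < 4 * C * Kap by rewrite mulr_gt0 //; clear - C1'; lra.
have p48 : 0 < 48 :> R by rewrite ltr0n.
have pos3 : 0 < 48 / c1 / e0 ^+ d := divr_gt0 (divr_gt0 p48 hc1) (exprn_gt0 d e00).
have s1 : 1 <= s by clear - hs pos1 pos2 pos3 a0 Kap0; lra.
have s0 : 0 < s by clear - s1; lra.
have [S1 S2] : c1 * (expR (s ^+ 4) * (mu * min1 rho ^+ d)) <= 2 * s ^+ 4 /\
  s ^+ 4 <= 2 * C1 * (expR (s ^+ 4) * (mu * min1 rho ^+ d)).
  by rewrite -c1E -C1E; apply: (@expected_degree_bounds R d nu nuE eta C alpha d_gt1 eta01 C_ge1 a0 s mu rho phi) => //; clear - hs pos1 pos2 pos3 a0 Kap0 s1; lra.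
have /andP[_ hm2] := hm; rewrite -/m in hm2.
set l := expR (s ^+ 4) in hm2 S1 S2 *; set q := mu * min1 rho ^+ d in S1 S2 *.
have l0 : 0 < l by exact: expR_gt0.
have /andP[mu0 mu1] := dk_mu dk; have rho0 := dk_rho dk.
have min0 : 0 < min1 rho by rewrite /min1 lt_min ltr01.
have q0 : 0 <= q by apply: mulr_ge0 (ltW mu0) (exprn_ge0 d (ltW min0)).
pose L := s ^+ 4; rewrite -/L in S1 S2.
have L1 : 1 <= L by rewrite /L exprn_ege1.
have L0 : 0 < L by clear - L1; lra.
have sL : s <= L by rewrite /L ler_eXnr.
have iL : L^-1 <= s^-1 by rewrite lef_pV2.
have CS : C1 * (l * q) <= Kap * L.
  rewrite /Kap [leRHS](_ : _ = C1 / c1 * (2 * L)); last ring.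
  apply: (@le_trans _ _ (C1 / c1 * (c1 * (l * q)))).
    rewrite [leRHS](_ : _ = C1 * (l * q)); first exact: lexx.
    by field; rewrite gt_eqF.
  by rewrite ler_wpM2l // divr_ge0 // ltW.
have isP : 0 < s^-1 by rewrite invr_gt0.
(* For [mu] at most [L ^- 2] the exponent is at most [mu * (Kap * L) <= Kap / L] for all pairs.
   Otherwise the lower bound on [mu] turns the bound on [mu * min1 rho ^+ d] into one on the volume
   alone. *)
have [flat|steep] := leP mu (L ^+ 2)^-1.
  apply: (@le_trans _ _ (((1 / s) + 2 * (Kap / s)) * m ^+ 2)%:E); last first.
    rewrite lee_fin [leLHS](_ : _ = CA / s); last by rewrite /CA; ring.
    by rewrite ler_wpM2r ?(ltW isP) // lerDl.
  apply: (coupling_error_flat nuE _ eta01 C_ge1 dk l0 (ltW m0)) => //.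
  - by rewrite mulr_ge0 // ltW.
  - rewrite mul1r (le_trans flat) // (le_trans _ iL) // lef_pV2 ?posrE ?exprn_gt0 //.
    by rewrite ler_eXnr.
  - rewrite C1E -/q; apply: (@le_trans _ _ ((L ^+ 2)^-1 * (Kap * L))).
      apply: ler_pM => //; [exact: ltW|exact: mulr_ge0 (ltW hC1) (mulr_ge0 (ltW l0) q0)].
    rewrite [leLHS](_ : _ = Kap * L^-1); last by field; rewrite gt_eqF.
    by rewrite ler_wpM2l // ltW.
  - by rewrite ler_pdivrMr //; clear - hs pos1 pos2 pos3 a0 Kap0; lra.
have lmin : l * min1 rho ^+ d <= 2 / c1 * L ^+ 3.
  have H1 : c1 * (l * min1 rho ^+ d) * mu <= 2 * L by move: S1; rewrite /q; clear - hc1; lra.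
  have H2 : c1 * (l * min1 rho ^+ d) * (L ^+ 2)^-1 <= 2 * L.
    apply: le_trans H1; rewrite ler_wpM2l ?(ltW steep) // !mulr_ge0 ?exprn_ge0 // ltW //.
  move: H2; rewrite ler_pdivrMr ?exprn_gt0 // mulrC -ler_pdivlMr // => /le_trans; apply.
  by rewrite le_eqVlt; apply/orP; left; apply/eqP; ring.
(* As [l = expR L] beats the polynomial in [lmin], the range of the kernel is small and [min1 rho]
   is [rho] itself. The 48 is twice the factorial of 4, from the fourth-order bound on the
   exponential. *)
have small : min1 rho < e0.
  rewrite ltNge; apply/negP => big.
  have H1 : e0 ^+ d <= min1 rho ^+ d by rewrite lerXn2r ?nnegrE // ltW.
  have H2 : min1 rho ^+ d <= 48 / c1 / L.
    have := expRN_le_pow 3 L0; rewrite -ler_pdivlMl // in lmin.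
    move=> e4; apply: le_trans lmin _; rewrite -expRN.
    apply: (@le_trans _ _ (4`!%:R / L ^+ 4 * (2 / c1 * L ^+ 3))).
      by rewrite ler_wpM2r // mulr_ge0 ?exprn_ge0 // ltW.
    rewrite (_ : 4`!%:R = 24 :> R) // le_eqVlt; apply/orP; left; apply/eqP; field.
    by rewrite !gt_eqF.
  have := le_trans H1 H2; apply/negP; rewrite -ltNge.
  apply: (@le_lt_trans _ _ (48 / c1 / s)).
    by rewrite ler_wpM2l // divr_ge0 // ltW.
  rewrite ltr_pdivrMr // -ltr_pdivrMl ?exprn_gt0 //; clear - hs pos1 pos2 a0 Kap0; lra.
have e01 : e0 < 1 by rewrite invf_lt1 ?mulr_gt0 //; clear - K4; lra.
have minE : min1 rho = rho.
  rewrite /min1 min_r // leNgt.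
  by apply/negP => /ltW r1; move: small; rewrite /min1 min_l // ltNge (ltW e01).
rewrite minE in lmin small min0; rewrite /q minE in S1 S2 CS.
have Krho : K * rho <= 4^-1.
  have -> : 4^-1 = K * e0 :> R by rewrite /e0; field; rewrite gt_eqF.
  by rewrite ler_wpM2l ?(ltW K0) // ltW.
have c5S : c5 * s <= c1 * (l * (mu * rho ^+ d)) / 2.
  apply: (@le_trans _ _ (c5 * L)); first by rewrite ler_wpM2l // ltW.
  apply: (@le_trans _ _ (c5 * (2 * C1 * (l * (mu * rho ^+ d))))); first by rewrite ler_wpM2l // ltW.
  have q1 : 0 <= l * (mu * rho ^+ d) by rewrite !mulr_ge0 ?exprn_ge0 // ltW.
  have := ler_wpM2r q1 c51; clear - q1; lra.
(* With this [t], [l] times the private mass is at least of order [t * L = s], while close pairs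
   cost a volume of order at most [t ^+ d * L <= t ^+ 2 * L = s ^- 2], by [d >= 2]. *)
pose t := (s ^+ 3)^-1.
have t0 : 0 < t by rewrite invr_gt0 exprn_gt0.
have t1 : t <= 1 by rewrite invf_le1 ?exprn_gt0 // exprn_ege1.
(* If [mu <= 1 / 2] the codegree is at most half the degree at any distance, and no close pairs need
   to be set aside; if [mu > 1 / 2], the mean number of points within range is at most of order
   [L]. *)
pose r2 := if mu <= 2^-1 then 0 else t * rho.
have r20 : 0 <= r2 by rewrite /r2; case: ifP => _ //; rewrite mulr_ge0 // ltW.
have Lr2 : l * (2 * r2) ^+ d <= G2 / s.
  rewrite /r2; have [mu2|mu2] := leP mu 2^-1.
    by rewrite mulr0 expr0n gtn_eqF // mulr0 divr_ge0 // ltW.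
  have lr : l * rho ^+ d <= 4 / c1 * L.
    rewrite [leRHS]mulrAC ler_pdivlMr //.
    have : c1 * (l * rho ^+ d) * 2^-1 <= c1 * (l * rho ^+ d) * mu.
      by rewrite ler_wpM2l ?(ltW mu2) // !mulr_ge0 ?exprn_ge0 // ltW.
    by move: S1; clear - hc1; lra.
  rewrite !exprMn [leLHS](_ : _ = 2 ^+ d * t ^+ d * (l * rho ^+ d)); last ring.
  apply: (@le_trans _ _ (2 ^+ d * t ^+ d * (4 / c1 * L))).
    by rewrite ler_wpM2l // mulr_ge0 ?exprn_ge0 // ltW.
  rewrite [leLHS](_ : _ = G2 * (t ^+ d * L)); last by rewrite /G2; ring.
  rewrite ler_wpM2l //; apply: (@le_trans _ _ (t ^+ 2 * L)).
    by rewrite ler_wpM2r ?(ltW L0) // ler_wiXn2l // ltW.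
  rewrite (_ : t ^+ 2 * L = (s ^+ 2)^-1); last by rewrite /t /L; field; rewrite gt_eqF.
  by rewrite lef_pV2 ?posrE ?exprn_gt0 // ler_eXnr.
have Lr1 : l * (2 * (2 * L * rho)) ^+ d <= G * s ^+ (4 * d + 12).
  rewrite [leLHS](_ : _ = 4 ^+ d * L ^+ d * (l * rho ^+ d)); last first.
    rewrite (_ : 2 * (2 * L * rho) = 4 * L * rho); last ring.
    by rewrite (exprMn d (4 * L) rho) (exprMn d 4 L) mulrCA.
  apply: (@le_trans _ _ (4 ^+ d * L ^+ d * (2 / c1 * L ^+ 3))).
    by rewrite ler_wpM2l // mulr_ge0 ?exprn_ge0 // ltW.
  rewrite exprD exprM -/L (exprM s 4 3) -/L /G le_eqVlt; apply/orP; left; apply/eqP; ring.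
have Lc : l * (2 * (K * rho)) ^+ d <= G3 * s ^+ 12.
  rewrite mulrA exprMn [leLHS](_ : _ = (2 * K) ^+ d * (l * rho ^+ d)); last ring.
  rewrite (exprM s 4 3) -/L /G3 -mulrA ler_wpM2l // exprn_ge0 // mulr_ge0 // ltW //.
pose b := expR (- (c5 * s)).
have b0 : 0 <= b by exact: expR_ge0.
have bS : expR (- (c1 * (l * (mu * rho ^+ d)))) <= b.
  rewrite ler_expR lerN2; have q1 : 0 <= c1 * (l * (mu * rho ^+ d)) by rewrite !mulr_ge0 ?exprn_ge0 // ltW.
  clear - q1 c5S; lra.
(* Taking [L] radii as the scale of far pairs makes the exponent from [codeg_far] at most a constant
   times [L / L ^+ d.+1], hence at most a constant over [s]. *)
have main := @coupling_error_local R d nu nuE eta C mu rho phi d_gt0 eta01 C_ge1 dk l l0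
  m (C / s) L (2 * C * Kap / s) b b r2 ((2 * (K * rho)) ^+ d) (corner_count (K * rho)) (ltW m0) hm2 L1.
apply: le_trans (main _ _ _ _ _ _ _ _ _ _) _; rewrite ?C1E ?c1E ?minE.
- rewrite ler_wpM2l //.
  rewrite (le_trans _ iL) // lef_pV2 ?posrE ?exprn_gt0 // ler_eXnr //.
- apply: (@le_trans _ _ (2 * (C / L ^+ d.+1) * (Kap * L))).
    by rewrite ler_wpM2l // mulr_ge0 // divr_ge0 // exprn_ge0 // ltW.
  rewrite exprSr [leLHS](_ : _ = 2 * C * Kap * (L ^+ d)^-1); last first.
    by field; rewrite !gt_eqF ?exprn_gt0.
  rewrite ler_wpM2l //.
  by apply: le_trans iL; rewrite lef_pV2 ?posrE ?exprn_gt0 // ler_eXnr.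
- rewrite divr_ge0 ?(ltW s0) //=.
  by rewrite ler_pdivrMr //; clear - hs pos1 pos2 pos3 a0 Kap0; lra.
- exact: b0.
- exact: b0.
- exact: r20.
- by move=> x; exact: corner_count_ge0.
- exact: measurable_corner_count.
- by apply: (integral_corner_count nuE); rewrite mulr_ge0 // ltW.
- move=> x y xC yC; rewrite ?c1E ?minE /r2.
  have [mu2|mu2] := leP mu 2^-1.
    right; left; rewrite ler_expR lerN2 (le_trans c5S) //.
    have := @private_mass_half R d nu eta C mu rho phi dk x y mu2; have /andP[dy _] := deg_bounds nuE d_gt0 eta01 C_ge1 dk yC.
    rewrite minE c1E in dy => H.
    have : l * (c1 * (mu * rho ^+ d) / 2) <= l * private_mass nu phi x y.
      by rewrite ler_wpM2l ?(ltW l0) // (le_trans _ H) // ler_wpM2r.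
    clear - l0 c5S; lra.
  have [[i far]|near] := near_pairP (t * rho) x y; last by left.
  have [inter|corner] := corner_countP (K * rho) xC; last by right; right; right.
  right.
  have t01 : 0 < t <= 1 by rewrite t0.
  have lB z : eta * mu / 2 * (t * (rho / (8 * d%:R ^+ 2)) ^+ d) <= z -> expR (- (l * z)) <= b.
    move=> H; rewrite ler_expR lerN2; apply: (@le_trans _ _ (l * (eta * mu / 2 * (t * (rho / (8 * d%:R ^+ 2)) ^+ d)))); last first.
      by rewrite ler_wpM2l // ltW.
    rewrite expr_div_n [leRHS](_ : _ = c3 * t * (l * (mu * rho ^+ d))); last first.
      by rewrite /c3; ring.
    apply: (@le_trans _ _ (c5 * t * L)).
      by rewrite -mulrA ler_wpM2l ?(ltW c50) // /t ler_pdivlMl ?exprn_gt0 // -exprSr.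
    apply: (@le_trans _ _ (c5 * t * (2 * C1 * (l * (mu * rho ^+ d))))).
      by rewrite ler_wpM2l // mulr_ge0 // ltW.
    have q1 : 0 <= t * (l * (mu * rho ^+ d)) by rewrite !mulr_ge0 ?exprn_ge0 // ltW.
    have := ler_wpM2r q1 c52; clear - q1; lra.
  have [DD|DD] := @private_mass_near R d nu eta C mu rho phi x y t nuE d_gt0 eta01 C_ge1 dk d_gt1 t01 Krho xC yC (ex_intro _ i far) (fun=> inter).
    by left; exact: lB.
  by right; left; exact: lB.
rewrite lee_fin; apply: (@le_trans _ _ (CB / s)); last by rewrite ler_wpM2r ?(ltW isP) // lerDr.
have -> : CB / s = (C / s + 2 * (2 * C * Kap / s)) * m ^+ 2 +
    (G * K1 * m / s + (G * K1 * m / s + (G2 * m / s + G * G3 * K2 / s))).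
  by rewrite /CB; ring.
have bL : b * (l * (2 * (2 * L * rho)) ^+ d) * m <= G * K1 * m / s.
  apply: (@le_trans _ _ (b * (G * s ^+ (4 * d + 12)) * m)).
    by rewrite ler_wpM2r ?(ltW m0) // ler_wpM2l.
  rewrite [leLHS](_ : _ = G * m * (b * s ^+ (4 * d + 12))); last ring.
  rewrite [leRHS](_ : _ = G * m * (K1 / s)); last ring.
  by rewrite ler_wpM2l ?HK1 // mulr_ge0 // ltW.
rewrite lerD2l; do 2 apply: lerD => //; apply: lerD.
  rewrite mul1r [leRHS](_ : _ = G2 / s * m); last ring.
  by rewrite ler_wpM2r // ltW.
apply: (@le_trans _ _ (b * (G * s ^+ (4 * d + 12)) * (G3 * s ^+ 12))).
  apply: ler_pM => //.
  - by rewrite !mulr_ge0 ?exprn_ge0 ?mulr_ge0 // ltW.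
  - by rewrite mulr_ge0 ?exprn_ge0 ?mulr_ge0 // ltW.
  - by rewrite ler_wpM2l.
rewrite [leLHS](_ : _ = G * G3 * (b * s ^+ (4 * d + 24))); last first.
  by rewrite (_ : (4 * d + 24 = 4 * d + 12 + 12)%N) ?(exprD s (4 * d + 12)) -?addnA //; ring.
apply: (@le_trans _ _ (G * G3 * (K2 / s))); last by rewrite le_eqVlt; apply/orP; left; apply/eqP; ring.
by rewrite ler_wpM2l ?HK2 // mulr_ge0.
Qed.

(** * Isolated vertices of the Poisson random graph *)

Lemma counting_enum (R : realType) (V : choiceType) (X A : set V) n (y : nat -> V) :
  set_bij `I_n X y -> counting (X `&` A) = (\sum_(i < n) (y i \in A))%N%:R%:E :> \bar R.
Proof.
move=> [yX yinj ysurj].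
pose s := [seq y i | i <- iota 0 n & y i \in A].
have su : uniq s.
  rewrite map_inj_in_uniq ?filter_uniq ?iota_uniq // => i j.
  rewrite !mem_filter !mem_iota !add0n => /andP[_ /= iN] /andP[_ /= jN].
  by apply: yinj; rewrite inE.
have XAE : X `&` A = [set` [fset x in s]%fset].
  apply/seteqP; split => x /=.
    move=> [/ysurj[i iN <-] yA]; rewrite inE /=; apply/mapP; exists i => //.
    by rewrite mem_filter mem_iota add0n; apply/andP; split; [exact/mem_set|].
  rewrite inE /= => /mapP[i]; rewrite mem_filter mem_iota add0n => /andP[/set_mem iA /= iN] ->.
  by split => //; apply: yX.
rewrite /counting XAE asboolT; last exact: finite_fset.
rewrite set_fsetK card_fseq undup_id // size_map size_filter.
rewrite -(big_mkord xpredT (fun i => (y i \in A) : nat)) /index_iota subn0 -sum1_count big_mkcond.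
by congr (_%:R%:E); apply: eq_bigr => i _; case: (_ \in _).
Qed.

Section random_graph.
Context (R : realType) (d : nat) (disp : measure_display) (T : measurableType disp)
  (P : probability T R) (lambda : R) (phi : 'rV[R]_d -> R) (G : T -> graph 'rV[R]_d).
Local Notation E := 'rV[R]_d.
Variable nu : probability E R.
Hypothesis nuE : forall A, nu A = lebesgue_rV R d (A `&` unit_cube R d).
Hypothesis lambda_gt0 : 0 < lambda.
Hypothesis phiP : connection_function phi.
Hypothesis GP : poisson_process P lambda (fun w => vertices (G w)).

Variables (N : T -> nat) (Y : nat -> T -> E).
Hypothesis mN : measurable_fun [set: T] N.
Hypothesis mY : forall i, measurable_fun [set: T] (Y i).
Hypothesis Ybij : forall w, set_bij `I_(N w) (vertices (G w)) (fun i => Y i w).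
Hypothesis madj : forall i j,
  measurable [set w | adj (G w) (Y i w) (Y j w) /\ (i < j < N w)%N].
Hypothesis edgeP : forall n (B : set (n.-tuple E)) (e : rel 'I_n), measurable B ->
  let A := [set w | N w = n /\ B [tuple Y i w | i < n]] in
  P (A `&` [set w | forall i j : 'I_n, (i < j)%N -> adj (G w) (Y i w) (Y j w) <-> e i j]) =
  (\int[P]_(w in A) (edge_prob phi (fun i : 'I_n => Y i w) e)%:E)%E.

Local Notation w_ := (kernel_pair phi).
Let w01 x y : 0 <= w_ x y <= 1. Proof. exact: connection_itv phiP _. Qed.
Let wC x y : w_ x y = w_ y x.
Proof. by rewrite /kernel_pair -(connection_even phiP) opprB. Qed.
Let mw : measurable_fun [set: E * E] (fun p => w_ p.1 p.2).
Proof. exact: (measurableT_comp (connection_measurable phiP) (@measurable_rV_sub R d)). Qed.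

Lemma vertex_count_law m (A : 'I_m -> set E) (k : 'I_m -> nat) :
  (forall i, measurable (A i)) -> trivIset [set: 'I_m] A ->
  P [set w | forall j, (\sum_(i < N w) (Y i w \in A j))%N = k j] =
  (\prod_j (expR (- (lambda * fine (nu (A j)))) * (lambda * fine (nu (A j))) ^+ k j / (k j)`!%:R))%:E.
Proof.
move=> mA tA.
rewrite (_ : [set w | _] = \bigcap_j [set w | num_points R (vertices (G w)) (A j) = (k j)%:R%:E]).
  rewrite (poisson_indep GP) // -prodEFin; apply: eq_bigr => j _.
  by rewrite (poisson_count GP) // -nuE.
apply/seteqP; split => w /= H j; first by move=> _ /=; rewrite /num_points (counting_enum _ _ (Ybij w)) H.
have := H j I; rewrite /= /num_points (counting_enum _ _ (Ybij w)) => -[] /eqP.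
by rewrite eqr_nat => /eqP.
Qed.

Definition edge_set n (w : T) : {set 'I_n * 'I_n} :=
  [set p : 'I_n * 'I_n | (p.1 < p.2)%N && `[< adj (G w) (Y p.1 w) (Y p.2 w) >]]%SET.

Lemma in_edge_set n w (i j : 'I_n) :
  ((i, j) \in edge_set n w) = (i < j)%N && `[< adj (G w) (Y i w) (Y j w) >].
Proof. by rewrite finset.inE. Qed.

Lemma N0_edge_set n w : N w = n -> N0 R (G w) = #|iso_set [set: 'I_n]%SET (edge_set n w)|%:R%:E.
Proof.
move=> Nn; have [YX Yinj Ysurj] := Ybij w.
have Yin (i : 'I_n) : vertices (G w) (Y i w) by apply: YX => /=; rewrite Nn.
have Yi (i j : 'I_n) : Y i w = Y j w -> i = j.
  by move=> e; apply/val_inj/Yinj => //; rewrite inE /= Nn.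
rewrite /N0 (_ : Defs.isolated (G w) = vertices (G w) `&` Defs.isolated (G w)); last first.
  by rewrite setIidr // => x [].
rewrite (counting_enum _ _ (Ybij w)) Nn -sum1_card [in RHS]big_mkcond /=.
congr (_%:R%:E); apply: eq_bigr => i _; rewrite in_iso_set finset.in_setT /=.
rewrite (_ : (Y i w \in Defs.isolated (G w)) = [forall j in [set: 'I_n]%SET, (j != i) ==>
  ((i, j) \notin edge_set n w) && ((j, i) \notin edge_set n w)]); first by case: [forall _ in _, _].
apply/idP/forall_inP => [/set_mem[_ iso] j _|H].
  apply/implyP => ji; rewrite !in_edge_set.
  apply/andP; split; apply/nandP; right; apply/negP => /asboolP aij; first exact: (iso _ aij).
  by apply: (iso (Y j w)); exact: adj_sym.
apply/mem_set; split => // y adjy.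
have [_ /Ysurj[j /= jN jy]] := adj_vertices adjy; rewrite Nn in jN.
have := H (Ordinal jN); rewrite finset.in_setT => /(_ isT).
have ji : Ordinal jN != i.
  apply/eqP => e; apply: (@adj_irrefl _ (G w) (Y i w)).
  by move: adjy; rewrite -jy -[j]/(val (Ordinal jN)) e.
rewrite ji implyTb !in_edge_set => /andP[/nandP[n1|/asboolPn]]; last by rewrite /= jy.
move=> /nandP[n2|/asboolPn]; last by apply; rewrite /= jy; exact: adj_sym.
by case/eqP: ji; apply/val_inj/anti_leq; move: n1 n2; rewrite -!leqNgt => -> ->.
Qed.

Let upward n (e : {set 'I_n * 'I_n}) := [forall p in e, (p.1 < p.2)%N].

(** Non-increasing pairs have weight 0, so only upward edge sets count, and on these the extra
    factors are 1. Symmetry of the kernel reconciles [phi (x j - x i)] with [phi (x i - x j)]. *)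
Lemma edge_weight_upward n (x : 'I_n -> E) (e : {set 'I_n * 'I_n}) :
  edge_weight (fun i j => w_ (x i) (x j)) e =
  if upward e then edge_prob phi x (fun i j => (i, j) \in e) else 0.
Proof.
have [up|/forall_inPn[p pe pn]] := boolP (upward e); last first.
  by rewrite /edge_weight (bigD1 p) //= pe (negbTE pn) mul0r.
rewrite /edge_weight /edge_prob [RHS](eq_bigr (fun i => \prod_(j < n) (if (i, j) \in e then
  (if (i < j)%N then w_ (x i) (x j) else 0) else 1 - (if (i < j)%N then w_ (x i) (x j) else 0)))).
  by rewrite pair_big /=; apply: eq_bigr => -[i j] _.
move=> i _; rewrite big_mkcond /=; apply: eq_bigr => j _; rewrite wC /kernel_pair.
case: (boolP ((i, j) \in e)) => ije; first by have := forall_inP up _ ije => /= ->.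
by case: ifP; rewrite // subr0.
Qed.

Let level n := [set w | N w = n].

Let mlevel n : measurable (level n).
Proof.
rewrite (_ : level n = N @^-1` [set n]) //.
by rewrite -[X in measurable X]setTI; exact: mN.
Qed.

Let pattern n (e : {set 'I_n * 'I_n}) := level n `&` [set w | edge_set n w = e].

Lemma pattern_adj n (e : {set 'I_n * 'I_n}) : upward e -> pattern e =
  [set w | N w = n /\ [set: n.-tuple E] [tuple Y i w | i < n]] `&`
  [set w | forall i j : 'I_n, (i < j)%N -> adj (G w) (Y i w) (Y j w) <-> (i, j) \in e].
Proof.
move=> up; apply/seteqP; split => w [] /=.
  move=> Nw /= <-; split => // i j ij; rewrite in_edge_set ij andTb.
  by split => /asboolP.
move=> [Nw _] H; split => //; apply/setP => -[i j]; rewrite in_edge_set.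
apply/andP/idP => [[ij /asboolP]|ije]; first by move/(H i j ij).
by have ij := forall_inP up _ ije; split => //; apply/asboolP/(H i j ij).
Qed.

(** Measurability of adjacency is given only for indices below [N w], hence the pattern is assembled
    inside the event [N w = n]. *)
Lemma measurable_pattern n (e : {set 'I_n * 'I_n}) : measurable (pattern e).
Proof.
rewrite (_ : pattern e = \bigcap_(p in [set: 'I_n * 'I_n]) (level n `&` [set w | (p \in edge_set n w) = (p \in e)]) `&` level n).
  apply: measurableI => //; apply: fin_bigcap_measurable => [|p _]; first exact: finite_finset.
  have mp : measurable (level n `&` [set w | p \in edge_set n w]).
    rewrite (_ : _ `&` _ = level n `&` [set w | adj (G w) (Y p.1 w) (Y p.2 w) /\ (p.1 < p.2 < N w)%N]).
      exact: measurableI.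
    apply/seteqP; split => w [Nw] /=.
      by rewrite finset.inE => /andP[p12 /asboolP padj]; rewrite p12 Nw ltn_ord.
    by move=> [padj /andP[p12 _]]; split => //=; rewrite finset.inE p12; exact/asboolP.
  case: (p \in e).
    by rewrite (_ : [set w | _ = true] = [set w | p \in edge_set n w]).
  rewrite (_ : _ `&` _ = level n `\` (level n `&` [set w | p \in edge_set n w])).
    exact: measurableD.
  apply/seteqP; split => w [Nw] /=; first by move=> pe; split => // -[_]; rewrite pe.
  by move=> H; split => //; apply/negbTE/negP => pe; apply: H.
apply/seteqP; split => w [] /=.
  by move=> Nw /= <-; split => // p _.
by move=> H Nw; split => //; apply/setP => p; have [_ /= ->] := H p I.
Qed.

Lemma N0_level n k : level n `&` [set w | N0 R (G w) = k%:R%:E] =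
  \big[setU/set0]_(e : {set 'I_n * 'I_n} | upward e && (#|iso_set [set: 'I_n]%SET e| == k)) pattern e.
Proof.
rewrite -bigcup_seq_cond; apply/seteqP; split => w.
  move=> [Nw /=]; rewrite (N0_edge_set Nw) => -[] /eqP; rewrite eqr_nat => kE.
  exists (edge_set n w) => //=; rewrite mem_index_enum kE andbT /=.
  by apply/forall_inP => p; rewrite finset.inE => /andP[].
move=> [e /= /andP[_ /andP[_ /eqP kE]] [Nw we]]; split => //=.
by rewrite (N0_edge_set Nw) we kE.
Qed.

Let seqY n w := [seq Y i w | i : 'I_n <- enum 'I_n].

Let nth_seqY n w (i : 'I_n) : nth 0 (seqY n w) i = Y i w.
Proof. by rewrite /seqY (nth_map i) ?size_enum_ord // nth_ord_enum. Qed.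

(** The event splits into the finitely many edge patterns with [k] isolated vertices, to each of
    which the conditional law of the edges applies; summing [edge_prob] over them gives back
    [iso_coef]. *)
Lemma probability_N0_level n k : P (level n `&` [set w | N0 R (G w) = k%:R%:E]) =
  (\int[P]_(w in level n) (iso_coef (0%R : E) w_ n k (seqY n w))%:E)%E.
Proof.
pose c (e : {set 'I_n * 'I_n}) : R := (upward e && (#|iso_set [set: 'I_n]%SET e| == k))%:R.
pose F (e : {set 'I_n * 'I_n}) w := edge_prob phi (fun i : 'I_n => Y i w) (fun i j => (i, j) \in e).
have F0 e w : 0 <= F e w.
  apply: prodr_ge0 => i _; apply: prodr_ge0 => j _; have := connection_itv phiP (Y i w - Y j w).
  by move=> /andP[? ?]; case: ifP => _ //; rewrite subr_ge0.
have mF e : measurable_fun [set: T] (F e).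
  rewrite /F /edge_prob; apply: measurable_prod => i _; under eq_fun do rewrite big_mkcond /=.
  have mij j : measurable_fun [set: T] (fun w => phi (Y i w - Y j w)).
    exact: (measurableT_comp mw (measurable_fun_pair (mY j) (mY i))).
  apply: measurable_prod => j _; case: (boolP (i < j)%N) => _ //.
  by case: (boolP ((i, j) \in e)) => _ //; apply: measurable_funB.
have iE w : iso_coef (0%R : E) w_ n k (seqY n w) = \sum_e c e * F e w.
  rewrite /iso_coef coef_iso_pgf; apply: eq_bigr => e _.
  rewrite (_ : (fun i j : 'I_n => _) = (fun i j : 'I_n => w_ (Y i w) (Y j w))); last first.
    by apply/funext => i; apply/funext => j; rewrite !nth_seqY.
  by rewrite edge_weight_upward /c; case: (upward e); rewrite ?mul0r //= mulrC.
under eq_integral do rewrite iE -sumEFin.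
rewrite ge0_integral_sum //; last 2 first.
- move=> e; apply: measurable_funTS; apply/measurable_EFinP; exact: measurable_funM.
- by move=> e w _; rewrite lee_fin mulr_ge0.
have mL : measurable (level n `&` [set w | N0 R (G w) = k%:R%:E]).
  by rewrite N0_level; apply: bigsetU_measurable => e _; exact: measurable_pattern.
have LE w : \1_(level n `&` [set w | N0 R (G w) = k%:R%:E]) w = \sum_e c e * \1_(pattern e) w.
  rewrite indicE; case: (boolP (w \in _)) => [/set_mem[Nw /=]|].
    rewrite (N0_edge_set Nw) => -[] /eqP; rewrite eqr_nat => kE.
    rewrite (bigD1 (edge_set n w)) //= big1 ?addr0 => [|e ew].
      rewrite /c kE andbT indicE mem_set //.
      rewrite (_ : upward _ = true) ?mulr1 //.
      by apply/forall_inP => -[i j]; rewrite in_edge_set => /andP[].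
    by rewrite indicE memNset ?mulr0 // => -[_ /= e'E]; rewrite e'E eqxx in ew.
  move=> wL; rewrite big1 // => e _; rewrite /c.
  case: (boolP (upward e && _)) => [ek|]; last by rewrite mul0r.
  rewrite indicE memNset ?mulr0 // => pe; move/negP: wL; apply; apply/mem_set.
  rewrite N0_level -bigcup_seq_cond; exists e => //=.
  by rewrite mem_index_enum ek.
transitivity (\int[P]_w (\1_(level n `&` [set w | N0 R (G w) = k%:R%:E]) w)%:E)%E.
  by rewrite integral_indic // setIT.
transitivity (\int[P]_w (\sum_e (c e * \1_(pattern e) w)%:E))%E.
  by apply: eq_integral => w _; rewrite sumEFin LE.
rewrite ge0_integral_sum //; last 2 first.
- move=> e; apply/measurable_EFinP; apply: measurable_funM => //.
  by apply: measurable_indic; exact: measurable_pattern.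
- by move=> e w _; rewrite lee_fin mulr_ge0.
apply: eq_bigr => e _; under eq_integral do rewrite EFinM.
under [RHS]eq_integral do rewrite EFinM.
rewrite [LHS]ge0_integralZl_EFin //; last first.
  by apply/measurable_EFinP; apply: measurable_indic; exact: measurable_pattern.
rewrite [RHS]ge0_integralZl_EFin //; last 2 first.
- by move=> w _; rewrite lee_fin.
- by apply: measurable_funTS; exact/measurable_EFinP.
rewrite integral_indic ?setIT //; last exact: measurable_pattern.
rewrite /c; case: (boolP (upward e)) => [up|]; last by rewrite !mul0e.
have /= adjE := @edgeP n setT (fun i j => (i, j) \in e) measurableT.
congr (_ * _)%E; rewrite (pattern_adj up); apply: etrans adjE _.
by rewrite (_ : [set w | N w = n /\ _] = level n) //; apply/seteqP; split => w // [].
Qed.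

(** [iso_coef] is invariant under renumbering, so all integrals in [poisson_law] coincide, and
    dividing by their number turns its constant into [pois lambda n]. *)
Lemma probability_N0_level_iter n k : P (level n `&` [set w | N0 R (G w) = k%:R%:E]) =
  ((pois lambda n)%:E * iter_int nu n (iso_coef (0%R : E) w_ n k))%E.
Proof.
have F0 s : 0 <= iso_coef (0%R : E) w_ n k s by exact: iso_coef_ge0.
have := poisson_law (0%R : E) mN mY (ltW lambda_gt0) vertex_count_law F0 (measurable_iso_coef (0%R : E) mw k).
rewrite (eq_bigr (fun=> (\int[P]_(w in level n) (iso_coef (0%R : E) w_ n k (seqY n w))%:E)%E)); last first.
  move=> s _; apply: eq_integral => w _; congr EFin; rewrite /iso_coef.
  have -> : [set: 'I_n]%SET = [set s x | x in [set: 'I_n]%SET]%SET.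
    apply/setP => i; rewrite finset.in_setT; apply/esym/imsetP; exists (s^-1%g i) => //.
    by rewrite permKV.
  rewrite [in RHS]iso_pgf_imset; last 3 first.
  - exact: perm_inj.
  - by move=> i j; exact: wC.
  - by move=> i j; have /andP[] := w01 (nth 0 (seqY n w) i) (nth 0 (seqY n w) j).
  rewrite (_ : [set s x | x in [set: 'I_n]%SET]%SET = [set: 'I_n]%SET); last first.
    apply/setP => i; rewrite finset.in_setT; apply/imsetP; exists (s^-1%g i) => //.
    by rewrite permKV.
  congr (_`_ _); congr iso_pgf; apply/funext => i; apply/funext => j.
  have nthS (l : 'I_n) : nth 0 [seq Y (s i0) w | i0 : 'I_n <- enum 'I_n] l = Y (s l) w.
    by rewrite (nth_map l) ?size_enum_ord // nth_ord_enum.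
  by rewrite !nthS !nth_seqY.
rewrite -probability_N0_level big_const card_Sn; set p := P _ => H.
have nfact : (n`!%:R : R) != 0 by rewrite pnatr_eq0 -lt0n fact_gt0.
have iterE m : iter m (+%E p) 0%E = (m%:R%:E * p)%E.
  elim: m => [|m IH]; first by rewrite mul0e.
  by rewrite iterS IH -natr1 EFinD ge0_muleDl ?lee_fin // mul1e addeC.
rewrite iterE in H.
rewrite -[LHS]mul1e -[X in X%:E](mulVf nfact) EFinM -muleA H muleA -EFinM.
by congr (_%:E * _)%E; rewrite /pois mulrC.
Qed.

Lemma measurable_N0_level n k : measurable (level n `&` [set w | N0 R (G w) = k%:R%:E]).
Proof. by rewrite N0_level; apply: bigsetU_measurable => e _; exact: measurable_pattern. Qed.

Lemma N0_levels k : [set w | N0 R (G w) = k%:R%:E] =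
  \bigcup_n (level n `&` [set w | N0 R (G w) = k%:R%:E]).
Proof.
by apply/seteqP; split => w => [H|[n _ [_ //]]]; exists (N w).
Qed.

Lemma measurable_N0 k : measurable [set w | N0 R (G w) = k%:R%:E].
Proof.
by rewrite N0_levels; apply: bigcup_measurable => n _; exact: measurable_N0_level.
Qed.

Lemma probability_N0 k : P [set w | N0 R (G w) = k%:R%:E] = iso_prob nu (0%R : E) w_ lambda k.
Proof.
rewrite N0_levels measure_semi_bigcup //; last 3 first.
- by move=> n; exact: measurable_N0_level.
- by apply/trivIsetP => i j _ _ /eqP ij; apply/seteqP; split => w // [[wi _] [wj _]]; exact: ij (etrans (esym wi) wj).
- by apply: bigcup_measurable => n _; exact: measurable_N0_level.
by apply: eq_eseriesr => n _; exact: probability_N0_level_iter.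
Qed.

(** Read off from the graph: its vertex set is finite, so the events of having exactly [k] isolated
    vertices cover the probability space. *)
Lemma sum_iso_prob : (\sum_(0 <= k <oo) iso_prob nu (0%R : E) w_ lambda k = 1)%E.
Proof.
transitivity (\sum_(0 <= k <oo) P [set w | N0 R (G w) = k%:R%:E])%E.
  by apply: eq_eseriesr => k _; rewrite probability_N0.
rewrite -measure_semi_bigcup //; last 3 first.
- exact: measurable_N0.
- apply/trivIsetP => i j _ _ ij; apply/seteqP; split => w // [/= -> []] /eqP.
  by rewrite eqr_nat (negbTE ij).
- by apply: bigcup_measurable => k _; exact: measurable_N0.
rewrite -[RHS](probability_setT P); congr (P _); apply/seteqP; split => w // _.
by exists #|iso_set [set: 'I_(N w)]%SET (edge_set (N w) w)| => //=; rewrite (@N0_edge_set (N w)).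
Qed.

End random_graph.

(** * The limit *)

Section poisson_limit.
Context (R : realType) (p : nat -> nat -> R) (m : nat -> R) (alpha : R).
Hypothesis alpha_gt0 : 0 < alpha.
Hypothesis p_ge0 : forall n k, 0 <= p n k.
Hypothesis m_ge0 : forall n, 0 <= m n.
Hypothesis m_cvg : m n @[n --> \oo] --> alpha.
Hypothesis p_step : forall e : R, 0 < e ->
  \forall n \near \oo, forall k, m n * p n k <= k.+1%:R * p n k.+1 + e.
Hypothesis p_mean : forall n M, \sum_(k < M) k.+1%:R * p n k.+1 <= m n.
Hypothesis p_le1 : forall n M, \sum_(k < M) p n k <= 1.
Hypothesis p_tail : forall n M, 1 <= \sum_(k < M.+1) p n k + m n / M.+1%:R.

Let m_bounded : \forall n \near \oo, m n <= alpha + 1.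
Proof.
have := m_cvg => /cvgrPdist_le /(_ 1 ltr01); apply: filterS => n.
rewrite ler_norml => /andP[? ?]; lra.
Qed.

Let exists_div_le (c e : R) : 0 <= c -> 0 < e -> exists M : nat, c / M.+1%:R <= e.
Proof.
move=> c0 e0; exists (Num.trunc (c / e)).
rewrite ler_pdivrMr // mulrC -ler_pdivrMr //.
by have /andP[_ /ltW] := truncn_itv (divr_ge0 c0 (ltW e0)).
Qed.

(** From below the defects are controlled by [p_step]. From above, [p_mean] and [p_tail] bound their
    sum over [j <= M] by [m n ^+ 2 / M.+1]; since the other defects are nearly nonnegative, the one
    at [k] cannot be large. *)
Lemma ratio_defect_cvg k : (k.+1%:R * p n k.+1 - m n * p n k) @[n --> \oo] --> (0 : R).
Proof.
apply/cvgr0Pnorm_le => e e0.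
have a0 := alpha_gt0; have e2 : 0 < e / 2 by lra.
have [M0 HM0] := exists_div_le (sqr_ge0 (alpha + 1)) e2.
pose M := maxn M0 k.
have HM : (alpha + 1) ^+ 2 / M.+1%:R <= e / 2.
  apply: le_trans HM0; rewrite ler_wpM2l ?sqr_ge0 // lef_pV2 ?posrE // ler_nat.
  by rewrite ltnS leq_maxl.
(* The tolerance for each defect is divided by [M.+1], so that the [M] others together lose at most
   [e / 2]. *)
have d0 : 0 < e / 2 / M.+1%:R by rewrite divr_gt0.
have kM : (k < M.+1)%N by rewrite ltnS leq_maxr.
near=> n.
have step : forall j, m n * p n j <= j.+1%:R * p n j.+1 + e / 2 / M.+1%:R by near: n; exact: p_step.
have mb : m n <= alpha + 1 by near: n.
have dle : e / 2 / M.+1%:R <= e / 2 by rewrite ler_pdivrMr // ler_peMr ?ler1n // ltW.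
rewrite ler_norml; apply/andP; split.
  rewrite lerNl opprB lerBlDl; apply: le_trans (step k) _; rewrite lerD2l.
  by apply: le_trans dle _; lra.
pose q j := j.+1%:R * p n j.+1 - m n * p n j.
have qge j : - (e / 2 / M.+1%:R) <= q j by rewrite /q lerNl opprB lerBlDl; exact: step.
have qsum : \sum_(j < M.+1) q j <= (m n) ^+ 2 / M.+1%:R.
  rewrite /q sumrB -mulr_sumr; have := p_mean n M.+1; have := p_tail n M.
  set s1 := \sum_(j < M.+1) p n j; set s2 := \sum_(j < M.+1) _ => H1 H2.
  have H3 := ler_wpM2l (m_ge0 n) H1; rewrite mulrDr mulr1 in H3; rewrite expr2 -mulrA.
  by rewrite lerBlDr; apply: le_trans H2 _; rewrite addrC.
have qk : q k - M%:R * (e / 2 / M.+1%:R) <= \sum_(j < M.+1) q j.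
  rewrite (bigD1 (Ordinal kM)) //= lerD2l.
  apply: (@le_trans _ _ (\sum_(j < M.+1 | j != Ordinal kM) - (e / 2 / M.+1%:R))).
    rewrite sumr_const (_ : #|_| = M); last by rewrite cardC1 card_ord.
    by rewrite -[leRHS]mulr_natl mulrN.
  by apply: ler_sum => j _; exact: qge.
have Mle : M%:R * (e / 2 / M.+1%:R) <= e / 2.
  rewrite mulrCA ler_piMr ?(ltW e2) // ler_pdivrMr // mul1r ler_nat //.
have msq : (m n) ^+ 2 / M.+1%:R <= (alpha + 1) ^+ 2 / M.+1%:R.
  rewrite ler_wpM2r // lerXn2r ?nnegrE ?m_ge0 //; lra.
rewrite lerBlDr in qk; apply: le_trans qk _; rewrite [leRHS]splitr.
exact: lerD (le_trans qsum (le_trans msq HM)) Mle.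
Unshelve. all: by end_near.
Qed.

Lemma poisson_ratio_cvg k : (p n k - p n 0 * (alpha ^+ k / k`!%:R)) @[n --> \oo] --> (0 : R).
Proof.
elim: k => [|k IH].
  under eq_fun do rewrite expr0 fact0 divr1 mulr1 subrr; exact: cvg_cst.
have mp0 : ((m n - alpha) * p n k) @[n --> \oo] --> (0 : R).
  have ma : (m n - alpha) @[n --> \oo] --> (0 : R).
    by rewrite -(subrr alpha); apply: cvgB => //; exact: cvg_cst.
  apply/cvgr0Pnorm_le => e e0; move/cvgr0Pnorm_le: ma => /(_ e e0); apply: filterS => n H.
  rewrite normrM; apply: le_trans H; rewrite ler_piMr // ger0_norm //.
  by apply: le_trans (p_le1 n k.+1); rewrite big_ord_recr /= lerDr sumr_ge0.
have k0 : (k.+1%:R : R) != 0 by rewrite pnatr_eq0.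
have kf : (k`!%:R : R) != 0 by rewrite pnatr_eq0 -lt0n fact_gt0.
have E n : p n k.+1 - p n 0 * (alpha ^+ k.+1 / k.+1`!%:R) =
    k.+1%:R^-1 * ((k.+1%:R * p n k.+1 - m n * p n k) + (m n - alpha) * p n k +
      alpha * (p n k - p n 0 * (alpha ^+ k / k`!%:R))).
  move: k0 kf; rewrite factS natrM exprS; move: (k.+1%:R : R) (k`!%:R : R) => a b a0 b0.
  by field; rewrite a0 b0.
rewrite (_ : (fun n => _) = (fun n => k.+1%:R^-1 * ((k.+1%:R * p n k.+1 - m n * p n k) + (m n - alpha) * p n k +
      alpha * (p n k - p n 0 * (alpha ^+ k / k`!%:R))))); last by apply/funext.
rewrite -[X in _ --> X](mulr0 k.+1%:R^-1); apply: cvgMl_tmp.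
rewrite -[X in _ --> X](addr0 0); apply: cvgD; last first.
  by rewrite -[X in _ --> X](mulr0 alpha); apply: cvgMl_tmp.
rewrite -[X in _ --> X](addr0 0); apply: cvgD => //.
exact: ratio_defect_cvg.
Qed.

(** Normalisation fixes the last unknown: by [poisson_ratio_cvg] a partial sum of the [p n k] is
    close to [p n 0] times a partial sum of the series of [expR alpha], and it is close to 1 because
    the tail is at most [m n / M.+1], uniformly for large [n]. *)
Lemma poisson_void_cvg : p n 0 @[n --> \oo] --> expR (- alpha).
Proof.
have a0 := alpha_gt0.
apply/cvgrPdist_le => e e0; have e3 : 0 < e / 3 by lra.
have ser : series (exp_coeff alpha) n @[n --> \oo] --> expR alpha.
  by apply: is_cvg_series_exp_coeff.
have a1 : 0 <= alpha + 1 by lra.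
have [M0 HM0] := exists_div_le a1 e3.
have [M1 _ HM1] : \forall n \near \oo, `|expR alpha - series (exp_coeff alpha) n| <= e / 3.
  by move/cvgrPdist_le: ser; apply.
pose M := maxn M0 M1.
have HM : (alpha + 1) / M.+1%:R <= e / 3.
  apply: le_trans HM0; rewrite ler_wpM2l // lef_pV2 ?posrE // ler_nat.
  by rewrite ltnS leq_maxl.
have HE : `|expR alpha - series (exp_coeff alpha) M.+1| <= e / 3.
  by apply: HM1 => /=; rewrite (leq_trans (leq_maxr M0 M1)).
have sum0 : (\sum_(k < M.+1) (p n k - p n 0 * (alpha ^+ k / k`!%:R))) @[n --> \oo] --> (0 : R).
  elim: {HM HE} M.+1 => [|K IH]; first by under eq_fun do rewrite big_ord0; exact: cvg_cst.
  rewrite (_ : (fun n => _) = (fun n => \sum_(k < K) (p n k - p n 0 * (alpha ^+ k / k`!%:R)) +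
    (p n K - p n 0 * (alpha ^+ K / K`!%:R)))); last by apply/funext => n; rewrite big_ord_recr.
  by rewrite -[X in _ --> X](addr0 0); apply: cvgD => //; exact: poisson_ratio_cvg.
near=> n.
have mb : m n <= alpha + 1 by near: n; exact: m_bounded.
have : `|\sum_(k < M.+1) (p n k - p n 0 * (alpha ^+ k / k`!%:R))| <= e / 3.
  by near: n; move/cvgr0Pnorm_le: sum0; apply.
rewrite sumrB -mulr_sumr.
have -> : \sum_(k < M.+1) (alpha ^+ k / k`!%:R) = series (exp_coeff alpha) M.+1.
  by rewrite /series /= big_mkord; apply: eq_bigr => k _; rewrite /exp_coeff.
move: HE; set S := series _ _; set s1 := \sum_(k < _) _ => HE Hs.
have p01 : 0 <= p n 0 <= 1.
  by rewrite p_ge0 /=; have := p_le1 n 1; rewrite big_ord1.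
have s1b : 1 - e / 3 <= s1 <= 1.
  rewrite p_le1 andbT; have := p_tail n M; rewrite -/s1.
  rewrite lerBlDr => /le_trans; apply; rewrite lerD2l; apply: le_trans HM.
  by rewrite ler_wpM2r.
have pS : `|p n 0 * (expR alpha - S)| <= e / 3.
  have /andP[p0 p1] := p01.
  by rewrite normrM (ger0_norm p0); apply: le_trans HE; rewrite ler_piMl.
have key : `|1 - p n 0 * expR alpha| <= e.
  move: Hs pS s1b; rewrite mulrBr; set X := p n 0 * S; set Z := p n 0 * expR alpha.
  rewrite !ler_norml => /andP[? ?] /andP[? ?] /andP[? ?]; apply/andP; split; lra.
rewrite (_ : expR (- alpha) - p n 0 = expR (- alpha) * (1 - p n 0 * expR alpha)); last first.
  by rewrite expRN; field; rewrite gt_eqF // expR_gt0.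
rewrite normrM; apply: le_trans key; rewrite ler_piMl // ger0_norm ?expR_ge0 //.
by rewrite expR_le1 oppr_le0 ltW.
Unshelve. all: by end_near.
Qed.

Lemma poisson_cvg k : p n k @[n --> \oo] --> expR (- alpha) * alpha ^+ k / k`!%:R.
Proof.
rewrite (_ : (fun n => p n k) = (fun n => (p n k - p n 0 * (alpha ^+ k / k`!%:R)) + p n 0 * (alpha ^+ k / k`!%:R))); last first.
  by apply/funext => n; rewrite subrK.
rewrite -[X in _ --> X]add0r; apply: cvgD; first exact: poisson_ratio_cvg.
by rewrite -mulrA; apply: cvgMr_tmp; exact: poisson_void_cvg.
Qed.

End poisson_limit.

(** Markov's inequality: beyond [M] each [p k] is at most [k * p k / M.+1]. It is applied to finite
    sums before passing to the limit. *)
Lemma eseries_tail_le (R : realType) (p : nat -> R) (m : R) (M : nat) :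
  (forall k, 0 <= p k) -> (\sum_(0 <= k <oo) (p k)%:E = 1)%E ->
  (forall K, \sum_(k < K) k.+1%:R * p k.+1 <= m) ->
  1 <= \sum_(k < M.+1) p k + m / M.+1%:R.
Proof.
move=> p0 psum pm.
have part K : \sum_(k < K + M.+1) p k <= \sum_(k < M.+1) p k + m / M.+1%:R.
  rewrite addnC big_split_ord /= lerD2l ler_pdivlMr // mulrC.
  apply: le_trans (pm (M + K)%N); rewrite big_split_ord /= mulr_sumr.
  apply: (@le_trans _ _ (\sum_(i < K) (M + i).+1%:R * p (M + i).+1)).
    apply: ler_sum => i _; rewrite addSn ler_wpM2r // ler_nat ltnS.
    exact: leq_addr.
  by rewrite lerDr sumr_ge0 // => i _; rewrite mulr_ge0.
rewrite -lee_fin -psum; apply: lime_le.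
  by apply: is_cvg_nneseries => k _ _; rewrite lee_fin.
near=> K; rewrite big_mkord sumEFin lee_fin.
have KM : (M.+1 <= K)%N by near: K; exists M.+1.
by have := part (K - M.+1)%N; rewrite subnK.
Unshelve. all: by end_near.
Qed.

Theorem theorem3p1 (R : realType) (d : nat) (hd : (2 <= d)%N)
    (alpha eta : R) (halpha : 0 < alpha) (heta : 0 < eta <= 1)
    (lambda : nat -> R) (lambda_gt0 : forall n, 0 < lambda n)
    (lambda_incr : nondecreasing_seq lambda)
    (lambda_pinfty : lambda n @[n --> \oo] --> +oo)
    (phi : R -> 'rV[R]_d -> R)
    (hphi : forall l : R, 0 < l -> Phi_class eta (phi l))
    (hlim : lambda n * \int[lebesgue_rV R d]_(x in unit_cube R d)
                expR (- (lambda n * \int[lebesgue_rV R d]_(y in unit_cube R d)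
                                       phi (lambda n) (y - x)))
              @[n --> \oo] --> alpha)
    (disp : nat -> measure_display) (T : forall n, measurableType (disp n))
    (P : forall n, probability (T n) R)
    (G : forall n, T n -> graph 'rV[R]_d)
    (hG : forall n,
        poisson_random_graph (P n) (lambda n) (phi (lambda n)) (G n))
    (k : nat) :
  P n [set w | N0 R (G n w) = k%:R%:E] @[n --> \oo]
    --> (expR (- alpha) * alpha ^+ k / k`!%:R)%:E.
Proof.
have [nu nuE] := cube_probability R d.
have d0 : (0 < d)%N by exact: ltnW.
have [C C1 PhiC] := Phi_class_decaying d0 heta.
have [Cst [s0 err_small]] := coupling_error_small nuE hd heta C1 halpha.
pose w n : 'rV[R]_d -> 'rV[R]_d -> R := kernel_pair (phi (lambda n)).
pose q n j := P n [set w | N0 R (G n w) = j%:R%:E].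
pose p n j := fine (q n j).
pose m n := lambda n * (\int[nu]_x piso nu (w n) (lambda n) x)%R.
have dk n : exists mu rho, decaying_kernel eta C mu rho (phi (lambda n)) by exact: PhiC (hphi _ (lambda_gt0 n)).
have phiP n : connection_function (phi (lambda n)) := Phi_connection (hphi _ (lambda_gt0 n)).
have w01 n x y : 0 <= w n x y <= 1 by have [mu [rho H]] := dk n; exact: (kernel_pair01 H).
have wC n x y : w n x y = w n y x by have [mu [rho H]] := dk n; exact: (kernel_pairC H).
have mw n : measurable_fun [set: 'rV[R]_d * 'rV[R]_d] (fun z => w n z.1 z.2).
  by have [mu [rho H]] := dk n; exact: (measurable_kernel_pair H).
have qE n j : q n j = iso_prob nu (0%R : 'rV[R]_d) (w n) (lambda n) j.
  have [GP [N [Y [mN mY Yb madj edgeP]]]] := hG n.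
  exact: (probability_N0 nuE (lambda_gt0 n) (phiP n) GP mN mY Yb madj edgeP).
have qsum n : (\sum_(0 <= j <oo) q n j = 1)%E.
  have [GP [N [Y [mN mY Yb madj edgeP]]]] := hG n.
  rewrite -(sum_iso_prob nuE (lambda_gt0 n) (phiP n) GP mN mY Yb madj edgeP).
  by apply: eq_eseriesr => j _; exact: qE.
have q0 n j : (0 <= q n j)%E by exact: measure_ge0.
have qp n j : q n j = (p n j)%:E.
  rewrite /p fineK // ge0_fin_numE // (@le_lt_trans _ _ 1%E) ?ltry //.
  rewrite -(qsum n); apply: le_trans (nneseries_lim_ge j.+1 _); last by [].
  by rewrite big_nat_recr //= leeDr // sume_ge0.
have p0 n j : 0 <= p n j by rewrite -lee_fin -qp.
have mE n : mean_iso nu (w n) (lambda n) = (m n)%:E.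
  rewrite /mean_iso /m EFinM integral_Rintegral //.
    by move=> x; exact: piso01.
  exact: measurable_piso.
have m0 n : 0 <= m n.
  rewrite mulr_ge0 ?(ltW (lambda_gt0 n)) //; apply: Rintegral_ge0 => x _; exact: expR_ge0.
have psum n : (\sum_(0 <= j <oo) (p n j)%:E = 1)%E.
  by rewrite -(qsum n); apply: eq_eseriesr => j _; rewrite qp.
have p_mean n M : \sum_(j < M) j.+1%:R * p n j.+1 <= m n.
  rewrite -lee_fin -mE -sumEFin; apply: le_trans (iso_prob_mean nu (0 : 'rV[R]_d) (w01 n) (wC n) (mw n) (lambda_gt0 n) M).
  by apply: lee_sum => j _; rewrite EFinM -qp qE.
have p_le1 n M : \sum_(j < M) p n j <= 1.
  rewrite -lee_fin -(psum n) -sumEFin -(big_mkord xpredT (fun j => (p n j)%:E)).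
  by apply: nneseries_lim_ge => j _ _; rewrite lee_fin.
have p_tail n M : 1 <= \sum_(j < M.+1) p n j + m n / M.+1%:R.
  exact: (@eseries_tail_le R (p n) (m n) M (p0 n) (psum n) (p_mean n)).
(* [nu] is Lebesgue measure restricted to the cube, so [hlim] is the convergence of the mean number
   of isolated vertices. *)
have mP : m n @[n --> \oo] --> alpha.
  rewrite (_ : (fun n => m n) = (fun n => lambda n * \int[lebesgue_rV R d]_(x in unit_cube R d)
    expR (- (lambda n * \int[lebesgue_rV R d]_(y in unit_cube R d) phi (lambda n) (y - x))))) //.
  apply/funext => n; rewrite /m; congr (_ * _).
  have degE x : deg nu (w n) x = (\int[lebesgue_rV R d]_(y in unit_cube R d) phi (lambda n) (y - x))%R.
    rewrite /deg /Rintegral (ge0_integral_nu nuE) //.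
      by apply/measurable_EFinP; exact: measurable_w1 (mw n) x.
    by move=> y; rewrite lee_fin; have /andP[] := w01 n x y.
  rewrite /Rintegral (ge0_integral_nu nuE); last 2 first.
  - by apply/measurable_EFinP; exact: measurable_piso.
  - by move=> x; rewrite lee_fin expR_ge0.
  apply: congr1; apply: eq_integral => x _.
  exact: (congr1 (fun t => (expR (- (lambda n * t)))%:E) (degE x)).
have p_step e : 0 < e -> \forall n \near \oo, forall j, m n * p n j <= j.+1%:R * p n j.+1 + e.
  (* Threshold for [s]: past [s0] the error bound holds, 1 keeps [s] positive, and past the last
     entry [Cst / s] is at most [e]. *)
  move=> e0; pose B := Num.max (Num.max s0 1) (`|Cst| / e).
  have Bs0 : s0 <= B by rewrite /B !le_max lexx.
  have B1 : 1 <= B by rewrite /B !le_max lexx orbT.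
  have BC : `|Cst| / e <= B by rewrite /B le_max lexx orbT.
  near=> n => j.
  have lB : expR (B ^+ 4) <= lambda n by near: n; exact: (cvgryPge _).1.
  have mn : `|alpha - m n| <= alpha / 2.
    by near: n; move/cvgrPdist_le: mP; apply; rewrite divr_gt0.
  have lnB : B ^+ 4 <= ln (lambda n) by rewrite -(expRK (B ^+ 4)) ler_ln ?posrE ?expR_gt0.
  have B0 : 0 <= B by apply: le_trans B1.
  have ln0 : 0 <= ln (lambda n) by apply: le_trans lnB; exact: exprn_ge0.
  pose s := Num.sqrt (Num.sqrt (ln (lambda n))).
  have s4 : s ^+ 4 = ln (lambda n).
    by rewrite /s (exprM _ 2 2) sqr_sqrtr ?sqrtr_ge0 // sqr_sqrtr.
  have Bs : B <= s by rewrite -(@ler_pXn2r _ 4) ?nnegrE ?sqrtr_ge0 // s4.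
  have lE : expR (s ^+ 4) = lambda n by rewrite s4 lnK // posrE.
  have [mu [rho H]] := dk n.
  have hm : ((alpha / 2)%:E <= mean_iso nu (kernel_pair (phi (lambda n))) (expR (s ^+ 4)) <= (2 * alpha)%:E)%E.
    rewrite lE -/(w n) mE !lee_fin; move: mn; rewrite ler_norml => /andP[? ?]; apply/andP; split; lra.
  have := err_small s (le_trans Bs0 Bs) mu rho _ H hm; rewrite lE -/(w n) => err.
  have := iso_prob_step nu (0 : 'rV[R]_d) (w01 n) (wC n) (mw n) (lambda_gt0 n) j.
  rewrite -!qE !qp mE -!EFinM => /le_trans st.
  have {}st := st _ (leeD (lexx _) err); rewrite -EFinD lee_fin in st.
  apply: le_trans st _; rewrite lerD2l.
  have s_gt0 : 0 < s by apply: lt_le_trans Bs; apply: lt_le_trans B1.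
  rewrite ler_pdivrMr // (le_trans (ler_norm _)) // mulrC -ler_pdivrMr //.
  exact: le_trans BC Bs.
rewrite (_ : (fun n => P n _) = (fun n => (p n k)%:E)); last by apply/funext => n; exact: qp.
apply: cvg_EFin; first exact: nearW.
exact: (@poisson_cvg R p m alpha halpha p0 m0 mP p_step p_mean p_le1 p_tail k).
Unshelve. all: by end_near.
Qed.
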